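(* Fix $1\le\delta\le 16$. The locally closed set $\mathcal{V}_\delta\subset X^\vee$ parametrizing quartic surfaces with $\delta$ nodes is smooth of the expected dimension $$\dim\mathcal{V}_\delta=34-\delta.$$ Assume $H\in\mathcal{V}_\delta$, so that $S:=X\cap H\subset\mathbb{P}^3$ is a quartic surface with $\delta$ nodes. Then for every sufficiently small ball $B\subseteq\mathbb{P}^\vee$ containing $H$, the variety $B\cap X^\vee$ is a divisor of $B$ with normal crossings.
   Context: Work over $\mathbb{C}$. $X\subset\mathbb{P}\cong\mathbb{P}^{34}$ is the Veronese variety, i.e. $\mathbb{P}^3$ embedded by the complete linear system $|\mathcal{O}_{\mathbb{P}^3}(4)|$ of quartic surfaces. Points $H$ of the dual space $\mathbb{P}^\vee\cong\mathbb{P}^{34}$ are hyperplanes of $\mathbb{P}$ and correspond to quartic surfaces $X\cap H\subset X\cong\mathbb{P}^3$. $X^\vee\subset\mathbb{P}^\vee$ is the dual hypersurface of $X$, which parametrizes singular quartics. A node is an ordinary double point (an $A_1$ surface singularity). $\mathcal{V}_\delta\subset X^\vee$ is the locally closed subset parametrizing quartic surfaces with $\delta$ nodes, i.e. whose singular locus consists of exactly $\delta$ points, all of them nodes. Balls are taken in the classical (analytic) topology, and ''normal crossings'' is meant in the analytic sense: at each point the divisor is given in suitable local analytic coordinates by $t_1\cdots t_k=0$ for some $k$. *)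

(* Defs.v *)
From HB Require Import structures.
From mathcomp Require Import all_boot all_order all_algebra.
From mathcomp Require Import complex.
From mathcomp Require mpoly.
From mathcomp Require Import boolp classical_sets functions cardinality.

Set Implicit Arguments.
Unset Strict Implicit.
Unset Printing Implicit Defensive.

Import Order.TTheory GRing.Theory Num.Theory.
Local Open Scope ring_scope.

(* A module, because the notations of mpoly and of the analysis library cannot
   be imported together. *)
Module Algebraic.
Import mpoly.
Local Open Scope classical_set_scope.
Local Open Scope ring_scope.

(* P^n over K: the lines of K^(n+1). *)
Definition projspace (K : fieldType) (n : nat) : Type :=
  {L : {vspace 'rV[K]_n.+1} | \dim L == 1%N}.

(* Homogeneous coordinates of a point, i.e. a chosen nonzero vector of the
   line.  Every use below is invariant under rescaling this vector. *)
Definition hcoord (K : fieldType) (n : nat) (p : projspace K n) : 'rV[K]_n.+1 :=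
  vpick (val p).

Lemma hcoord_in (K : fieldType) (n : nat) (p : projspace K n) :
  hcoord p \in val p.
Proof. exact: memv_pick. Qed.

Lemma hcoord_neq0 (K : fieldType) (n : nat) (p : projspace K n) : hcoord p != 0.
Proof. by rewrite vpick0 -dimv_eq0; case: p => L /= /eqP ->. Qed.

Definition line_of (K : fieldType) (n : nat) (v : 'rV[K]_n.+1) (v0 : v != 0) :
  projspace K n.
Proof. by exists <[v]>%VS; rewrite dim_vline v0. Defined.

(* (y_0, ..., y_(n-1)) |-> [y_0 : ... : 1 : ... : y_(n-1)], 1 in position i *)
Definition affine_vec (K : fieldType) (n : nat) (i : 'I_n.+1) (y : 'rV[K]_n) :
    'rV[K]_n.+1 :=
  \row_j (if unlift i j is Some k then y ord0 k else 1).

Lemma affine_vec_neq0 (K : fieldType) (n : nat) (i : 'I_n.+1) (y : 'rV[K]_n) :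
  affine_vec i y != 0.
Proof.
apply/eqP => /rowP /(_ i); rewrite !mxE unlift_none => /eqP.
by rewrite oner_eq0.
Qed.

Definition affine_chart (K : fieldType) (n : nat) (i : 'I_n.+1)
    (y : 'rV[K]_n) : projspace K n :=
  line_of (affine_vec_neq0 i y).

Definition affine_coord (K : fieldType) (n : nat) (i : 'I_n.+1)
    (p : projspace K n) : 'rV[K]_n :=
  \row_k (hcoord p ord0 (lift i k) / hcoord p ord0 i).

Definition eval_at (K : fieldType) (n : nat) (F : {mpoly K[n]})
    (x : 'rV[K]_n) : K :=
  F.@[fun j => x ord0 j].

Definition zariski_closed (K : fieldType) (n : nat) (Z : set (projspace K n)) :
    Prop :=
  exists Fs : set {mpoly K[n.+1]},
    (forall F, Fs F -> exists d : nat, F \is d.-homog) /\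
    Z = [set p | forall F, Fs F -> eval_at F (hcoord p) = 0].

Definition zariski_locally_closed (K : fieldType) (n : nat)
    (V : set (projspace K n)) : Prop :=
  exists Z1 Z2 : set (projspace K n),
    [/\ zariski_closed Z1, zariski_closed Z2 & V = Z1 `\` Z2].

(* F is meant to be a form. *)
Definition singular_locus (K : fieldType) (n : nat) (F : {mpoly K[n.+1]}) :
    set (projspace K n) :=
  [set p | eval_at F (hcoord p) = 0 /\
           forall j, eval_at (F^`M(j)) (hcoord p) = 0].

Definition dehomogenize (K : fieldType) (n : nat) (i : 'I_n.+1)
    (F : {mpoly K[n.+1]}) : {mpoly K[n]} :=
  F \mPo [tuple (if unlift i j is Some k then 'X_k else 1) | j < n.+1].

Definition hessian (K : fieldType) (n : nat) (f : {mpoly K[n]})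
    (x : 'rV[K]_n) : 'M[K]_n :=
  \matrix_(a, b) eval_at (f^`M(a)^`M(b)) x.

(* Ordinary double point: in an affine chart around p, the local equation of
   the hypersurface has no terms of degree 0 and 1 at p and a nondegenerate
   quadratic part. *)
Definition is_node (K : fieldType) (n : nat) (F : {mpoly K[n.+1]})
    (p : projspace K n) : Prop :=
  exists i : 'I_n.+1, hcoord p ord0 i != 0 /\
    let f := dehomogenize i F in
    let x := affine_coord i p in
    [/\ eval_at f x = 0,
        forall a, eval_at (f^`M(a)) x = 0
      & \det (hessian f x) != 0].

(* The 35 exponent vectors of the quartic monomials in x_0, ..., x_3. *)
Definition quartic_exponents : seq (seq nat) :=
  [seq e <- [seq [:: ab.1; ab.2; c; 4 - ab.1 - ab.2 - c]%N |
              ab <- allpairs pair (iota 0 5) (iota 0 5), c <- iota 0 5]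
         | sumn e == 4%N].

Lemma size_quartic_exponents : size quartic_exponents = 35%N.
Proof. by []. Qed.

Lemma uniq_quartic_exponents : uniq quartic_exponents.
Proof. by []. Qed.

(* The homogeneous coordinates of the Veronese embedding P^3 -> P^34. *)
Definition veronese (K : fieldType) (j : 'I_35) : {mpoly K[4]} :=
  'X_[[multinom nth 0%N (nth [::] quartic_exponents j) k | k < 4]].

(* A point H of the dual projective space is the hyperplane
   sum_j h_j z_j = 0, h := hcoord H.  Pulled back along the Veronese embedding
   it is the following quartic form, the equation of X :&: H in P^3. *)
Definition quartic_of (K : fieldType) (H : projspace K 34) : {mpoly K[4]} :=
  \sum_j hcoord H ord0 j *: veronese K j.

(* X^dual: the hyperplanes tangent to X, i.e. containing the embedded tangent
   space of X at some point, the span of the partial derivatives of the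
   Veronese parametrization (it contains the point, by Euler's formula). *)
Definition dual_variety (K : fieldType) : set (projspace K 34) :=
  [set H | exists p : projspace K 3, forall k : 'I_4,
     \sum_j hcoord H ord0 j * eval_at ((veronese K j)^`M(k)) (hcoord p) = 0].

Definition nodal_quartics (K : fieldType) (delta : nat) : set (projspace K 34) :=
  [set H | [/\ dual_variety H,
               (singular_locus (quartic_of H) #= `I_delta)%card
             & forall p, singular_locus (quartic_of H) p ->
                         is_node (quartic_of H) p]].

Arguments dual_variety : clear implicits.
Arguments nodal_quartics : clear implicits.

End Algebraic.
Export Algebraic.

From mathcomp Require Import all_classical all_reals all_analysis.
Import numFieldNormedType.Exports.
Local Open Scope classical_set_scope.
Local Open Scope ring_scope.

Definition Cplx (R : realType) : numClosedFieldType := R[i].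

(* The topology of 'rV[Cplx R]_n is the product (classical) topology, and
   "differentiable" is complex (Frechet) differentiability, which on an open
   set is holomorphy. *)
Definition holomorphic_on (R : realType) (n : nat)
    (U : set 'rV[Cplx R]_n) (f : 'rV[Cplx R]_n -> 'rV[Cplx R]_n) : Prop :=
  forall z, U z -> differentiable f z.

(* t = (t_0, ..., t_(n-1)) is a system of analytic coordinates, centered at q,
   on the open neighbourhood U of q: a biholomorphism from U onto an open set. *)
Definition analytic_coordinates (R : realType) (n : nat) (q : 'rV[Cplx R]_n)
    (U : set 'rV[Cplx R]_n) (t : 'rV[Cplx R]_n -> 'rV[Cplx R]_n) : Prop :=
  [/\ open U, U q, t q = 0, holomorphic_on U t
    & exists s : 'rV[Cplx R]_n -> 'rV[Cplx R]_n,
        [/\ open (t @` U), holomorphic_on (t @` U) s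
          & forall z, U z -> s (t z) = z]].

(* A is a nonempty complex submanifold of P^n, of dimension d at each of its
   points.  A Zariski locally closed subset of P^n, with its reduced structure,
   is a smooth variety of pure dimension d iff it has this property. *)
Definition smooth_of_dim (R : realType) (n : nat) (A : set (projspace (Cplx R) n))
    (d : nat) : Prop :=
  [/\ (d <= n)%N, A !=set0 &
    forall (i : 'I_n.+1) (y : 'rV[Cplx R]_n), A (affine_chart i y) ->
      exists U t, analytic_coordinates y U t /\
        forall z, U z ->
          (A (affine_chart i z) <->
           forall k : 'I_n, (d <= k)%N -> t z ord0 k = 0)].

(* D is a divisor of the open set B with (analytic) normal crossings: around
   each point of B, for some k, it is given by t_0 * ... * t_(k-1) = 0 in
   suitable coordinates (k = 0 off D). *)
Definition normal_crossings (R : realType) (n : nat)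
    (B D : set 'rV[Cplx R]_n) : Prop :=
  D `<=` B /\
  forall q, B q ->
    exists U t (k : nat), [/\ analytic_coordinates q U t, U `<=` B, (k <= n)%N
      & forall z, U z ->
          (D z <-> \prod_(j < n | (j < k)%N) t z ord0 j = 0)].

(* Euclidean ball; the library's ball on 'rV is a polydisc. *)
Definition euclidean_ball (R : realType) (n : nat) (c : 'rV[Cplx R]_n) (r : R) :
    set 'rV[Cplx R]_n :=
  [set z : 'rV[Cplx R]_n |
     \sum_j `|z ord0 j - c ord0 j| ^+ 2 < ((r ^+ 2)%:C)%C :> Cplx R].

(* Main.v *)
(** Let F be a quartic form with nodes P_1, ..., P_m.

    The nodes impose independent conditions on quartics.  Write the differences
    of gradients as F'(x) - F'(p) = Delta(x, p) (x - p), with Delta quadratic.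
    From a relation sum_i c_i q(P_i) = 0 between the evaluations of quartics q,
    expanding along one row a determinant built from Delta(x, P_i) yields a matrix
    M <> 0 such that sum_jk M_jk x_k F_j(x) = 0, an infinitesimal symmetry of F.
    The eigenvectors of M of maximal modulus are singular points of F; the
    nondegeneracy of the Hessian there determines the trace of M, makes M
    nilpotent, and finally gives M = 0.

    By the implicit function theorem a node P_i extends to a critical point of the
    nearby quartics, with critical value t_i.  The differential of t_i is the
    evaluation at P_i, so that t_1, ..., t_m are part of a system of coordinates.
    By the projective Nullstellensatz the Jacobian ideal of F contains all forms
    of large degree vanishing at the nodes; hence the singular points of the
    nearby quartics are close to the nodes of F, and they are the critical points
    with t_i = 0.  Near F the dual variety is therefore t_1 ... t_m = 0, and the
    quartics with k nodes are those for which exactly k of the t_i vanish.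
    Deforming the 16 nodes of a Kummer quartic shows that all strata are nonempty. *)

Require Import Defs.
From HB Require Import structures.
From mathcomp Require Import all_boot all_order all_algebra fingroup perm spectral.
From mathcomp Require Import complex.
From mathcomp Require Import boolp classical_sets functions cardinality reals.
From mathcomp Require mpoly.
From mathcomp Require Import ring lra zify.

Set Implicit Arguments.
Unset Strict Implicit.
Unset Printing Implicit Defensive.

Import Order.TTheory GRing.Theory Num.Theory.
Local Open Scope ring_scope.

(** Independence rests on a degree count. A minor made of three quadratic rows of Delta(x, p) and
    one constant row h has total degree 6 in x and p. Normalize the nodes by h(p) = 1, for a linear
    form h that vanishes at none of them. The part of degree k + 2 in x has degree 4 - k in p, and
    the factor h(p)^k turns it into a quartic in p, which the relation kills. What survives is
    affine in x, and h makes it linear: this is the matrix M.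

    The strata are Zariski locally closed because being non-nodal or having at least k singular
    points is a closed condition. Outside that set a graded piece of an ideal built from the
    partials has small codimension; a determinant in the coefficients of the quartic expresses that
    this persists nearby.

    Singular points of nearby quartics are kept near the nodes without a compactness argument:
    membership in the Jacobian ideal turns into an explicit inequality, which bounds a product of
    distances to the nodes by the distance of the two quartics. *)

Module QuarticForms.
Import mpoly.

(** * Homogeneous polynomials: derivatives, Euler's formula, scaling *)

Section Forms.
Variables (K : numClosedFieldType) (n : nat).
Implicit Types (F q : {mpoly K[n]}) (x v : 'rV[K]_n) (d : nat).

Lemma mderiv_homog d F i : F \is d.+1.-homog -> F^`M(i) \is d.-homog.
Proof.
move=> /dhomogP hF; rewrite [F]mpolyE raddf_sum.
rewrite big_seq_cond; apply: rpred_sum => m /andP[mF _].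
rewrite /= mderivZ mderivX; have : mdeg m = d.+1 by exact: hF.
have [->|mi0] := eqVneq (m i) 0%N; first by rewrite scale0r scaler0 rpred0.
move=> dm; rewrite 2?rpredZ // dhomogX; apply/eqP.
have := @submK _ U_(i)%MM m.
by rewrite lep1mP => /(_ mi0) /(congr1 mdeg); rewrite mdegD mdeg1 dm addn1 => -[].
Qed.

Lemma euler d F : F \is d.-homog -> \sum_j 'X_j * F^`M(j) = d%:R *: F.
Proof.
move=> /dhomogP hF; rewrite [in RHS](mpolyE F) scaler_sumr.
under eq_bigr => j _ do rewrite {1}(mpolyE F) raddf_sum mulr_sumr.
rewrite exchange_big /= big_seq_cond [RHS]big_seq_cond; apply: eq_bigr => m /andP[mF _].
have <- : mdeg m = d by exact: hF.
rewrite mdegE natr_sum scaler_suml; apply: eq_bigr => j _.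
rewrite /= mderivZ mderivX -scalerAr -scalerAr -mpolyXD.
have [->|mj0] := eqVneq (m j) 0%N; first by rewrite !scale0r !scaler0.
by rewrite addmC submK ?lep1mP // scalerA mulrC -scalerA.
Qed.

Lemma eval_at_scale d F c v : F \is d.-homog ->
  eval_at F (c *: v) = c ^+ d * eval_at F v.
Proof.
move=> /dhomogP hF; rewrite /eval_at !mevalE mulr_sumr [LHS]big_seq [RHS]big_seq.
apply: eq_bigr => m mF; rewrite mulrCA; congr (_ * _).
have <- : mdeg m = d by exact: hF.
rewrite mdegE -prodrXr -big_split /=; apply: eq_bigr => j _.
by rewrite mxE exprMn.
Qed.

Lemma eval_euler d F v : F \is d.-homog ->
  \sum_j v ord0 j * eval_at F^`M(j) v = d%:R * eval_at F v.
Proof.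
move=> /euler /(congr1 (fun q => eval_at q v)); rewrite /eval_at mevalZ => <-.
by rewrite raddf_sum; apply: eq_bigr => j _; rewrite /= mevalM mevalXU.
Qed.

Lemma dhomog_X j : ('X_j : {mpoly K[n]}) \is 1.-homog.
Proof. by rewrite dhomogX; apply/eqP; exact: mdeg1. Qed.

End Forms.
End QuarticForms.

(** * A quartic whose singular points are nodes has no infinitesimal symmetry *)

Module InfinitesimalSymmetry.

(** Adjacent transpositions generate the symmetric group, so these axioms give full symmetry and
    linearity in every argument. The quartic is [Phi x x x x] up to the factor 24. *)
Record symtensor (K : fieldType) := Symtensor {
  tensor_fun :> 'rV[K]_4 -> 'rV[K]_4 -> 'rV[K]_4 -> 'rV[K]_4 -> K;
  tensor_lin : forall k a a' b c d,
    tensor_fun (k *: a + a') b c d = k * tensor_fun a b c d + tensor_fun a' b c d;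
  tensor12 : forall a b c d, tensor_fun a b c d = tensor_fun b a c d;
  tensor23 : forall a b c d, tensor_fun a b c d = tensor_fun a c b d;
  tensor34 : forall a b c d, tensor_fun a b c d = tensor_fun a b d c }.

(** The node condition at a singular point [p]: by Euler's formula the Hessian in all four variables
    kills [p], and for a node it kills nothing beyond the line of [p]. *)
Definition nondeg_kernel (K : fieldType) (Phi : symtensor K) (p : 'rV[K]_4) :=
  forall w, (forall x, Phi p p w x = 0) -> exists c, w = c *: p.

Section QuarticTensor.
Variables (K : numClosedFieldType) (Phi : symtensor K).
Notation Phi_lin := (tensor_lin Phi).
Notation Phi12 := (tensor12 Phi).
Notation Phi23 := (tensor23 Phi).
Notation Phi34 := (tensor34 Phi).

Lemma PhiD1 a a' b c d : Phi (a + a') b c d = Phi a b c d + Phi a' b c d.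
Proof. by have := Phi_lin 1 a a' b c d; rewrite scale1r mul1r. Qed.
Lemma Phi01 b c d : Phi 0 b c d = 0.
Proof. by have := Phi_lin (-1) 0 0 b c d; rewrite scaler0 addr0 mulN1r addNr. Qed.
Lemma PhiZ1 k a b c d : Phi (k *: a) b c d = k * Phi a b c d.
Proof. by have := Phi_lin k a 0 b c d; rewrite addr0 Phi01 addr0. Qed.
Lemma PhiD2 a b b' c d : Phi a (b + b') c d = Phi a b c d + Phi a b' c d.
Proof. by rewrite Phi12 PhiD1 Phi12 (Phi12 b'). Qed.
Lemma PhiZ2 k a b c d : Phi a (k *: b) c d = k * Phi a b c d.
Proof. by rewrite Phi12 PhiZ1 Phi12. Qed.
Lemma Phi02 a c d : Phi a 0 c d = 0.
Proof. by rewrite Phi12 Phi01. Qed.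
Lemma PhiD3 a b c c' d : Phi a b (c + c') d = Phi a b c d + Phi a b c' d.
Proof. by rewrite Phi23 PhiD2 Phi23 (Phi23 _ c'). Qed.
Lemma PhiZ3 k a b c d : Phi a b (k *: c) d = k * Phi a b c d.
Proof. by rewrite Phi23 PhiZ2 Phi23. Qed.
Lemma Phi03 a b d : Phi a b 0 d = 0.
Proof. by rewrite Phi23 Phi02. Qed.
Lemma PhiD4 a b c d d' : Phi a b c (d + d') = Phi a b c d + Phi a b c d'.
Proof. by rewrite Phi34 PhiD3 Phi34 (Phi34 _ _ d'). Qed.
Lemma PhiZ4 k a b c d : Phi a b c (k *: d) = k * Phi a b c d.
Proof. by rewrite Phi34 PhiZ3 Phi34. Qed.
Lemma Phi04 a b c : Phi a b c 0 = 0.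
Proof. by rewrite Phi34 Phi03. Qed.
Definition Phi0 := (Phi01, Phi02, Phi03, Phi04).

Variable M : 'M[K]_4.
Hypothesis symM : forall x, Phi (x *m M) x x x = 0.

(** This replaces differentiation along a line: the values at 1, -1 and 2 determine the
    coefficients. *)
Lemma cubic_zero (A B C : K) :
  (forall t : K, t * A + t ^+ 2 * B + t ^+ 3 * C = 0) -> A = 0 /\ B = 0.
Proof.
move=> h; have h1 := h 1; have h2 := h (-1); have h3 := h 2.
split.
  have -> : A = (1 * A + 1 ^+ 2 * B + 1 ^+ 3 * C)
   - (1%:R / 3) * ((-1) * A + (-1) ^+ 2 * B + (-1) ^+ 3 * C)
   - (1%:R / 6) * (2 * A + 2 ^+ 2 * B + 2 ^+ 3 * C) by field.
  by rewrite h1 h2 h3; ring.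
have -> : B = (1%:R / 2) * (1 * A + 1 ^+ 2 * B + 1 ^+ 3 * C)
   + (1%:R / 2) * ((-1) * A + (-1) ^+ 2 * B + (-1) ^+ 3 * C) by field.
by rewrite h1 h2; ring.
Qed.

(** The differential of [symM] at [a] in the direction [d]. Further polarization leads to [polar],
    which says that the action of [M] as a derivation annihilates [Phi]. *)
Lemma polar_aaa a d : 3 * Phi (a *m M) a a d + Phi a a a (d *m M) = 0.
Proof.
pose A := 3 * Phi (a *m M) a a d + Phi (d *m M) a a a.
pose B := 3 * Phi (d *m M) a a d + 3 * Phi (a *m M) a d d.
pose C := 3 * Phi (d *m M) a d d + Phi (a *m M) d d d.
have [] := @cubic_zero A B C.
  move=> t; have := symM (a + t *: d).
  rewrite mulmxDl -scalemxAl !(PhiD1, PhiD2, PhiD3, PhiD4, PhiZ1, PhiZ2, PhiZ3, PhiZ4).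
  rewrite !symM !(Phi34 _ _ d a) !(Phi23 _ d a) !(Phi34 _ _ d a) /A /B /C => <-.
  by ring.
by rewrite /A => <- _; rewrite (Phi12 (d *m M)) (Phi23 a (d *m M)) (Phi34 a a (d *m M)).
Qed.

Lemma polar_aab a b d :
  2 * Phi (a *m M) a b d + Phi a a (b *m M) d + Phi a a b (d *m M) = 0.
Proof.
pose A := 3 * (2 * Phi (a *m M) a b d + Phi (b *m M) a a d + Phi (d *m M) a a b).
pose B := 3 * (2 * Phi (b *m M) a b d + Phi (a *m M) b b d + Phi (d *m M) a b b).
have [] := @cubic_zero A B (3 * Phi (b *m M) b b d + Phi (d *m M) b b b).
  move=> t; have := polar_aaa (a + t *: b) d.
  have ea := polar_aaa a d; rewrite (Phi34 a) (Phi23 a) (Phi12 a) in ea.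
  rewrite (Phi34 (a + _)) (Phi23 (a + _)) (Phi12 (a + _)).
  rewrite mulmxDl -scalemxAl !(PhiD1, PhiD2, PhiD3, PhiD4, PhiZ1, PhiZ2, PhiZ3, PhiZ4).
  rewrite !(Phi34 _ _ b a) !(Phi23 _ b a) !(Phi34 _ _ b a) /A /B => eb.
  by rewrite -[RHS](subr0 0) -{1}eb -ea; ring.
rewrite /A => /eqP; rewrite mulf_eq0 pnatr_eq0 /= => /eqP <- _.
by rewrite (Phi12 (b *m M)) (Phi23 a (b *m M)) (Phi12 (d *m M)) (Phi23 a (d *m M)) (Phi34 a a (d *m M)).
Qed.

Lemma polar a b c d :
  Phi (a *m M) b c d + Phi a (b *m M) c d + Phi a b (c *m M) d + Phi a b c (d *m M) = 0.
Proof.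
have := polar_aab (a + b) c d.
rewrite mulmxDl !(PhiD1, PhiD2).
have ea := polar_aab a c d; have eb := polar_aab b c d.
have -> : Phi b a (c *m M) d = Phi a b (c *m M) d by rewrite Phi12.
have -> : Phi b a c (d *m M) = Phi a b c (d *m M) by rewrite Phi12.
have -> : Phi (b *m M) a c d = Phi a (b *m M) c d by rewrite Phi12.
move=> e; apply: (@mulfI K 2); first by rewrite pnatr_eq0.
by rewrite mulr0 -[RHS](subr0 0) -{1}e -(addr0 0) -{1}ea -eb; ring.
Qed.

Lemma polar_abb a b d :
  Phi (a *m M) b b d + 2 * Phi a (b *m M) b d + Phi a b b (d *m M) = 0.
Proof. by have := polar a b b d; rewrite (Phi23 a b) => <-; ring. Qed.

(** Give [u], [w], [v], [p] the levels 0 to 3, and likewise [y], [z], [q], [s]; then [M] raises the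
    level by one. The equations [e0] to [e7] are eight linear relations between eight values of
    [Phi] of total level 8, and the final coefficients solve them for [Phi v v v q]. *)
Lemma chain4_vvvq u y (w := u *m M) (v := w *m M) (p := v *m M)
    (z := y *m M) (q := z *m M) (s := q *m M) :
  p *m M = 0 -> s *m M = 0 -> Phi v v v q = 0.
Proof.
move=> pM sM.
have [Dw [Dv Dp]] : w = u *m M /\ v = w *m M /\ p = v *m M by [].
have [Dz [Dq Ds]] : z = y *m M /\ q = z *m M /\ s = q *m M by [].
move: w v p z q s Dw Dv Dp Dz Dq Ds pM sM => w v p z q s Dw Dv Dp Dz Dq Ds pM sM.
have e0 : Phi p p v y + Phi p p w z = 0.
  by have := polar_aab p w y; rewrite -?Dw -?Dv -?Dp -?Dz -?Dq -?Ds ?pM ?sM ?Phi0; rewrite ?mulr0 ?add0r ?addr0.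
have e1 : Phi p p w z + Phi p p u q = 0.
  by have := polar_aab p u z; rewrite -?Dw -?Dv -?Dp -?Dz -?Dq -?Ds ?pM ?sM ?Phi0; rewrite ?mulr0 ?add0r ?addr0.
have e2 : 2 * Phi p p v y + Phi p v v z = 0.
  by have := polar_abb p v y; rewrite -?Dw -?Dv -?Dp -?Dz -?Dq -?Ds ?pM ?sM ?Phi0; rewrite ?mulr0 ?add0r ?addr0.
have e3 : Phi p p w z + Phi p v v z + Phi p v w q = 0.
  by have := polar p v w z; rewrite -?Dw -?Dv -?Dp -?Dz -?Dq -?Ds ?pM ?sM ?Phi0; rewrite ?mulr0 ?add0r ?addr0.
have e4 : Phi p p u q + Phi p v w q + Phi p v u s = 0.
  by have := polar p v u q; rewrite -?Dw -?Dv -?Dp -?Dz -?Dq -?Ds ?pM ?sM ?Phi0; rewrite ?mulr0 ?add0r ?addr0.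
have e5 : 2 * Phi p v w q + Phi p w w s = 0.
  by have := polar_abb p w q; rewrite -?Dw -?Dv -?Dp -?Dz -?Dq -?Ds ?pM ?sM ?Phi0; rewrite ?mulr0 ?add0r ?addr0.
have e6 : Phi p v u s + Phi p w w s = 0.
  by have := polar p w u s; rewrite -?Dw -?Dv -?Dp -?Dz -?Dq -?Ds ?pM ?sM ?Phi0; rewrite ?mulr0 ?add0r ?addr0.
have e7 : 3 * Phi p v v z + Phi v v v q = 0.
  by have := polar_aaa v z; rewrite -?Dw -?Dv -?Dp -?Dz -?Dq -?Ds ?pM ?sM ?Phi0; rewrite ?mulr0 ?add0r ?addr0.
have -> : Phi v v v q = (12 / 5) * (Phi p p v y + Phi p p w z)
    + - (3 / 5) * (Phi p p w z + Phi p p u q)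
    + - (6 / 5) * (2 * Phi p p v y + Phi p v v z)
    + - (9 / 5) * (Phi p p w z + Phi p v v z + Phi p v w q)
    + (3 / 5) * (Phi p p u q + Phi p v w q + Phi p v u s)
    + (3 / 5) * (2 * Phi p v w q + Phi p w w s)
    + - (3 / 5) * (Phi p v u s + Phi p w w s)
    + (3 * Phi p v v z + Phi v v v q).
  by field.
by rewrite e0 e1 e2 e3 e4 e5 e6 e7; ring.
Qed.

(** The same elimination for chains of length three, in total level 5, where two relations
    suffice. *)
Lemma chain3_vvvq u y (v := u *m M) (p := v *m M) (z := y *m M) (q := z *m M) :
  p *m M = 0 -> q *m M = 0 -> Phi v v v q = 0.
Proof.
move=> pM qM.
have e1 := polar u v v q; have e2 := polar_aab u p q.
rewrite pM qM !Phi0 !addr0 in e1 e2.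
have e3 : Phi u p v q = 0.
  move/eqP: e2; rewrite mulf_eq0 pnatr_eq0 /= => /eqP <-.
  by rewrite Phi12 -/v Phi23 Phi12 (Phi12 v u) Phi23 (Phi12 u) (Phi23 v) (Phi12 v).
by move: e1; rewrite -/v -/p (Phi23 u v) e3 !addr0.
Qed.

Hypothesis Phi_node : forall p, p != 0 -> (forall x, Phi p p p x = 0) ->
  nondeg_kernel Phi p.

Lemma Phi_sum4 a b c (x : 'rV[K]_4) :
  Phi a b c x = \sum_j x ord0 j * Phi a b c (delta_mx 0 j).
Proof.
rewrite {1}(row_sum_delta x) -[LHS]addr0 -[RHS]addr0.
elim/big_rec2: _ => [|j y1 y2 _ IH]; first by rewrite Phi04.
by rewrite PhiD4 PhiZ4 -addrA IH addrA.
Qed.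

Definition hess p : 'M[K]_4 := \matrix_(i, j) Phi p p (delta_mx 0 i) (delta_mx 0 j).

Lemma hessE p x y : (x *m hess p *m y^T) 0 0 = Phi p p x y.
Proof.
rewrite Phi_sum4 mxE; apply: eq_bigr => j _; rewrite [RHS]mulrC mxE; congr (_ * _).
rewrite Phi34 Phi_sum4; apply: eq_bigr => i _.
  by rewrite mxE Phi34.
by rewrite mxE.
Qed.

Lemma hess_ker p w : w *m hess p = 0 -> forall x, Phi p p w x = 0.
Proof. by move=> h x; rewrite -hessE h mul0mx mxE. Qed.

Lemma hess_sym p : (hess p)^T = hess p.
Proof. by apply/matrixP => i j; rewrite !mxE Phi34. Qed.

(** This is [polar_aab] at an eigenvector, read as an equation of matrices. *)
Lemma hess_symM p l : p *m M = l *: p ->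
  M *m hess p + hess p *m M^T = - (2 * l) *: hess p.
Proof.
move=> pM; apply/matrixP => i j.
have e (A : 'M[K]_4) : A i j = ((delta_mx 0 i : 'rV_4) *m A *m (delta_mx 0 j : 'rV_4)^T) 0 0.
  by rewrite -rowE trmx_delta -colE !mxE.
rewrite [LHS]e mulmxDr mulmxDl [LHS]mxE [RHS]mxE [in RHS]e hessE.
have -> : (delta_mx 0 i : 'rV_4) *m (M *m hess p) *m (delta_mx 0 j)^T
   = (delta_mx 0 i *m M) *m hess p *m (delta_mx 0 j : 'rV_4)^T by rewrite !mulmxA.
have -> : (delta_mx 0 i : 'rV_4) *m (hess p *m M^T) *m (delta_mx 0 j)^T
   = delta_mx 0 i *m hess p *m (delta_mx 0 j *m M : 'rV_4)^T.
  by rewrite trmx_mul !mulmxA.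
rewrite !hessE; have := polar_aab p (delta_mx 0 i) (delta_mx 0 j).
by rewrite pM PhiZ1 -addrA => /eqP; rewrite addr_eq0 => /eqP h; rewrite -[LHS]opprK -h; ring.
Qed.

(** Were the Hessian Q invertible, the trace of [hess_symM] times Q^-1 would give the trace of [M].
    Since Q has kernel spanned by [p], it is replaced by J = Q + e e^T, where p e = 1. The
    correction terms contribute 2l + l + l, so that 2 tr M = -8l + 4l. *)
Lemma node_trace p l : p != 0 -> p *m M = l *: p -> (forall x, Phi p p p x = 0) ->
  \tr M = - (2 * l).
Proof.
move=> p0 pM psing.
have [i pi0] : exists i, p 0 i != 0 by apply/rV0Pn.
have [e pe] : exists e : 'cV[K]_4, p *m e = 1%:M.
  exists ((p 0 i)^-1 *: delta_mx i 0).
  apply/matrixP => a b; rewrite !ord1 -scalemxAr -colE !mxE eqxx mulVf //.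
have pQ : p *m hess p = 0.
  apply/rowP => j; have := hessE p p (delta_mx 0 j).
  by rewrite psing trmx_delta -colE mxE => ->; rewrite mxE.
pose J := hess p + e *m e^T.
have pJ : p *m J = e^T by rewrite mulmxDr pQ add0r mulmxA pe mul1mx.
have JT : J^T = J by rewrite linearD /= hess_sym trmx_mul trmxK.
have Ju : J \in unitmx.
  rewrite -row_free_unit -kermx_eq0; apply/rowV0P => x /sub_kermxP xJ.
  have xe : x *m e = 0.
    have := congr1 (fun z => z *m p^T) xJ; rewrite mul0mx -mulmxA -{1}JT -trmx_mul pJ.
    by rewrite trmxK.
  have xQ : x *m hess p = 0 by move: xJ; rewrite mulmxDr mulmxA xe mul0mx addr0.
  have [c xc] := Phi_node p0 psing (hess_ker xQ).
  have : x *m e = c%:M by rewrite xc -scalemxAl pe scalemx1.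
  by rewrite xe xc => /matrixP /(_ 0 0); rewrite !mxE eqxx mulr1n => <-; rewrite scale0r.
have pJ1 : e^T *m invmx J = p by rewrite -pJ mulmxK.
have h : M *m J + J *m M^T
   = - (2 * l) *: J + (2 * l) *: (e *m e^T) + M *m e *m e^T + e *m e^T *m M^T.
  rewrite mulmxDr mulmxDl addrACA (hess_symM pM) /J scalerDr !mulmxA -!addrA.
  by congr (_ + _); rewrite addrA -scalerDl addNr scale0r add0r.
clearbody J.
have := congr1 (fun z => \tr (z *m invmx J)) h.
rewrite !mulmxDl -!scalemxAl !mulmxK ?mulmxV // !linearD !linearZ /= mxtrace1.
rewrite -!(mulmxA _ e^T) pJ1.
have t1 : \tr (J *m M^T *m invmx J) = \tr M.
  by rewrite mxtrace_mulC mulmxA mulVmx // mul1mx mxtrace_tr.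
have t2 : \tr (e *m p) = 1 by rewrite mxtrace_mulC pe mxtrace1.
have t3 : \tr (M *m e *m p) = l.
  by rewrite mxtrace_mulC mulmxA pM -scalemxAl linearZ /= pe mxtrace1 mulr1.
have t4 : \tr (e *m (e^T *m M^T) *m invmx J) = l.
  rewrite -mxtrace_tr !trmx_mul !trmxK trmx_inv JT mxtrace_mulC.
  by rewrite -mulmxA pJ1 t3.
rewrite t1 t2 t3 t4.
move=> h2; have -> : \tr M = (1%:R / 2) * (\tr M + \tr M) by field.
by rewrite h2; field.
Qed.

(** The gradient at [p] satisfies M g = -3l g. Were it nonzero, [M] would have an eigenvalue of
    modulus larger than the maximum. *)
Lemma eigenvalue_sing l p : (forall i, eigenvalue M i -> `|i| <= `|l|) -> l != 0 ->
  p *m M = l *: p -> forall x, Phi p p p x = 0.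
Proof.
move=> lmax l0 pM.
pose g : 'cV[K]_4 := \col_j Phi p p p (delta_mx 0 j).
have gE x : (x *m g) 0 0 = Phi p p p x.
  by rewrite Phi_sum4 mxE; apply: eq_bigr => j _; rewrite mxE.
have Mg : M *m g = (- (3 * l)) *: g.
  apply/matrixP => i j; rewrite ord1 !mxE.
  have -> : \sum_j0 M i j0 * g j0 0 = Phi p p p (delta_mx 0 i *m M).
    by rewrite -gE -mulmxA -rowE !mxE.
  have := polar_aaa p (delta_mx 0 i); rewrite pM PhiZ1 => /eqP.
  by rewrite addrC addr_eq0 => /eqP ->; ring.
move=> x; rewrite -gE; have [->|g0] := eqVneq g 0; first by rewrite mulmx0 mxE.
have /lmax : eigenvalue M (- (3 * l)).
  have : eigenvalue M^T (- (3 * l)).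
    apply/eigenvalueP; exists g^T; first by rewrite -trmx_mul Mg linearZ.
    by rewrite -(inj_eq (@trmx_inj _ _ _)) trmxK trmx0.
  rewrite !eigenvalue_root_char /char_poly /char_poly_mx -map_trmx.
  by rewrite -[X in root X _ -> _]det_tr linearB /= trmxK tr_scalar_mx.
rewrite normrN normrM normr_nat -subr_ge0.
have -> : `|l| - 3 * `|l| = - (2 * `|l|) by ring.
by rewrite oppr_ge0 pmulr_rle0 ?ltr0n // normr_le0 (negPf l0).
Qed.

Lemma max_norm_exists n (f : 'I_n.+1 -> K) : exists i, forall j, `|f j| <= `|f i|.
Proof.
elim: n f => [|n IH] f; first by exists ord0 => j; rewrite ord1.
have [i hi] := IH (fun k => f (lift ord0 k)).
have [h|h] := real_leP (normr_real (f ord0)) (normr_real (f (lift ord0 i))).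
  by exists (lift ord0 i) => j; case: (unliftP ord0 j) => [k ->|->].
exists ord0 => j; case: (unliftP ord0 j) => [k ->|->] //.
exact: le_trans (hi k) (ltW h).
Qed.

(** Suppose that an eigenvalue l of maximal modulus is nonzero. The trace is -2l, so the other three
    eigenvalues add up to -3l; their moduli are at most that of l, and the equality case of the
    triangle inequality makes them all equal to -l. Then -l is of maximal modulus too, and the trace
    is also 2l. *)
Lemma symmetry_nilpotent : M ^+ 4 = 0.
Proof.
have [s Ds] := closed_field_poly_normal (char_poly M).
rewrite (monicP (char_poly_monic M)) scale1r in Ds.
have s4 : size s = 4%N.
  by have := size_char_poly M; rewrite Ds size_prod_XsubC => -[].
pose r (i : 'I_4) := s`_i.
have tr : \tr M = \sum_i r i.
  have := @char_poly_trace _ 4 M isT.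
  have := @coefPn_prod_XsubC _ s; rewrite s4 -Ds => /(_ isT) -> /oppr_inj <-.
  by rewrite (big_nth 0) s4 big_mkord.
have eigE l : eigenvalue M l = (l \in s) by rewrite eigenvalue_root_char Ds root_prod_XsubC.
have eigr i : eigenvalue M (r i) by rewrite eigE mem_nth // s4.
have [i0 hi0] := max_norm_exists r.
have lmax l : eigenvalue M l -> `|l| <= `|r i0|.
  rewrite eigE => /(nthP 0) [j]; rewrite s4 => j4 <-; exact: (hi0 (Ordinal j4)).
have trE l : eigenvalue M l -> `|l| = `|r i0| -> l != 0 -> \tr M = - (2 * l).
  move=> /eigenvalueP [p pM p0] ln l0; apply: (node_trace p0 pM).
  by apply: eigenvalue_sing l0 pM => i /lmax; rewrite ln.
have r0 : r i0 = 0.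
  apply: contraTeq isT => l0; set l := r i0 in l0 hi0 lmax trE *.
  have t1 := trE l (eigr i0) erefl l0.
  have hs : \sum_(i | i != i0) (- r i / l) = \sum_(i | i != i0) (1 : K).
    rewrite -mulr_suml sumrN; move: tr; rewrite (bigD1 i0) //= -/l t1 => h.
    have -> : \sum_(i | i != i0) r i = - (3 * l) by rewrite -[LHS](addKr l) -h; ring.
    rewrite opprK mulfK // sumr_const cardC1 card_ord //.
  have := normC_sum_upper (F := fun i => - r i / l) (G := fun=> 1) _ hs.
  have hle i : i != i0 -> `|- r i / l| <= 1.
    by move=> _; rewrite normrM normrN normfV ler_pdivrMr ?normr_gt0 // mul1r.
  move=> /(_ hle) h1.
  have [i1 ii1] : exists i1 : 'I_4, i1 != i0.
    by exists (lift i0 0); rewrite eq_sym neq_lift.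
  have r1 : r i1 = - l.
    have /(canRL (mulfVK l0)) := h1 _ ii1.
    by rewrite mul1r => /eqP; rewrite eqr_oppLR => /eqP.
  have := trE (- l); rewrite -r1 eigr r1 normrN oppr_eq0 l0 => /(_ isT erefl isT).
  rewrite t1 => /eqP; rewrite -subr_eq0.
  have -> : - (2 * l) - - (2 * - l) = - (4 * l) by ring.
  by rewrite oppr_eq0 mulf_eq0 pnatr_eq0 (negPf l0).
have sz : s = nseq 4 0.
  rewrite -s4; apply/all_pred1P/allP => x; rewrite -eigE => /lmax.
  by rewrite r0 normr0 normr_le0.
have := Cayley_Hamilton M; rewrite Ds sz big_nseq subr0 /=.
by rewrite !rmorphM /= rmorph1 horner_mx_X mulr1 -!expr2 -!exprS.
Qed.

(** The last hypothesis makes [p] singular with [v] in the kernel of its Hessian. Then [v] is a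
    multiple of [p], and its image [p] under [M] is zero. *)
Lemma chain_end p v : v *m M = p -> p *m M = 0 -> p != 0 ->
  (forall x : 'rV_4, Phi v v v (x *m M *m M) = 0) -> False.
Proof.
move=> vM pM p0 h.
have n0 m : (m.+1%:R : K) != 0 by rewrite pnatr_eq0.
have e1 x : Phi p v v (x *m M) = 0.
  have /eqP := polar_aaa v (x *m M); rewrite h addr0 vM.
  by rewrite mulf_eq0 (negPf (n0 2%N)) => /eqP.
have e2 x : Phi p p v x = 0.
  have /eqP := polar_abb p v x; rewrite pM Phi0 add0r vM e1 addr0.
  by rewrite mulf_eq0 (negPf (n0 1%N)) => /eqP.
have e3 x : Phi p p p x = 0.
  by have := polar_aab p v x; rewrite pM Phi0 mulr0 add0r vM e2 addr0.
have [c vc] := Phi_node p0 e3 e2.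
by move: p0; rewrite -vM vc -scalemxAl pM scaler0 eqxx.
Qed.

Theorem no_infinitesimal_symmetry : M = 0.
Proof.
have M4 : M *m M *m M *m M = 0 by have := symmetry_nilpotent; rewrite !exprSr expr0 mul1r.
have nz (A : 'M[K]_4) : A != 0 -> exists u : 'rV_4, u *m A != 0.
  move=> /eqP A0; case: (pselect (exists u : 'rV_4, u *m A != 0)) => // h; case: A0.
  apply/row_matrixP => i; rewrite rowE row0; apply/eqP; apply: contra_notT h => h.
  by exists (delta_mx 0 i).
case: (eqVneq M 0) => // M0; exfalso.
(* The nilpotency index is 2, 3 or 4. In each case the last two vectors of a Jordan chain of maximal
   length contradict [chain_end]. *)
have [M2|/nz [u]] := eqVneq (M *m M) 0.
  have [v v0] := nz _ M0; apply: (@chain_end (v *m M) v) => //.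
    by rewrite -mulmxA M2 mulmx0.
  by move=> x; rewrite -mulmxA M2 mulmx0 Phi0.
have [M3|/nz [t t0] _] := eqVneq (M *m M *m M) 0.
  move=> u0; apply: (@chain_end (u *m M *m M) (u *m M)); rewrite -?mulmxA //.
    by rewrite [M *m (M *m M)]mulmxA M3 mulmx0.
  move=> x; apply: chain3_vvvq.
    by rewrite -2!mulmxA [M *m (M *m M)]mulmxA M3 mulmx0.
  by rewrite -2!mulmxA [M *m (M *m M)]mulmxA M3 mulmx0.
rewrite !mulmxA in t0.
have tM x : x *m M *m M *m M *m M = 0 :> 'rV_4.
  by rewrite -!mulmxA [M *m (M *m _)]mulmxA [M *m M *m (M *m M)]mulmxA M4 mulmx0.
apply: (@chain_end (t *m M *m M *m M) (t *m M *m M)) => //.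
by move=> x; apply: chain4_vvvq; apply: tM.
Qed.

End QuarticTensor.
End InfinitesimalSymmetry.

(** * From a relation between evaluations at nodes to an infinitesimal symmetry *)

Module NodeConditions.
Import mpoly QuarticForms InfinitesimalSymmetry.

Section FormFunctions.
Variables (K : numClosedFieldType) (N : nat).

Definition is_form (d : nat) (f : 'rV[K]_N -> K) :=
  exists2 q : {mpoly K[N]}, q \is d.-homog & forall x, f x = eval_at q x.

Lemma is_form_ext d f g : f =1 g -> is_form d f -> is_form d g.
Proof. by move=> fg [q qd fq]; exists q => // x; rewrite -fg. Qed.

Lemma is_form0 d : is_form d (fun=> 0).
Proof. by exists 0; [exact: rpred0 | move=> x; rewrite /eval_at meval0]. Qed.

Lemma is_formC c : is_form 0 (fun=> c).
Proof.
exists c%:MP; last by move=> x; rewrite /eval_at mevalC.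
by rewrite -[c%:MP]mulr1 mul_mpolyC rpredZ // dhomog1.
Qed.

Lemma is_formX j : is_form 1 (fun x => x ord0 j).
Proof. by exists 'X_j; [exact: dhomog_X | move=> x; rewrite /eval_at mevalXU]. Qed.

Lemma is_formD d f g : is_form d f -> is_form d g -> is_form d (fun x => f x + g x).
Proof.
move=> [p pd fp] [q qd gq]; exists (p + q); first exact: rpredD.
by move=> x; rewrite /eval_at mevalD fp gq.
Qed.

Lemma is_formM d e f g : is_form d f -> is_form e g -> is_form (d + e) (fun x => f x * g x).
Proof.
move=> [p pd fp] [q qd gq]; exists (p * q); first exact: dhomogM.
by move=> x; rewrite /eval_at mevalM fp gq.
Qed.

Lemma is_form_sum d (I : Type) (r : seq I) (P : pred I) (f : I -> 'rV[K]_N -> K) :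
  (forall i, P i -> is_form d (f i)) -> is_form d (fun x => \sum_(i <- r | P i) f i x).
Proof.
move=> h; elim: r => [|i r IH].
  by apply: is_form_ext (is_form0 d) => x; rewrite big_nil.
have [Pi|nPi] := boolP (P i).
  by apply: is_form_ext (is_formD (h i Pi) IH) => x; rewrite big_cons Pi.
by apply: is_form_ext IH => x; rewrite big_cons (negPf nPi).
Qed.

Lemma is_formZ d c f : is_form d f -> is_form d (fun x => c * f x).
Proof. by move=> h; have := is_formM (is_formC c) h. Qed.

Lemma is_formXn d f k : is_form d f -> is_form (d * k) (fun x => f x ^+ k).
Proof.
move=> h; elim: k => [|k IH]; first by rewrite muln0; apply: is_formC.
by rewrite mulnS; apply: is_form_ext (is_formM h IH) => x; rewrite exprS.
Qed.

Lemma is_form0_const f : is_form 0 f -> forall x y, f x = f y.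
Proof.
move=> [q qd fq] x y; rewrite !fq.
have h z : eval_at q z = eval_at q 0 by rewrite -(scale0r z) (eval_at_scale _ _ qd) expr0 mul1r.
by rewrite h -(h y).
Qed.

Lemma is_form1_linear f : is_form 1 f -> forall x, f x = \sum_k x ord0 k * f (delta_mx 0 k).
Proof.
move=> [q qd fq].
have qk k z : eval_at q^`M(k) z = eval_at q^`M(k) 0.
  rewrite -(scale0r z) (eval_at_scale _ _ (mderiv_homog k qd)) expr0 mul1r //.
have E z : f z = \sum_k z ord0 k * eval_at q^`M(k) 0.
  rewrite fq -[LHS]mul1r -(eval_euler _ qd).
  by apply: eq_bigr => k _; rewrite qk.
move=> x; rewrite E; apply: eq_bigr => k _; congr (_ * _).
rewrite E (bigD1 k) //= big1 ?addr0 => [|j /negPf jk]; first by rewrite mxE !eqxx mul1r.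
by rewrite mxE jk andbF mul0r.
Qed.

End FormFunctions.

Arguments is_form0 {K N} d.
Arguments is_formC {K N} c.
Arguments is_formX {K N} j.

Section BiForms.
Variable K : numClosedFieldType.

(* The variable of the polynomial P x p stands for a scaling of x. *)
Definition biform (n : nat) (P : 'rV[K]_4 -> 'rV[K]_4 -> {poly K}) :=
  [/\ forall x k, (k <= n)%N -> is_form (n - k) (fun p => (P x p)`_k),
      forall p k, (k <= n)%N -> is_form k (fun x => (P x p)`_k)
    & forall x p k, (n < k)%N -> (P x p)`_k = 0].

Lemma biformD n P Q : biform n P -> biform n Q -> biform n (fun x p => P x p + Q x p).
Proof.
move=> [P1 P2 P3] [Q1 Q2 Q3]; split => [x k kn|p k kn|x p k kn].
- apply: is_form_ext (is_formD (P1 x k kn) (Q1 x k kn)) => p.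
  by rewrite coefD.
- apply: is_form_ext (is_formD (P2 p k kn) (Q2 p k kn)) => x.
  by rewrite coefD.
- by rewrite coefD P3 // Q3 // addr0.
Qed.

Lemma biform0 n : biform n (fun _ _ => 0).
Proof.
split => [x k _|p k _|x p k _]; last by rewrite coef0.
  by apply: is_form_ext (is_form0 _) => p; rewrite coef0.
by apply: is_form_ext (is_form0 _) => x; rewrite coef0.
Qed.

Lemma biformC c : biform 0 (fun _ _ => c%:P).
Proof.
split => [x k|p k|x p k]; last by rewrite coefC; case: k.
  by case: k => // _; apply: is_form_ext (is_formC c) => p; rewrite coefC.
by case: k => // _; apply: is_form_ext (is_formC c) => x; rewrite coefC.
Qed.

Lemma biformM n m P Q : biform n P -> biform m Q -> biform (n + m) (fun x p => P x p * Q x p).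
Proof.
move=> [P1 P2 P3] [Q1 Q2 Q3]; split => [x k kn|p k kn|x p k kn].
- apply: (@is_form_ext _ _ _ (fun p => \sum_(j < k.+1) (P x p)`_j * (Q x p)`_(k - j))).
    by move=> p; rewrite coefM.
  apply: is_form_sum => j _; have jk := ltn_ord j; rewrite ltnS in jk.
  have [jn|jn] := leqP j n; last first.
    by apply: is_form_ext (is_form0 _) => p; rewrite P3 // mul0r.
  have [km|km] := leqP (k - j) m; last first.
    by apply: is_form_ext (is_form0 _) => p; rewrite Q3 // mulr0.
  have -> : (n + m - k = (n - j) + (m - (k - j)))%N by lia.
  exact: is_formM (P1 x j jn) (Q1 x _ km).
- apply: (@is_form_ext _ _ _ (fun x => \sum_(j < k.+1) (P x p)`_j * (Q x p)`_(k - j))).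
    by move=> x; rewrite coefM.
  apply: is_form_sum => j _; have jk := ltn_ord j; rewrite ltnS in jk.
  have [jn|jn] := leqP j n; last first.
    by apply: is_form_ext (is_form0 _) => x; rewrite P3 // mul0r.
  have [km|km] := leqP (k - j) m; last first.
    by apply: is_form_ext (is_form0 _) => x; rewrite Q3 // mulr0.
  by have := is_formM (P2 p j jn) (Q2 p _ km); rewrite subnKC.
- rewrite coefM big1 // => j _; have jk := ltn_ord j; rewrite ltnS in jk.
  have [jn|jn] := leqP j n; last by rewrite P3 // mul0r.
  by rewrite Q3 ?mulr0 //; lia.
Qed.

Lemma biform_ext n P Q : (forall x p, P x p = Q x p) -> biform n P -> biform n Q.
Proof.
move=> PQ [P1 P2 P3]; split => [x k kn|p k kn|x p k kn]; last by rewrite -PQ P3.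
  by apply: is_form_ext (P1 x k kn) => p; rewrite PQ.
by apply: is_form_ext (P2 p k kn) => x; rewrite PQ.
Qed.

Lemma biform_prod (I : Type) (r : seq I) (n : I -> nat) P :
  (forall i, biform (n i) (P i)) ->
  biform (\sum_(i <- r) n i) (fun x p => \prod_(i <- r) P i x p).
Proof.
move=> h; elim: r => [|i r IH].
  by rewrite big_nil; apply: biform_ext (biformC 1) => x p; rewrite big_nil.
by rewrite big_cons; apply: biform_ext (biformM (h i) IH) => x p; rewrite big_cons.
Qed.

Lemma biform_sum (I : Type) (r : seq I) n P :
  (forall i, biform n (P i)) -> biform n (fun x p => \sum_(i <- r) P i x p).
Proof.
move=> h; elim: r => [|i r IH].
  by apply: biform_ext (biform0 n) => x p; rewrite big_nil.
by apply: biform_ext (biformD (h i) IH) => x p; rewrite big_cons.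
Qed.

Lemma biform_det s (n : 'I_s -> nat) (A : 'rV[K]_4 -> 'rV[K]_4 -> 'M[{poly K}]_s) :
  (forall i j, biform (n i) (fun x p => A x p i j)) ->
  biform (\sum_i n i) (fun x p => \det (A x p)).
Proof.
move=> h; apply: biform_sum => sg.
have hs : biform 0 (fun _ _ => (-1) ^+ perm.odd_perm sg).
  by apply: biform_ext (biformC ((-1) ^+ perm.odd_perm sg)) => x p; rewrite rmorphXn rmorphN rmorph1.
by have := biformM hs (biform_prod (index_enum _) (fun i => h i (perm.fun_of_perm.body sg i))).
Qed.

End BiForms.
Section Independence.
Variables (K : numClosedFieldType) (Phi : symtensor K).
Let Phi12 := tensor12 Phi.
Let Phi23 := tensor23 Phi.
Let Phi34 := tensor34 Phi.
Notation e_ k := (delta_mx 0 k : 'rV[K]_4).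

Lemma tensor_sum1 b c d (x : 'rV[K]_4) : Phi x b c d = \sum_j x ord0 j * Phi (e_ j) b c d.
Proof.
rewrite Phi12 Phi23 Phi34 Phi_sum4; apply: eq_bigr => j _.
by rewrite Phi34 Phi23 Phi12.
Qed.

Lemma is_form_tensor1 b c d : is_form 1 (fun x => Phi x b c d).
Proof.
apply: (@is_form_ext _ _ _ (fun x => \sum_j Phi (e_ j) b c d * x ord0 j)).
  by move=> x; rewrite tensor_sum1; apply: eq_bigr => j _; rewrite mulrC.
by apply: is_form_sum => j _; apply/is_formZ/is_formX.
Qed.

Lemma is_form_tensor2 c d : is_form 2 (fun x => Phi x x c d).
Proof.
apply: (@is_form_ext _ _ _ (fun x => \sum_j x ord0 j * Phi x (e_ j) c d)).
  by move=> x; rewrite [RHS]tensor_sum1; apply: eq_bigr => j _; rewrite Phi12.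
apply: is_form_sum => j _; exact: (is_formM (is_formX j) (is_form_tensor1 _ _ _)).
Qed.

Variables (h : 'cV[K]_4).
Notation "[ 'h' x ]" := ((x *m h) 0 0) (format "[ 'h'  x ]").

(* The gradient G of x |-> Phi x x x x / 24 satisfies
   G (t *: x) - G p = (t *: x - p) *m dquot x p when evaluated at t. *)
Definition dquot (x p : 'rV[K]_4) : 'M[{poly K}]_4 :=
  \matrix_(k, j) (6^-1 *: ((Phi x x (e_ k) (e_ j))%:P * 'X^2
    + (Phi x p (e_ k) (e_ j))%:P * 'X + (Phi p p (e_ k) (e_ j))%:P)).

(** The transpose of [dquot] with column [j] replaced by [h], as in the numerators of Cramer's
    rule. *)
Definition dquot_h (j : 'I_4) (x p : 'rV[K]_4) : 'M[{poly K}]_4 :=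
  \matrix_(i, k) (if i == j then (h k 0)%:P else dquot x p k i).

Definition minor_h j x p := \det (dquot_h j x p).

Lemma biform_dquot k j : biform 2 (fun x p => dquot x p k j).
Proof.
have c6 := biformC (6^-1 : K).
apply: (@biform_ext _ (0 + 2)) (biformM c6 (_ : biform 2 (fun x p => (Phi x x (e_ k) (e_ j))%:P * 'X^2
    + (Phi x p (e_ k) (e_ j))%:P * 'X + (Phi p p (e_ k) (e_ j))%:P))) => [x p|].
  by rewrite mxE mul_polyC.
have E x p i : ((Phi x x (e_ k) (e_ j))%:P * 'X^2 + (Phi x p (e_ k) (e_ j))%:P * 'X
    + (Phi p p (e_ k) (e_ j))%:P)`_i =
    if i is i'.+1 then if i' is i''.+1 then if i'' is _.+1 then 0 else Phi x x (e_ k) (e_ j)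
       else Phi x p (e_ k) (e_ j) else Phi p p (e_ k) (e_ j).
  rewrite !coefD !coefCM coefXn coefX coefC.
  by case: i => [|[|[|i]]] /=; rewrite ?mulr0 ?mulr1 ?addr0 ?add0r.
split => [x i i2|p i i2|x p i i2]; last by rewrite E; case: i i2 => [|[|[|]]].
  apply: (is_form_ext (fun p => esym (E x p i))).
  case: i i2 => [|[|[|i]]] //= _; rewrite ?subn0 ?subn1 ?subnn.
  - exact: is_form_tensor2.
  - by apply: (@is_form_ext _ _ _ (fun p => Phi p x (e_ k) (e_ j))) (is_form_tensor1 _ _ _).
  - exact: is_formC.
apply: (is_form_ext (fun x => esym (E x p i))).
case: i i2 => [|[|[|i]]] //= _.
- exact: is_formC.
- exact: is_form_tensor1.
- exact: is_form_tensor2.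
Qed.

(** Three quadratic rows and the constant row [h] give total degree 6. *)
Lemma biform_minor j : biform 6 (minor_h j).
Proof.
have -> : 6%N = (\sum_(i < 4) (if i == j then 0 else 2))%N.
  by rewrite (bigD1 j) //= eqxx (eq_bigr (fun=> 2%N)) => [|i /negPf -> //];
     rewrite sum_nat_const cardC1 card_ord.
apply: biform_det => i k.
have [ij|ij] := boolP (i == j).
  by apply: biform_ext (biformC (h k 0)) => x p; rewrite mxE ij.
by apply: biform_ext (biform_dquot k i) => x p; rewrite [RHS]mxE (negPf ij).
Qed.

Lemma horner_dquot (x p : 'rV[K]_4) (k j : 'I_4) : (dquot x p k j).[1] =
  6^-1 * (Phi x x (e_ k) (e_ j) + Phi x p (e_ k) (e_ j) + Phi p p (e_ k) (e_ j)).
Proof. by rewrite mxE hornerZ !hornerD !hornerM !hornerC !hornerX !mulr1. Qed.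

Lemma dquotE (x p : 'rV[K]_4) (j : 'I_4) : \sum_k (x - p) ord0 k * (dquot x p k j).[1]
  = 6^-1 * (Phi x x x (e_ j) - Phi p p p (e_ j)).
Proof.
have S a b : \sum_k (x - p) ord0 k * Phi a b (e_ k) (e_ j) = Phi a b (x - p) (e_ j).
  by rewrite Phi34 Phi_sum4; apply: eq_bigr => k _; rewrite Phi34.
under eq_bigr => k _ do rewrite horner_dquot mulrCA !mulrDr.
rewrite !big_split /= -!mulr_sumr !S -!mulrDr -scaleN1r !(PhiD3, PhiZ3).
congr (_ * _); rewrite (Phi23 x p x) (Phi23 p p x) (Phi12 p x p); ring.
Qed.

Definition dquot1 x p : 'M[K]_4 := \matrix_(k, j) (dquot x p k j).[1].

Definition dquot1_h j x p : 'M[K]_4 :=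
  \matrix_(i, k) (if i == j then h k 0 else dquot1 x p k i).

Lemma minor_h1 j x p : (minor_h j x p).[1] = \det (dquot1_h j x p).
Proof.
rewrite -[LHS]/(horner_eval 1 _) -det_map_mx; congr (\det _).
apply/matrixP => i k; rewrite [LHS]mxE [dquot_h _ _ _ _ _]mxE [RHS]mxE /horner_eval.
case: ifP => _; last by rewrite [RHS]mxE.
exact: hornerC.
Qed.

Lemma dquot1E x p : (x - p) *m dquot1 x p
  = 6^-1 *: \row_j (Phi x x x (e_ j) - Phi p p p (e_ j)).
Proof.
apply/rowP => j; rewrite !mxE -dquotE; apply: eq_bigr => k _.
by rewrite [dquot1 _ _ _ _]mxE.
Qed.

(** Cramer's rule for the system that expresses the gradient difference [g] through [x - p], paired
    with the linear form [h]. *)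
Lemma minor_syzygy x p (g := (x - p) *m dquot1 x p) :
  \sum_j (minor_h j x p).[1] * g 0 j = \det (dquot1 x p) * [h (x - p)].
Proof.
set D := dquot1 x p.
have E j : (minor_h j x p).[1] = (h^T *m \adj D^T) 0 j.
  rewrite minor_h1 (expand_det_row _ j) mxE; apply: eq_bigr => k _.
  rewrite !mxE eqxx; congr (_ * _); rewrite /cofactor; congr (_ * \det _).
  by apply/matrixP => a b; rewrite !mxE eq_sym (negPf (neq_lift _ _)).
have -> : \sum_j (minor_h j x p).[1] * g 0 j = (h^T *m \adj D^T *m D^T *m (x - p)^T) 0 0.
  rewrite -mulmxA -trmx_mul [RHS]mxE; apply: eq_bigr => j _.
  by rewrite E [_^T j 0]mxE.
rewrite -(mulmxA h^T) mul_adj_mx mul_mx_scalar -scalemxAl mxE det_tr; congr (_ * _).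
by rewrite -trmx_mul mxE.
Qed.

(** The vector [x - p] is in the kernel of the transposed matrix: neither the gradient nor [h]
    separates the two points. This applies to two distinct nodes. *)
Lemma minor_h1_eq0 j x p : x != p -> [h x] = [h p] ->
  (forall k, Phi x x x (e_ k) = Phi p p p (e_ k)) -> (minor_h j x p).[1] = 0.
Proof.
move=> xp hxp gxp; rewrite minor_h1 -det_tr; apply/eqP/det0P.
exists (x - p); first by rewrite subr_eq0.
have g0 : (x - p) *m dquot1 x p = 0.
  by rewrite dquot1E; apply/rowP => k; rewrite !mxE gxp subrr mulr0.
apply/rowP => i; rewrite [RHS]mxE mxE.
have [->|/negPf ij] := eqVneq i j.
  have -> : \sum_k (x - p) 0 k * (dquot1_h j x p)^T k j = [h (x - p)].
    by rewrite mxE; apply: eq_bigr => k _; rewrite !mxE eqxx.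
  by rewrite mulmxBl !mxE; move: hxp; rewrite !mxE => ->; rewrite subrr.
have -> : \sum_k (x - p) 0 k * (dquot1_h j x p)^T k i = ((x - p) *m dquot1 x p) 0 i.
  rewrite [RHS]mxE; apply: eq_bigr => k _.
  by rewrite [_^T k i]mxE [dquot1_h _ _ _ _ _]mxE ij.
by rewrite g0 mxE.
Qed.

(** For [x = p] the matrix [dquot1] is half the Hessian of [Phi]. If coordinate [j] of [p] is
    nonzero, Euler's formula restores the equation that [h] has replaced; so a kernel vector is a
    multiple of [p], and [h] forces it to vanish. *)
Lemma minor_h1_neq0 p : (forall x, Phi p p p x = 0) -> nondeg_kernel Phi p ->
  [h p] = 1 -> exists j, (minor_h j p p).[1] != 0.
Proof.
move=> psing pnode hp1.
have p0 : p != 0.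
  by apply: contra_eq_neq hp1 => ->; rewrite mul0mx mxE eq_sym oner_neq0.
have [j pj] : exists j, p 0 j != 0 by apply/rV0Pn.
exists j; rewrite minor_h1 -det_tr; apply/det0P => -[w w0 wD].
have E i : \sum_k w 0 k * (dquot1_h j p p)^T k i = 0.
  by move/rowP: wD => /(_ i); rewrite [RHS]mxE mxE.
have hw : [h w] = 0.
  by rewrite -(E j) mxE; apply: eq_bigr => k _; rewrite !mxE eqxx.
have wi i : i != j -> Phi p p w (e_ i) = 0.
  move=> ij; have := E i.
  have -> : \sum_k w 0 k * (dquot1_h j p p)^T k i = 2^-1 * Phi p p w (e_ i).
    rewrite [in RHS]Phi34 Phi_sum4 mulr_sumr; apply: eq_bigr => k _.
    rewrite [_^T k i]mxE [dquot1_h _ _ _ _ _]mxE (negPf ij) [dquot1 _ _ _ _]mxE horner_dquot.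
    by rewrite (Phi34 p p _ (e_ k)); field.
  by move=> /eqP; rewrite mulf_eq0 invr_eq0 pnatr_eq0 /= => /eqP.
have wj : Phi p p w (e_ j) = 0.
  have : Phi p p w p = 0 by rewrite Phi34.
  rewrite Phi_sum4 (bigD1 j) //= big1 ?addr0 => [|i ij]; last by rewrite wi ?mulr0.
  by move=> /eqP; rewrite mulf_eq0 (negPf pj) => /eqP.
have wx x : Phi p p w x = 0.
  rewrite Phi_sum4 big1 // => i _; have [->|ij] := eqVneq i j; first by rewrite wj mulr0.
  by rewrite wi // mulr0.
have [c wc] := pnode _ wx.
move: hw w0; rewrite wc -scalemxAl mxE hp1 mulr1 => ->; by rewrite scale0r eqxx.
Qed.

Lemma cubic_const_eq0 (A B C D : K) :
  (forall t, t != 0 -> A + t * B + t ^+ 2 * C + t ^+ 3 * D = 0) -> A = 0.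
Proof.
have n0 k : (k.+1%:R : K) != 0 by rewrite pnatr_eq0.
move=> e; have e1 := e 1 (n0 0%N); have e2 := e 2 (n0 1%N).
have := e (-1); rewrite oppr_eq0 => /(_ (n0 0%N)) e3.
have := e (- 2); rewrite oppr_eq0 => /(_ (n0 1%N)) e4.
have -> : A = 4 / 6 * ((A + 1 * B + 1 ^+ 2 * C + 1 ^+ 3 * D)
    + (A + (-1) * B + (-1) ^+ 2 * C + (-1) ^+ 3 * D))
  - 1%:R / 6 * ((A + 2 * B + 2 ^+ 2 * C + 2 ^+ 3 * D)
    + (A + (- 2) * B + (- 2) ^+ 2 * C + (- 2) ^+ 3 * D)) by field.
by rewrite e1 e2 e3 e4; ring.
Qed.

Lemma linformZ (t : K) (x : 'rV[K]_4) : [h (t *: x)] = t * [h x].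
Proof. by rewrite -scalemxAl mxE. Qed.

Lemma linformD (x y : 'rV[K]_4) : [h (x + y)] = [h x] + [h y].
Proof. by rewrite mulmxDl mxE. Qed.

Lemma relation_symmetry m (p : 'I_m -> 'rV[K]_4) (c : 'I_m -> K) l :
  injective p -> (forall i, [h p i] = 1) ->
  (forall i x, Phi (p i) (p i) (p i) x = 0) -> (forall i, nondeg_kernel Phi (p i)) ->
  (forall f, is_form 4 f -> \sum_i c i * f (p i) = 0) -> c l != 0 ->
  exists2 M : 'M[K]_4, M != 0 & forall x, Phi (x *m M) x x x = 0.
Proof.
move=> p_inj hp psing pnode crel cl.
pose a j x := \sum_i c i * (minor_h j x (p i)).[1].
pose a0 j x := \sum_i c i * (minor_h j x (p i))`_0.
pose a1 j x := \sum_i c i * (minor_h j x (p i))`_1.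
(* In degree [k.+2] in [x] the minor has degree [4 - k] in the node. Multiplied by the [k]-th power
   of [h], which is 1 at the nodes, it is a quartic, and [crel] kills it. Only degrees 0 and 1 in
   [x] survive. *)
have aE j x : a j x = a0 j x + a1 j x.
  have [B1 _ B3] := biform_minor j.
  have -> : a j x = \sum_(k < 7) \sum_i c i * (minor_h j x (p i))`_k.
    rewrite exchange_big /=; apply: eq_bigr => i _; rewrite -mulr_sumr.
    rewrite (@horner_coef_wide _ 7); last by apply/leq_sizeP => k; exact: B3.
    by congr (_ * _); apply: eq_bigr => k _; rewrite expr1n mulr1.
  rewrite big_ord_recl big_ord_recl [X in _ + (_ + X)]big1 ?addr0 // => k _.
  rewrite -[RHS](crel (fun y => [h y] ^+ k * (minor_h j x y)`_k.+2)).
    by apply: eq_bigr => i _; rewrite hp expr1n mul1r.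
  have k6 : (k.+2 <= 6)%N by rewrite ltnS; exact: ltn_ord.
  have hf : is_form 1 (fun y : 'rV[K]_4 => [h y]).
    apply: (@is_form_ext _ _ _ (fun y => \sum_j h j 0 * y ord0 j)).
      by move=> y; rewrite mxE; apply: eq_bigr => i _; rewrite mulrC.
    by apply: is_form_sum => i _; apply/is_formZ/is_formX.
  have := is_formM (is_formXn k hf) (B1 x _ k6).
  by rewrite mul1n; have -> : (k + (6 - k.+2) = 4)%N by lia.
have a0E j x y : a0 j x = a0 j y.
  have [_ B2 _] := biform_minor j.
  apply: (@is_form0_const K 4 (a0 j)); apply: is_form_sum => i _; apply: is_formZ.
  exact: B2.
have a1E j x : a1 j x = \sum_k x ord0 k * a1 j (e_ k).
  have [_ B2 _] := biform_minor j.
  apply: is_form1_linear; apply: is_form_sum => i _; apply: is_formZ.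
  exact: B2.
(* The affine map with components [a j], made linear by multiplying its constant part by [h]. *)
pose M : 'M[K]_4 := \matrix_(k, j) (h k 0 * a0 j 0 + a1 j (e_ k)).
have ME x j : (x *m M) 0 j = [h x] * a0 j x + a1 j x.
  rewrite (a0E j x 0) a1E !mxE mulr_suml -big_split /=; apply: eq_bigr => k _.
  by rewrite mxE mulrDr mulrA.
have M1 x : [h x] = 1 -> Phi (x *m M) x x x = 0.
  move=> hx.
  have -> : Phi (x *m M) x x x = 6 * \sum_j a j x * (6^-1 * Phi x x x (e_ j)).
    rewrite tensor_sum1 mulr_sumr; apply: eq_bigr => j _.
    by rewrite ME hx mul1r -aE (Phi12 (e_ j)) (Phi23 x (e_ j)) (Phi34 x x (e_ j)); field.
  under eq_bigr => j _ do rewrite /a mulr_suml.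
  rewrite exchange_big /= big1 ?mulr0 // => i _.
  under eq_bigr => j _ do rewrite -mulrA.
  rewrite -mulr_sumr.
  (* On the hyperplane where [h] is 1 the right-hand side of the syzygy vanishes for all nodes
     simultaneously. *)
  have hB : [h (x - p i)] = 0 by rewrite mulmxBl mxE hx [X in 1 + X]mxE hp subrr.
  have := minor_syzygy x (p i); rewrite hB mulr0 => e.
  apply/eqP; rewrite mulf_eq0; apply/orP; right; rewrite -[X in _ == X]e; apply/eqP; apply: eq_bigr => j _.
  by rewrite dquot1E !mxE psing subr0.
have Mn0 x : [h x] != 0 -> Phi (x *m M) x x x = 0.
  move=> hx; have := M1 ([h x]^-1 *: x).
  rewrite linformZ mulVf // => /(_ erefl).
  rewrite -scalemxAl PhiZ1 PhiZ2 PhiZ3 PhiZ4 !mulrA => /eqP.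
  by rewrite mulf_eq0 !mulf_eq0 !invr_eq0 (negPf hx) => /eqP.
exists M.
  (* At the node [p l] all summands of [a j] with another index vanish, and for a suitable [j] the
     summand of [l] does not. *)
  have [j aj] := minor_h1_neq0 (psing l) (pnode l) (hp l).
  have : a j (p l) != 0.
    rewrite /a (bigD1 l) //= big1 ?addr0 ?mulf_neq0 // => i il.
    rewrite minor_h1_eq0 ?mulr0 //; first by rewrite (inj_eq p_inj) eq_sym.
      by rewrite !hp.
    by move=> k; rewrite !psing.
  rewrite aE -[a0 _ _]mul1r -(hp l) -ME; apply: contra_neq => ->.
  by rewrite mulmx0 mxE.
move=> x; have [hx|] := eqVneq [h x] 0; last exact: Mn0.
(* For [h x = 0] the identity holds at [x + t *: y] for all nonzero [t]; as it is polynomial in [t],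
   its constant term vanishes. *)
pose y := p l.
have g t : t != 0 -> Phi ((x + t *: y) *m M) (x + t *: y) (x + t *: y) (x + t *: y) = 0.
  move=> t0; apply: Mn0; by rewrite linformD linformZ hx add0r hp mulr1.
apply: (@cubic_const_eq0 _ (Phi (y *m M) x x x + 3 * Phi (x *m M) x x y)
  (3 * Phi (y *m M) x x y + 3 * Phi (x *m M) x y y)
  (3 * Phi (y *m M) x y y + Phi (x *m M) y y y)) => t t0.
have := g t t0; rewrite mulmxDl -scalemxAl !PhiD1 !PhiD2 !PhiD3 !PhiD4.
rewrite !PhiZ1 !PhiZ2 !PhiZ3 !PhiZ4 (M1 y (hp l)) !(Phi34 _ _ y x) !(Phi23 _ y x) !(Phi34 _ _ y x).
by move=> <-; ring.
Qed.

End Independence.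
End NodeConditions.

(** * Polarization, affine charts, and the Hessian criterion for a node *)

Module NodalQuartics.
Import mpoly QuarticForms InfinitesimalSymmetry NodeConditions.
Local Open Scope classical_set_scope.
Local Open Scope ring_scope.

Section DirectionalDerivative.
Variables (K : numClosedFieldType) (n : nat).
Implicit Types (q : {mpoly K[n]}) (a b v : 'rV[K]_n).

Definition dder a q : {mpoly K[n]} := \sum_i a ord0 i *: q^`M(i).

Lemma dder_linl k a b q : dder (k *: a + b) q = k *: dder a q + dder b q.
Proof.
rewrite /dder scaler_sumr -big_split; apply: eq_bigr => i _ /=.
by rewrite !mxE scalerDl scalerA.
Qed.

Lemma dderC a b q : dder a (dder b q) = dder b (dder a q).
Proof.
have E c i : (dder c q)^`M(i) = \sum_j c ord0 j *: q^`M(j)^`M(i).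
  by rewrite raddf_sum; apply: eq_bigr => j _ /=; rewrite mderivZ.
have E' c c' : dder c (dder c' q) = \sum_i c ord0 i *: (dder c' q)^`M(i) by [].
rewrite !E'.
under eq_bigr => i _ do rewrite E scaler_sumr.
under [RHS]eq_bigr => i _ do rewrite E scaler_sumr.
rewrite exchange_big; apply: eq_bigr => i _; apply: eq_bigr => j _ /=.
by rewrite !scalerA mulrC mderiv_comm.
Qed.

Lemma dder_homog d a q : q \is d.+1.-homog -> dder a q \is d.-homog.
Proof. by move=> hq; apply: rpred_sum => i _; rewrite rpredZ // mderiv_homog. Qed.

Lemma eval_dder_self d v q : q \is d.-homog -> eval_at (dder v q) v = d%:R * eval_at q v.
Proof.
move=> hq; rewrite -(eval_euler v hq) /eval_at /dder raddf_sum /=.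
by apply: eq_bigr => i _; rewrite mevalZ.
Qed.

Lemma dder_delta i q : dder (delta_mx 0 i) q = q^`M(i).
Proof.
rewrite /dder (bigD1 i) //= mxE !eqxx scale1r big1 ?addr0 // => j /negPf ji.
by rewrite mxE ji andbF scale0r.
Qed.

Lemma eval_dder a q v : eval_at (dder a q) v = \sum_i a ord0 i * eval_at q^`M(i) v.
Proof. by rewrite /eval_at /dder raddf_sum; apply: eq_bigr => i _; rewrite /= mevalZ. Qed.

Lemma eval_homog0 q v : q \is 0.-homog -> eval_at q v = eval_at q 0.
Proof. by move=> hq; rewrite -(scale0r v) (eval_at_scale _ _ hq) expr0 mul1r. Qed.

End DirectionalDerivative.

Section QuarticTensorOf.
Variables (K : numClosedFieldType) (F : {mpoly K[4]}).

(** Fourth derivatives of a quartic are constant, so the choice of the point 0 is immaterial. *)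
Definition quartic_tensor_fun (a b c d : 'rV[K]_4) :=
  eval_at (dder a (dder b (dder c (dder d F)))) 0.

Lemma quartic_tensor_lin k a a' b c d : quartic_tensor_fun (k *: a + a') b c d =
  k * quartic_tensor_fun a b c d + quartic_tensor_fun a' b c d.
Proof. by rewrite /quartic_tensor_fun dder_linl /eval_at mevalD mevalZ. Qed.

Lemma quartic_tensor12 a b c d : quartic_tensor_fun a b c d = quartic_tensor_fun b a c d.
Proof. by rewrite /quartic_tensor_fun dderC. Qed.

Lemma quartic_tensor23 a b c d : quartic_tensor_fun a b c d = quartic_tensor_fun a c b d.
Proof. by rewrite /quartic_tensor_fun (dderC b). Qed.

Lemma quartic_tensor34 a b c d : quartic_tensor_fun a b c d = quartic_tensor_fun a b d c.
Proof. by rewrite /quartic_tensor_fun (dderC c). Qed.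

Definition quartic_tensor := Symtensor quartic_tensor_lin quartic_tensor12
  quartic_tensor23 quartic_tensor34.

Hypothesis F4 : F \is 4.-homog.

Lemma quartic_tensor_grad p x :
  quartic_tensor p p p x = 6 * eval_at (dder x F) p.
Proof.
have h3 := dder_homog x F4; have h2 := dder_homog p h3; have h1 := dder_homog p h2.
rewrite /= /quartic_tensor_fun -(eval_homog0 p (dder_homog p h1)).
by rewrite (eval_dder_self _ h1) (eval_dder_self _ h2) (eval_dder_self _ h3) !mulrA -!natrM.
Qed.

Lemma quartic_tensor_hess p x y :
  quartic_tensor p p x y = 2 * eval_at (dder x (dder y F)) p.
Proof.
have h3 := dder_homog y F4; have h2 := dder_homog x h3; have h1 := dder_homog p h2.
rewrite /= /quartic_tensor_fun -(eval_homog0 p (dder_homog p h1)).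
by rewrite (eval_dder_self _ h1) (eval_dder_self _ h2) !mulrA -!natrM.
Qed.

End QuarticTensorOf.

Section Charts.
Variables (K : numClosedFieldType) (n : nat).
Implicit Types (F : {mpoly K[n.+1]}) (P : projspace K n).

Lemma eval_dehomogenize i F y : eval_at (dehomogenize i F) y = eval_at F (affine_vec i y).
Proof.
rewrite /eval_at /dehomogenize comp_mpoly_meval; apply: meval_eq => j /=.
rewrite tnth_mktuple mxE; case: unliftP => [k _|_]; first by rewrite mevalXU.
by rewrite meval1.
Qed.

(** The property is stable under sums, scalars and, by the Leibniz rule, products, which reduces it
    to variables. *)
Lemma mderiv_dehomogenize i F a :
  (dehomogenize i F)^`M(a) = dehomogenize i (F^`M(lift i a)).
Proof.
pose D (q : {mpoly K[n.+1]}) := (dehomogenize i q)^`M(a) = dehomogenize i (q^`M(lift i a)).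
have D1 : D 1 by rewrite /D /dehomogenize comp_mpoly1 -!mpolyC1 !mderivC comp_mpoly0.
have DM p q : D p -> D q -> D (p * q).
  rewrite /D /dehomogenize => hp hq.
  by rewrite rmorphM /= !mderivM hp hq rmorphD /= !rmorphM.
have DX j : D 'X_j.
  rewrite /D /dehomogenize comp_mpolyXU -tnth_nth tnth_mktuple mderivX mnm1E.
  case: unliftP => [k ->|->].
    rewrite mderivX mnm1E (inj_eq lift_inj).
    case: eqP => [->|_]; last by rewrite !scale0r comp_mpoly0.
    have mm l (m : 'X_{1..l}) : (m - m)%MM = 0%MM by apply/mnmP => t; rewrite mnmBE mnm0E subnn.
    by rewrite !scale1r !mm !mpolyX0 comp_mpoly1.
  by rewrite -mpolyC1 mderivC (negPf (neq_lift _ _)) scale0r comp_mpoly0.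
have Dm m : D 'X_[m].
  rewrite mpolyXE_id; apply: (big_ind D) => // j _.
  by elim: (m j) => [|k IH]; rewrite ?expr0 // exprS; apply: DM.
have : D F.
  rewrite [F]mpolyE; apply: (big_ind D) => [|p q|m _].
  - by rewrite /D /dehomogenize comp_mpoly0 !mderiv0 comp_mpoly0.
  - by rewrite /D /dehomogenize => hp hq; rewrite !(comp_mpolyD, mderivD) hp hq.
  - by have := Dm m; rewrite /D /dehomogenize !(comp_mpolyZ, mderivZ) => ->.
by [].
Qed.

Lemma affine_vec_coord i P : hcoord P ord0 i != 0 ->
  affine_vec i (affine_coord i P) = (hcoord P ord0 i)^-1 *: hcoord P.
Proof.
move=> Pi; apply/rowP => j; rewrite !mxE; case: unliftP => [k ->|->].
  by rewrite mxE mulrC.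
by rewrite mulVf.
Qed.

Lemma hcoord_line_of (v : 'rV[K]_n.+1) (v0 : v != 0) : exists2 c : K, c != 0 & hcoord (line_of v0) = c *: v.
Proof.
have := hcoord_in (line_of v0); rewrite /= => /vlineP [c hc].
exists c => //; apply: contraNneq (hcoord_neq0 (line_of v0)) => c0.
by rewrite hc c0 scale0r.
Qed.

Lemma projspace_eq P Q c : hcoord P = c *: hcoord Q -> P = Q.
Proof.
move=> PQ; apply/val_inj => /=.
have lineP (S : projspace K n) : val S = <[hcoord S]>%VS.
  apply/eqP; rewrite eq_sym eqEdim -memvE hcoord_in /= (eqP (valP S)).
  by rewrite dim_vline hcoord_neq0.
have c0 : c != 0.
  by apply: contraNneq (hcoord_neq0 P) => c0; rewrite PQ c0 scale0r.
rewrite !lineP PQ; apply/eqP; rewrite eqEdim !dim_vline scaler_eq0 (negPf c0) hcoord_neq0 andbT.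
by rewrite -memvE memvZ // memv_line.
Qed.

Lemma exists_hcoord P : exists i, hcoord P ord0 i != 0.
Proof. exact/rV0Pn/hcoord_neq0. Qed.

End Charts.

Section Nodes.
Variables (K : numClosedFieldType) (F : {mpoly K[4]}).
Hypothesis F4 : F \is 4.-homog.
Implicit Types (P : projspace K 3).

Lemma singular_locusP P :
  singular_locus F P <-> forall j, eval_at F^`M(j) (hcoord P) = 0.
Proof.
split=> [[]//|h]; split=> //; apply: (mulfI (_ : 4 != 0)); first by rewrite pnatr_eq0.
by rewrite -(eval_euler _ F4) mulr0 big1 // => j _; rewrite h mulr0.
Qed.

Lemma singular_tensor p : (forall j, eval_at F^`M(j) p = 0) ->
  forall x, quartic_tensor F p p p x = 0.
Proof.
by move=> h x; rewrite quartic_tensor_grad // eval_dder big1 ?mulr0 // => i _; rewrite h mulr0.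
Qed.

Lemma tensor_singular p : (forall x, quartic_tensor F p p p x = 0) ->
  forall j, eval_at F^`M(j) p = 0.
Proof.
move=> h j; have /eqP := h (delta_mx 0 j).
by rewrite quartic_tensor_grad // mulf_eq0 pnatr_eq0 dder_delta => /eqP.
Qed.

(** Modulo [p] a kernel vector of [A] may be taken with coordinate [i] equal to 0. For such vectors
    the equation of index [i] follows from the others, because [A] is symmetric and kills [p]. *)
Lemma minor_kernel n (A : 'M[K]_n.+1) (p : 'rV[K]_n.+1) i : A^T = A -> p *m A = 0 ->
  p 0 i != 0 ->
  \det (\matrix_(a, b) A (lift i a) (lift i b)) != 0 <->
  forall w, w *m A = 0 -> exists c, w = c *: p.
Proof.
move=> AT pA pi; set B := \matrix_(a, b) _; split.
  move=> Bn0 w wA; exists (w 0 i / p 0 i).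
  apply/eqP; rewrite -subr_eq0; set u := w - _.
  have ui : u 0 i = 0 by rewrite !mxE mulfVK ?subrr.
  have uA : u *m A = 0 by rewrite mulmxBl -scalemxAl pA scaler0 wA subr0.
  pose u' : 'rV[K]_n := \row_a u 0 (lift i a).
  have u'B : u' *m B = 0.
    apply/rowP => b; transitivity ((u *m A) 0 (lift i b)); last by rewrite uA !mxE.
    rewrite [RHS]mxE (bigD1_ord i) //= ui mul0r add0r mxE.
    by apply: eq_bigr => a _; rewrite !mxE.
  have u'0 : u' = 0.
    apply/eqP; apply: contraNT Bn0 => u'0; apply/det0P; by exists u'.
  apply/eqP/rowP => a; rewrite [RHS]mxE; case: (unliftP i a) => [b ->|->] //.
  by have /rowP/(_ b) := u'0; rewrite !mxE.
move=> h; apply/negP => /det0P [u' u'0 u'B].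
pose u : 'rV[K]_n.+1 := \row_a (if unlift i a is Some b then u' 0 b else 0).
have ui : u 0 i = 0 by rewrite mxE unlift_none.
have uA b : (u *m A) 0 (lift i b) = 0.
  transitivity ((u' *m B) 0 b); last by rewrite u'B mxE.
  rewrite [LHS]mxE [RHS]mxE (bigD1_ord i) //= ui mul0r add0r.
  by apply: eq_bigr => a _; rewrite !mxE liftK.
have uAi : (u *m A) 0 i = 0.
  have : (u *m A *m p^T) 0 0 = 0.
    by rewrite -mulmxA -{1}AT -trmx_mul pA trmx0 mulmx0 mxE.
  rewrite mxE (bigD1_ord i) //= big1 ?addr0 => [|b _]; last by rewrite uA mul0r.
  by rewrite [_^T _ _]mxE => /eqP; rewrite mulf_eq0 (negPf pi) orbF => /eqP.
have [|c uc] := h u.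
  by apply/rowP => a; rewrite [RHS]mxE; case: (unliftP i a) => [b ->|->].
have c0 : c = 0.
  by move: ui; rewrite uc mxE => /eqP; rewrite mulf_eq0 (negPf pi) orbF => /eqP.
case/eqP: u'0; apply/rowP => b; have := congr1 (fun z : 'rV_n.+1 => z 0 (lift i b)) uc.
by rewrite c0 scale0r !mxE liftK.
Qed.

Lemma kernel_tensor p (A := \matrix_(a, b) eval_at F^`M(a)^`M(b) p : 'M[K]_4) :
  nondeg_kernel (quartic_tensor F) p <-> forall w, w *m A = 0 -> exists c, w = c *: p.
Proof.
have E w b : quartic_tensor F p p w (delta_mx 0 b) = 2 * (w *m A) 0 b.
  rewrite quartic_tensor_hess // eval_dder mxE; congr (_ * _); apply: eq_bigr => a _.
  by rewrite dder_delta mxE mderiv_comm.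
split=> h w wA; apply: h.
  by move=> x; rewrite Phi_sum4 big1 // => b _; rewrite E wA mxE !mulr0.
apply/rowP => b; have /eqP := E w b; rewrite wA [in RHS]mxE.
by rewrite eq_sym mulf_eq0 pnatr_eq0 => /eqP.
Qed.

Lemma singular_kernel p (A := \matrix_(a, b) eval_at F^`M(a)^`M(b) p : 'M[K]_4) :
  (forall j, eval_at F^`M(j) p = 0) -> p *m A = 0.
Proof.
move=> h; apply/rowP => b; rewrite mxE [RHS]mxE.
under eq_bigr => a _ do rewrite [A _ _]mxE mderiv_comm.
by rewrite (eval_euler _ (mderiv_homog b F4)) h mulr0.
Qed.

Lemma hess_chart i (p : 'rV[K]_4) y : affine_vec i y = (p ord0 i)^-1 *: p ->
  hessian (dehomogenize i F) y =
  (p ord0 i)^-1 ^+ 2 *: \matrix_(a, b) eval_at F^`M(lift i a)^`M(lift i b) p.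
Proof.
move=> yp; apply/matrixP => a b; rewrite !mxE !mderiv_dehomogenize eval_dehomogenize yp.
by rewrite (eval_at_scale _ _ (mderiv_homog _ (mderiv_homog _ F4))).
Qed.

Lemma det_hess_chart i (p : 'rV[K]_4) y : p ord0 i != 0 -> affine_vec i y = (p ord0 i)^-1 *: p ->
  (forall j, eval_at F^`M(j) p = 0) ->
  \det (hessian (dehomogenize i F) y) != 0 <-> nondeg_kernel (quartic_tensor F) p.
Proof.
move=> pi yp h; rewrite (hess_chart yp) detZ mulf_eq0 !expf_eq0 invr_eq0 (negPf pi) andbF /=.
set A : 'M[K]_4 := \matrix_(a, b) eval_at F^`M(a)^`M(b) p.
have AT : A^T = A by apply/matrixP => a b; rewrite !mxE mderiv_comm.
have -> : \matrix_(a, b) eval_at F^`M(lift i a)^`M(lift i b) p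
    = \matrix_(a, b) A (lift i a) (lift i b) by apply/matrixP => a b; rewrite !mxE.
rewrite (minor_kernel AT (singular_kernel h) pi).
by apply: iff_sym; apply: kernel_tensor.
Qed.

(** Frees the node condition from the chart chosen in [is_node]. *)
Lemma is_nodeP P : singular_locus F P ->
  is_node F P <-> nondeg_kernel (quartic_tensor F) (hcoord P).
Proof.
move=> /singular_locusP h; split=> [[i [Pi [_ _ d]]]|d].
  by apply/(det_hess_chart Pi (affine_vec_coord Pi) h).
have [i Pi] := exists_hcoord P; exists i; split=> //.
split; last exact/(det_hess_chart Pi (affine_vec_coord Pi) h).
  rewrite eval_dehomogenize (affine_vec_coord Pi) (eval_at_scale _ _ F4).
  by have /singular_locusP [-> _] := h; rewrite mulr0.
move=> a; rewrite mderiv_dehomogenize eval_dehomogenize (affine_vec_coord Pi).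
by rewrite (eval_at_scale _ _ (mderiv_homog _ F4)) h mulr0.
Qed.

End Nodes.
End NodalQuartics.

(** * Nodes impose independent conditions on quartics *)

Module NodeIndependence.
Import mpoly QuarticForms InfinitesimalSymmetry NodeConditions NodalQuartics.
Local Open Scope classical_set_scope.
Local Open Scope ring_scope.

Section VeroneseSpan.
Variable K : numClosedFieldType.

Definition quartic_form (h : 'rV[K]_35) : {mpoly K[4]} := \sum_j h ord0 j *: veronese K j.

Lemma veronese_homog j : veronese K j \is 4.-homog.
Proof.
rewrite dhomogX; apply/eqP; rewrite /= mdegE.
set e := nth [::] quartic_exponents j.
have : all (fun e => (size e == 4) && (sumn e == 4)) quartic_exponents by [].
move=> /(all_nthP [::]) /(_ j); rewrite size_quartic_exponents => /(_ (ltn_ord j)).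
rewrite -/e => /andP[/eqP se /eqP e4]; rewrite -[RHS]e4.
under eq_bigr => k _ do rewrite mnmE.
by rewrite sumnE (big_nth 0%N) se big_mkord.
Qed.

Lemma quartic_form_homog h : quartic_form h \is 4.-homog.
Proof. by apply: rpred_sum => j _; rewrite rpredZ // veronese_homog. Qed.

Lemma quartic_monomial (m : 'X_{1..4}) : mdeg m = 4 -> exists j, veronese K j = 'X_[m].
Proof.
rewrite mdegE !big_ord_recl big_ord0 addn0 => dm.
set a := m _ in dm; set b := m _ in dm; set c := m _ in dm; set d := m _ in dm.
have : [:: a; b; c; d] \in quartic_exponents.
  have [a5 b5 c5] : [/\ a < 5, b < 5 & c < 5]%N by split; lia.
  have -> : d = (4 - a - b - c)%N by lia.
  have : (a + (b + (c + (4 - a - b - c))) = 4)%N by lia.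
  move: a b c a5 b5 c5 {dm} => a b c.
  (* A finite check: each of the three exponents is at most 4. *)
  by do 5?[case: a => [|a] //]; do 5?[case: b => [|b] //]; do 5?[case: c => [|c] //].
move=> /(nthP [::]) [j]; rewrite size_quartic_exponents => j35 ej.
exists (Ordinal j35); rewrite /veronese /= ej; congr 'X_[_]; apply/mnmP => k.
rewrite mnmE; case: k => [[|[|[|[|k]]]] k4] //=; rewrite /a /b /c /d; congr (m _); exact: val_inj.
Qed.

Lemma veronese_span (q : {mpoly K[4]}) : q \is 4.-homog -> exists h, q = quartic_form h.
Proof.
move=> /dhomogP hq; rewrite [q]mpolyE big_seq.
apply: (big_ind (fun p => exists h, p = quartic_form h)).
- by exists 0; rewrite /quartic_form big1 // => j _; rewrite mxE scale0r.
- move=> _ _ [h ->] [h' ->]; exists (h + h'); rewrite /quartic_form -big_split /=.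
  by apply: eq_bigr => j _; rewrite mxE scalerDl.
move=> m mq; have [j <-] := quartic_monomial (hq _ mq).
exists (q@_m *: delta_mx 0 j); rewrite /quartic_form (bigD1 j) //= big1 ?addr0.
  by rewrite !mxE !eqxx mulr1.
by move=> k /negPf kj; rewrite !mxE kj andbF mulr0 scale0r.
Qed.

(** Linear forms on the moment curve (1, t, t^2, t^3): each [v i] becomes a nonzero polynomial in t,
    and the product of these polynomials has a non-root. *)
Lemma generic_linear_form m (v : 'I_m -> 'rV[K]_4) : (forall i, v i != 0) ->
  exists h : 'cV[K]_4, forall i, (v i *m h) 0 0 != 0.
Proof.
move=> v0; pose Q := \prod_i rVpoly (v i).
have Q0 : Q != 0.
  by apply/prodf_neq0 => i _; apply: contraNneq (v0 i) => h; rewrite -[v i]rVpolyK h linear0.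
have [t Qt] : exists t, ~~ root Q t.
  pose rs := [seq (k%:R : K) | k <- iota 0 (size Q)].
  have u : uniq rs by rewrite map_inj_uniq ?iota_uniq // => i j /eqP; rewrite eqr_nat => /eqP.
  have : ~~ all (root Q) rs.
    by apply/negP => /(max_poly_roots Q0) /(_ u); rewrite size_map size_iota ltnn.
  by move=> /allPn [t _ tQ]; exists t.
exists (\col_k t ^+ k) => i; apply: contraNneq Qt => h0.
rewrite /root /Q horner_prod; apply/eqP; apply/eqP; rewrite prodf_seq_eq0; apply/hasP.
exists i; first exact: mem_index_enum.
rewrite /= /rVpoly horner_poly -[X in _ == X]h0 [X in _ == X]mxE; apply/eqP; apply: eq_bigr => k _.
by rewrite valK mxE.
Qed.

Definition nodal (F : {mpoly K[4]}) := forall P, singular_locus F P -> is_node F P.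

Theorem nodes_independent (F : {mpoly K[4]}) m (P : 'I_m -> projspace K 3) (c : 'I_m -> K) :
  F \is 4.-homog -> nodal F -> injective P -> (forall i, singular_locus F (P i)) ->
  (forall j, \sum_i c i * eval_at (veronese K j) (hcoord (P i)) = 0) ->
  forall i, c i = 0.
Proof.
move=> F4 Fnod P_inj Psing rel l; apply/eqP; apply: contraTT isT => cl.
have [h hP] := generic_linear_form (fun i => hcoord_neq0 (P i)).
pose s i := (hcoord (P i) *m h) 0 0; pose p i := (s i)^-1 *: hcoord (P i).
have psing i j : eval_at F^`M(j) (p i) = 0.
  rewrite (eval_at_scale _ _ (mderiv_homog j F4)).
  by have /(singular_locusP F4) -> := Psing i; rewrite mulr0.
have tnode q : q != 0 -> (forall x, quartic_tensor F q q q x = 0) ->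
    nondeg_kernel (quartic_tensor F) q.
  move=> q0 /(tensor_singular F4) qs.
  have [d d0 hq] := hcoord_line_of q0.
  have Qs : singular_locus F (line_of q0).
    by apply/(singular_locusP F4) => j; rewrite hq (eval_at_scale _ _ (mderiv_homog j F4)) qs mulr0.
  have /(is_nodeP F4 Qs) := Fnod _ Qs; rewrite hq => nd w wq.
  have [|e ->] := nd w; last by exists (e * d); rewrite scalerA.
  by move=> x; rewrite PhiZ1 PhiZ2 wq !mulr0.
have p0 i : p i != 0 by rewrite scaler_eq0 invr_eq0 negb_or hP hcoord_neq0.
(* The representatives [p i] are scaled to [h]-value 1; for a quartic the factor [s i ^+ 4] undoes
   the scaling. *)
have := @relation_symmetry K (quartic_tensor F) h m p (fun i => c i * s i ^+ 4) l.
case.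
- move=> i j pij; apply: P_inj; apply: (@projspace_eq _ _ _ _ (s i / s j)).
  apply: (@scalerI _ _ (s i)^-1); first by rewrite invr_eq0 hP.
  by rewrite scalerA mulKf ?hP.
- by move=> i; rewrite -scalemxAl mxE mulVf ?hP.
- by move=> i; apply: singular_tensor.
- by move=> i; apply: tnode => //; apply: singular_tensor.
- move=> f [q q4 fq]; have [g gq] := veronese_span q4.
  have E i : c i * s i ^+ 4 * f (p i)
      = \sum_j g ord0 j * (c i * eval_at (veronese K j) (hcoord (P i))).
    rewrite fq (eval_at_scale _ _ q4) -mulrA exprVn mulVKf ?expf_neq0 ?hP //.
    rewrite gq /eval_at /quartic_form raddf_sum mulr_sumr; apply: eq_bigr => j _.
    by rewrite /= mevalZ mulrCA.
  under eq_bigr => i _ do rewrite E.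
  by rewrite exchange_big big1 // => j _; rewrite -mulr_sumr rel mulr0.
- by rewrite mulf_neq0 ?expf_neq0 ?hP.
move=> M M0 /no_infinitesimal_symmetry MF; case/eqP: M0; exact: MF.
Qed.

End VeroneseSpan.
End NodeIndependence.

(** * The projective Nullstellensatz, by counting dimensions in each degree *)

Module ProjectiveNullstellensatz.
Import mpoly QuarticForms.

(** A subspace of largest dimension contained in [P] is all of [P]. *)
Lemma vspace_of_pred (K : fieldType) (V : vectType K) (P : V -> Prop) :
  P 0 -> (forall c u v, P u -> P v -> P (c *: u + v)) ->
  exists U : {vspace V}, forall v, v \in U <-> P v.
Proof.
move=> P0 Plin.
pose ok k := `[< exists U : {vspace V}, \dim U = k /\ forall v, v \in U -> P v >].
have ok0 : exists k, ok k.
  exists 0%N; apply/asboolP; exists 0%VS; rewrite dimv0; split=> // v.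
  by rewrite memv0 => /eqP ->.
have okle k : ok k -> (k <= \dim {:V})%N.
  by move=> /asboolP [U [<- _]]; apply: dimvS; apply: subvf.
case: (ex_maxnP ok0 okle) => k /asboolP [U [dU UP]] kmax.
exists U => v; split; first exact: UP.
move=> Pv; have /kmax : ok (\dim (<[v]> + U)).
  apply/asboolP; exists (<[v]> + U)%VS; split=> // w.
  by move=> /memv_addP [_ /vlineP [c ->] [u /UP Pu ->]]; apply: Plin.
rewrite -dU => dle; have : (U == <[v]> + U)%VS.
  by rewrite eqEdim addvSr dle.
by move=> /eqP ->; apply: (subvP (addvSl _ _)); apply: memv_line.
Qed.

Section Graded.
Variables (K : numClosedFieldType) (n : nat).
Notation S := {mpoly K[n.+1]}.
Implicit Types (I : nat -> S -> Prop) (p q l x y : S).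

(** The ideal is given through its graded pieces, because the arguments compare their
    codimensions. *)
Record graded_ideal I : Prop := GradedIdeal {
  graded_homog : forall d q, I d q -> q \is d.-homog;
  graded0 : forall d, I d 0;
  graded_lin : forall d c p q, I d p -> I d q -> I d (c *: p + q);
  gradedX : forall d k q, I d q -> I d.+1 ('X_k * q) }.

(** Stronger than not containing 1: the ideal contains no power of the ideal of all variables, as
    required for a zero in projective space. *)
Definition proper I := forall d, exists2 q, q \is d.-homog & ~ I d q.

(** The ideal generated by [I] and the linear form [l], which changes nothing in degree 0. *)
Definition add_form I l d q :=
  if d is e.+1 then exists2 a, a \is e.-homog & I e.+1 (q - l * a) else I 0%N q.

Lemma gradedD I d p q : graded_ideal I -> I d p -> I d q -> I d (p + q).
Proof. by move=> gI hp hq; have := graded_lin gI 1 hp hq; rewrite scale1r. Qed.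

Lemma gradedZ I d c p : graded_ideal I -> I d p -> I d (c *: p).
Proof. by move=> gI hp; have := graded_lin gI c hp (graded0 gI d); rewrite addr0. Qed.

Lemma graded_sum I d (J : Type) (r : seq J) (P : pred J) (f : J -> S) :
  graded_ideal I -> (forall j, P j -> I d (f j)) -> I d (\sum_(j <- r | P j) f j).
Proof. by move=> gI h; apply: big_ind => //; [exact: graded0|move=> *; exact: gradedD]. Qed.

Lemma homog_euler d q : q \is d.+1.-homog -> q = d.+1%:R^-1 *: \sum_k 'X_k * q^`M(k).
Proof. by move=> hq; rewrite (euler hq) scalerA mulVf ?scale1r // pnatr_eq0. Qed.

Lemma homog0 q : q \is 0.-homog -> q = (q@_0%MM)%:MP.
Proof.
move=> /dhomogP hq; apply/mpolyP => m; rewrite mcoeffC.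
have [->|m0] := eqVneq 0%MM m; first by rewrite mulr1.
rewrite mulr0; apply/eqP; apply: contraNT m0; rewrite -mcoeff_msupp => /hq h.
by rewrite eq_sym -mdeg_eq0; apply/eqP.
Qed.

Lemma gradedM I d e p q : graded_ideal I -> I d p -> q \is e.-homog -> I (d + e)%N (q * p).
Proof.
move=> gI hp; elim: e q => [|e IH] q hq.
  by rewrite (homog0 hq) addn0 mul_mpolyC; apply: gradedZ.
rewrite (homog_euler hq) -scalerAl mulr_suml; apply: gradedZ => //.
apply: graded_sum => // k _; rewrite -mulrA addnS; apply: gradedX => //.
exact/IH/mderiv_homog.
Qed.

Lemma graded_full I d : graded_ideal I -> (forall q, q \is d.-homog -> I d q) ->
  forall e q, (d <= e)%N -> q \is e.-homog -> I e q.
Proof.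
move=> gI h e; elim: e => [|e IH] q; first by case: d h => // h _; apply: h.
rewrite leq_eqVlt => /orP[/eqP <-|]; first exact: h.
rewrite ltnS => de hq; rewrite (homog_euler hq); apply: gradedZ => //.
by apply: graded_sum => // k _; apply: gradedX => //; apply/IH/mderiv_homog.
Qed.

Lemma add_form_graded I l : graded_ideal I -> l \is 1.-homog -> graded_ideal (add_form I l).
Proof.
move=> gI hl; split.
- case=> [|d] q /=; first exact: graded_homog.
  move=> [a ha /(graded_homog gI) h]; rewrite -(subrK (l * a) q) rpredD //.
  exact: (dhomogM hl ha).
- case=> [|d] /=; first exact: graded0.
  by exists 0; rewrite ?rpred0 // mulr0 subr0; apply: graded0.
- case=> [|d] c p q /=; first exact: graded_lin.
  move=> [a ha pa] [b hb qb]; exists (c *: a + b); first by rewrite rpredD ?rpredZ.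
  have -> : c *: p + q - l * (c *: a + b) = c *: (p - l * a) + (q - l * b).
    by rewrite mulrDr -scalerAr scalerBr opprD addrACA.
  exact: graded_lin.
case=> [|d] k q /=.
  move=> h; exists 0; first exact: rpred0.
  by rewrite mulr0 subr0; apply: gradedX.
move=> [a ha qa]; exists ('X_k * a); first exact: (dhomogM (dhomog_X _ k) ha).
by rewrite mulrCA -mulrBr; apply: gradedX.
Qed.

Lemma add_form_sub I l d q : graded_ideal I -> I d q -> add_form I l d q.
Proof.
by case: d => //= d gI h; exists 0; rewrite ?rpred0 // mulr0 subr0.
Qed.

Lemma add_form_mono I J l d q : (forall d q, I d q -> J d q) -> add_form I l d q ->
  add_form J l d q.
Proof. by case: d => [|d] IJ /=; [exact: IJ | move=> [a ha /IJ h]; exists a]. Qed.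

Lemma add_form_mem I l : graded_ideal I -> add_form I l 1 l.
Proof.
by move=> gI; exists 1; rewrite ?dhomog1 // mulr1 subrr; apply: graded0.
Qed.

Notation Sd d := (dhomog n.+1 K d).

Definition mulform d l (v : Sd d) : Sd d.+1 := indhomog d.+1 (l * (v : S)).

Lemma mulformE d l (v : Sd d) : l \is 1.-homog -> (mulform l v : S) = l * v.
Proof.
move=> hl; rewrite /mulform /indhomog insubdK //.
by have := dhomogM hl (dhomog_is_dhomog v); rewrite add1n.
Qed.

Lemma mulform_linear d l : l \is 1.-homog -> linear (@mulform d l).
Proof.
move=> hl c u v; apply: val_inj.
have : mpoly_of_dhomog (mulform l (c *: u + v)) = mpoly_of_dhomog (c *: mulform l u + mulform l v).
  by rewrite mulformE // !linearP /= !mulformE // mulrDr scalerAr.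
by [].
Qed.

Definition mulformL d l : 'Hom(Sd d, Sd d.+1) := linfun (@mulform d l).

Lemma mulformLE d l (v : Sd d) : l \is 1.-homog -> mulformL d l v = mulform l v.
Proof.
move=> hl; pose f := GRing.isLinear.Build _ _ _ _ _ (@mulform_linear d l hl).
pose g : {linear Sd d -> Sd d.+1} := HB.pack (@mulform d l) f.
exact: (lfunE g).
Qed.

Lemma graded_vspace I d : graded_ideal I ->
  exists U : {vspace Sd d}, forall v, v \in U <-> I d (v : S).
Proof.
move=> gI; apply: vspace_of_pred; first by rewrite linear0; apply: graded0.
by move=> c u v hu hv; rewrite linearP; apply: graded_lin.
Qed.

Lemma homog_sort d q : q \is d.-homog -> exists v : Sd d, (v : S) = q.
Proof. by move=> hq; exists (DHomog hq). Qed.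

(** The induced map from V/U to W/U' is onto. *)
Lemma codim_le (V W : vectType K) (f : 'Hom(V, W)) (U : {vspace V}) (U' : {vspace W}) :
  (f @: U <= U')%VS -> (f @: fullv + U' = fullv)%VS ->
  (\dim {:W} - \dim U' <= \dim {:V} - \dim U)%N.
Proof.
move=> fU full.
have hC : (fullv <= f @: U^C + U')%VS.
  rewrite -full subv_add addvSr andbT -(addv_complf U) limgD subv_add addvSl andbT.
  exact: subv_trans fU (addvSr _ _).
have := leq_trans (dimvS hC) (dimv_add_leqif _ _).
have := dimv_compl U; have := limg_ker_dim f (U^C)%VS.
move: (\dim (_ :&: lker f)) (\dim fullv) (\dim U') (\dim (f @: U^C)) => *; lia.
Qed.

Lemma add_form_fullv I l d (U : {vspace Sd d.+1}) : l \is 1.-homog -> graded_ideal I ->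
  (forall v : Sd d.+1, v \in U <-> I d.+1 (v : S)) ->
  (forall q, q \is d.+1.-homog -> add_form I l d.+1 q) ->
  (mulformL d l @: fullv + U = fullv)%VS.
Proof.
move=> hl gI UI full; apply/eqP; rewrite eqEsubv subvf; apply/subvP => v _.
have [a ha hI] := full _ (dhomog_is_dhomog v).
have [w wa] := homog_sort ha; have {hI} : I d.+1 ((v - mulformL d l w : Sd d.+1) : S).
  by rewrite linearB /= mulformLE // mulformE // wa.
move=> /UI hU; rewrite -(subrK (mulformL d l w) v) addrC; apply: memv_add => //.
exact/memv_img/memvf.
Qed.

(* If x generates S/I in degrees > e, then multiplication by x is bijective on S/I in
   large degrees; y - lam * x fails to be injective for some eigenvalue lam of y / x. *)
Lemma proper_add_form I x y e : graded_ideal I -> proper I ->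
  x \is 1.-homog -> y \is 1.-homog ->
  (forall q, q \is e.-homog -> add_form I x e q) ->
  exists lam, proper (add_form I (y - lam *: x)).
Proof.
move=> gI pI hx hy full.
have xfull d q : (e <= d)%N -> q \is d.-homog -> add_form I x d q.
  by apply: graded_full full _ _; apply: add_form_graded.
pose U d := sval (cid (graded_vspace d gI)).
have UI d v : v \in U d <-> I d (v : S) by apply: (svalP (cid (graded_vspace d gI))).
pose c d := (\dim {: Sd d} - \dim (U d))%N.
have cpos d : (0 < c d)%N.
  rewrite subn_gt0; have [q qd qI] := pI d; have [v vq] := homog_sort qd.
  rewrite ltn_neqAle dimvS ?subvf // andbT; apply/negP => /eqP dU.
  have : (U d == fullv)%VS by rewrite eqEdim subvf dU leqnn.
  by move=> /eqP UF; apply: qI; rewrite -vq; apply/UI; rewrite UF memvf.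
have mulU d l : l \is 1.-homog -> (mulformL d l @: U d <= U d.+1)%VS.
  move=> hl; apply/subvP => _ /memv_imgP [v /UI vU ->]; apply/UI.
  by rewrite mulformLE // mulformE //; have := gradedM gI vU hl; rewrite addn1.
have xU d : (e <= d)%N -> (mulformL d x @: fullv + U d.+1 = fullv)%VS.
  by move=> ed; apply: (add_form_fullv hx gI (UI d.+1)) => q; apply: xfull; apply: leqW.
have cS d : (e <= d)%N -> (c d.+1 <= c d)%N.
  by move=> ed; apply: codim_le (xU d ed); apply: mulU.
(* The codimensions [c d] do not increase from degree [e] on, so they are constant from a degree [D]
   where they are least. *)
have [D eD cD] : exists2 D, (e <= D)%N & forall d, (D <= d)%N -> c d = c D.
  have [k [m [em cm]] kmin] : exists2 k, (exists m, (e <= m)%N /\ c m = k) &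
      forall m, (e <= m)%N -> (k <= c m)%N.
    have ex0 : exists k, `[< exists m, (e <= m)%N /\ c m = k >].
      by exists (c e); apply/asboolP; exists e.
    case: (ex_minnP ex0) => k /asboolP hk hmin; exists k => // m em.
    by apply: hmin; apply/asboolP; exists m.
  exists m => // d md; have ed := leq_trans em md.
  apply/eqP; rewrite eqn_leq cm kmin // andbT -cm.
  elim: d md {ed} => [|d IH]; first by rewrite leqn0 => /eqP <-.
  rewrite leq_eqVlt => /orP[/eqP <- //|]; rewrite ltnS => md.
  by apply: leq_trans (IH md); apply: cS; apply: leq_trans md.
(* If [l] is onto modulo the ideal and kills the class of [v], then adjoining [v] to [U d] gives c
   d.+1 < c d, against the constancy of [c]. *)
have drop d l (v : Sd d) : (D <= d)%N -> l \is 1.-homog -> v \notin U d ->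
    mulformL d l v \in U d.+1 -> (mulformL d l @: fullv + U d.+1 = fullv)%VS -> False.
  move=> Dd hl vU lvU lfull.
  have hW : (mulformL d l @: (<[v]> + U d) <= U d.+1)%VS.
    by rewrite limgD subv_add mulU // andbT limg_line -memvE.
  have := codim_le hW lfull; rewrite -/(c d.+1) (cD _ (leqW Dd)) -(cD _ Dd).
  have : (\dim (U d) < \dim (<[v]> + U d))%N.
    rewrite ltn_neqAle dimvS ?addvSr // andbT; apply: contraNneq vU => dU.
    have /eqP -> : (U d == <[v]> + U d)%VS by rewrite eqEdim addvSr dU leqnn.
    by rewrite (subvP (addvSl _ _)) // memv_line.
  by have := cpos d; rewrite /c; move: (\dim _) (\dim _) (\dim _) => *; lia.
have xinj d (v : Sd d) : (D <= d)%N -> v \notin U d -> mulformL d x v \notin U d.+1.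
  move=> Dd vU; apply/negP => xv; apply: (drop d x v) => //.
  by apply: xU; apply: leq_trans Dd.
have [lam [v vU zv]] : exists lam, exists2 v : Sd D, v \notin U D &
    mulformL D (y - lam *: x) v \in U D.+1.
  pose C := (U D)^C%VS; pose b := vbasis C.
  have cE : \dim C = c D by rewrite dimv_compl.
  have hdec w : exists r : 'rV[K]_(\dim C),
      w - \sum_j r 0 j *: mulformL D x b`_j \in U D.+1.
    have : w \in (mulformL D x @: fullv + U D.+1)%VS by rewrite xU // memvf.
    rewrite -(addv_complf (U D)) limgD => /memv_addP [w1 + [w2 w2U ->]].
    move=> /memv_addP [w3 w3U [_ /memv_imgP [w4 w4C ->] ->]].
    exists (\row_j coord b j w4).
    rewrite {1}(coord_vbasis w4C) linear_sum /=.
    under eq_bigr => j _ do rewrite linearZ /=.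
    under [X in _ - X]eq_bigr => j _ do rewrite mxE.
    rewrite addrAC addrK memvD //.
    by apply: (subvP (mulU D x hx)).
  pose A (i : 'I_(\dim C)) := sval (cid (hdec (mulformL D y b`_i))).
  have hA (i : 'I_(\dim C)) : mulformL D y b`_i - \sum_j A i 0 j *: mulformL D x b`_j \in U D.+1.
    exact: (svalP (cid (hdec (mulformL D y b`_i)))).
  move: A hA => A hA.
  (* The matrix of y / x on the quotient in degree [D], in the basis [b] of a complement of the
     ideal. An eigenvector is a class killed by [y - lam *: x]. *)
  pose B : 'M[K]_(\dim C) := \matrix_(i, j) A i 0 j.
  have [lam /eigenvalueP [r rB r0]] : exists lam, eigenvalue B lam.
    by apply: eigenvalue_closed; rewrite cE.
  exists lam; exists (\sum_i r 0 i *: b`_i).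
    apply/negP => bU.
    have bC : \sum_i r 0 i *: b`_i \in C.
      by apply: memv_suml => i _; rewrite memvZ // vbasis_mem // mem_nth // size_tuple.
    have : \sum_i r 0 i *: b`_i = 0.
      have : \sum_i r 0 i *: b`_i \in (U D :&: C)%VS by rewrite memv_cap bU.
      by rewrite capv_compl memv0 => /eqP.
    have /freeP fb := basis_free (vbasisP C); move=> /(fb (fun i => r 0 i)) rz; case/eqP: r0; apply/rowP => i.
    by rewrite mxE rz.
  have mB (w : Sd D) : mulformL D (y - lam *: x) w = mulformL D y w - lam *: mulformL D x w.
    have hz : y - lam *: x \is 1.-homog by rewrite rpredB ?rpredZ.
    apply: val_inj; rewrite !mulformLE //.
    have : mpoly_of_dhomog (mulform (y - lam *: x) w)
       = mpoly_of_dhomog (mulform y w - lam *: mulform x w).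
      by rewrite (mulformE w hz) [RHS]linearB [X in _ - X]linearZ /= (mulformE w hy) (mulformE w hx) mulrBl scalerAl.
    by [].
  rewrite linear_sum /=; under eq_bigr => i _ do rewrite mB.
  have -> : \sum_i (mulformL D y (r 0 i *: b`_i) - lam *: mulformL D x (r 0 i *: b`_i))
     = \sum_i r 0 i *: (mulformL D y b`_i - \sum_j A i 0 j *: mulformL D x b`_j).
    rewrite !sumrB; under [RHS]eq_bigr => i _ do rewrite scalerBr.
    rewrite sumrB; congr (_ - _).
      by apply: eq_bigr => i _; rewrite linearZ.
    under [RHS]eq_bigr => i _ do rewrite scaler_sumr.
    rewrite exchange_big /=; apply: eq_bigr => j _.
    under eq_bigr => i _ do rewrite scalerA.
    rewrite -scaler_suml linearZ scalerA; congr (_ *: _).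
    have := congr1 (fun z : 'rV_(\dim C) => z 0 j) rB; rewrite !mxE => <-.
    by apply: eq_bigr => i _; rewrite mxE.
  by apply: memv_suml => i _; rewrite memvZ.
exists lam; set z := y - lam *: x in zv *.
have hz : z \is 1.-homog by rewrite rpredB ?rpredZ.
have gz := add_form_graded gI hz.
(* Multiplication by [x], injective from [D] on, carries the killed class into every higher
   degree. *)
have chain k : exists2 w : Sd (k + D), w \notin U (k + D)%N &
    mulformL (k + D) z w \in U (k + D).+1.
  elim: k => [|k [w wU zw]]; first by exists v.
  exists (mulformL (k + D) x w); first by rewrite xinj // leq_addl.
  have -> : mulformL (k.+1 + D) z (mulformL (k + D) x w)
          = mulformL (k + D).+1 x (mulformL (k + D) z w).
    apply: val_inj; have : mpoly_of_dhomog (mulformL (k.+1 + D) z (mulformL (k + D) x w))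
      = mpoly_of_dhomog (mulformL (k + D).+1 x (mulformL (k + D) z w)).
      by rewrite !mulformLE // !mulformE // mulrCA.
    by [].
  by apply: (subvP (mulU _ x hx)); apply: memv_img.
move=> d; apply: contrapT => nq.
have zf q : q \is d.-homog -> add_form I z d q.
  by move=> qd; apply: contrapT => h; apply: nq; exists q.
(* If the enlarged ideal were everything in degree [d], multiplication by [z] would be onto from
   there on and could not kill a class, by [drop]. *)
have [w wU zw] := chain d; apply: (drop _ z w) => //; first exact: leq_addl.
apply: (add_form_fullv hz gI (UI _)) => q hq; apply: graded_full zf _ _ _ hq => //.
exact/leqW/leq_addr.
Qed.

(** Modulo [I] every variable is a multiple of [X_i], so a form reduces to its value at [a] times a
    power of [X_i]. Euler's formula carries the induction on the degree. *)
Lemma graded_point I i (a : 'rV[K]_n.+1) : graded_ideal I ->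
  (forall k, I 1%N ('X_k - a 0 k *: 'X_i)) ->
  forall d q, q \is d.-homog -> I d (q - eval_at q a *: 'X_i ^+ d).
Proof.
move=> gI ha; elim=> [|d IH] q hq.
  rewrite (homog0 hq) /eval_at mevalC expr0 -mul_mpolyC mulr1 subrr.
  exact: graded0.
have E : q - eval_at q a *: 'X_i ^+ d.+1 = d.+1%:R^-1 *:
   \sum_k ('X_k * (q^`M(k) - eval_at q^`M(k) a *: 'X_i ^+ d)
     + eval_at q^`M(k) a *: ('X_i ^+ d * ('X_k - a 0 k *: 'X_i))).
  have d0 : d.+1%:R != 0 :> K by rewrite pnatr_eq0.
  rewrite -[eval_at q a](mulKf d0) -(eval_euler _ hq) {1}(homog_euler hq).
  rewrite -scalerA -scalerBr; congr (_ *: _); rewrite scaler_suml -sumrB.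
  apply: eq_bigr => k _; rewrite !mulrBr !scalerBr -!scalerAr scalerA -exprSr.
  rewrite -addrA; congr (_ + _); rewrite [_ * a 0 k]mulrC ['X_k * _]mulrC.
  by rewrite addKr.
rewrite E; apply: gradedZ => //; apply: graded_sum => // k _; apply: gradedD => //.
  by apply: gradedX => //; apply: IH; apply: mderiv_homog.
apply: gradedZ => //; have h := dhomogMn d (dhomog_X K i).
by have := gradedM gI (ha k) h; rewrite mul1n add1n.
Qed.

Theorem projective_nullstellensatz I : graded_ideal I -> proper I ->
  exists2 v : 'rV[K]_n.+1, v != 0 & forall d q, I d q -> eval_at q v = 0.
Proof.
move=> gI pI.
(* Variables are added to the ideal as long as it stays proper. Afterwards each variable either lies
   in it or generates the quotient in large degrees. *)
pose done_var J k := J 1%N 'X_k \/ exists e, forall q, q \is e.-homog -> add_form J 'X_k e q.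
have step1 (s : seq 'I_n.+1) : exists J, [/\ graded_ideal J, proper J,
    forall d q, I d q -> J d q & forall k, k \in s -> done_var J k].
  elim: s => [|k s [J [gJ pJ IJ Js]]]; first by exists I.
  have hk : 'X_k \is 1.-homog := dhomog_X K k.
  have [pk|npk] := pselect (proper (add_form J 'X_k)).
    exists (add_form J 'X_k); split=> //; first exact: add_form_graded.
      by move=> d q /IJ; apply: add_form_sub.
    move=> k'; rewrite inE => /orP[/eqP ->|/Js [h|[e he]]].
    - by left; apply: add_form_mem.
    - by left; apply: add_form_sub.
    - right; exists e => q /he; apply: add_form_mono => d p; exact: add_form_sub.
  exists J; split=> // k'; rewrite inE => /orP[/eqP ->|/Js //]; right.
  apply: contrapT => h; apply: npk => d; apply: contrapT => h'; apply: h.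
  exists d => q qd; apply: contrapT => nq; apply: h'; by exists q.
have [J [gJ pJ IJ Jdone]] := step1 (enum 'I_n.+1).
have [i iJ] : exists i, ~ J 1%N 'X_i.
  apply: contrapT => h; have [q q1] := pJ 1%N; apply.
  rewrite (homog_euler q1); apply: gradedZ => //; apply: graded_sum => // k _.
  have Jk : J 1%N 'X_k by apply: contrapT => hk; apply: h; exists k.
  by have := gradedM gJ Jk (mderiv_homog k q1); rewrite addn0 mulrC.
have [e he] : exists e, forall q, q \is e.-homog -> add_form J 'X_i e q.
  by have [//|] : done_var J i by apply: Jdone; rewrite mem_enum.
have hi : 'X_i \is 1.-homog := dhomog_X K i.
(* The variable [X_i] generates the quotient in large degrees, so [proper_add_form] makes every
   variable a multiple of it while the ideal stays proper. The result contains the ideal of a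
   point. *)
have step2 (s : seq 'I_n.+1) : exists J', [/\ graded_ideal J', proper J',
    forall d q, J d q -> J' d q & forall k, k \in s -> exists a, J' 1%N ('X_k - a *: 'X_i)].
  elim: s => [|k s [J' [gJ' pJ' JJ' Js]]]; first by exists J.
  have hk : 'X_k \is 1.-homog := dhomog_X K k.
  have he' q : q \is e.-homog -> add_form J' 'X_i e q.
    by move=> /he; apply: add_form_mono.
  have [a pa] := proper_add_form gJ' pJ' hi hk he'.
  have ha : 'X_k - a *: 'X_i \is 1.-homog by rewrite rpredB ?rpredZ.
  exists (add_form J' ('X_k - a *: 'X_i)); split=> //; first exact: add_form_graded.
    by move=> d q /JJ'; apply: add_form_sub.
  move=> k'; rewrite inE => /orP[/eqP ->|/Js [b hb]].
    by exists a; apply: add_form_mem.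
  by exists b; apply: add_form_sub.
have [J' [gJ' pJ' JJ' Jpt]] := step2 (enum 'I_n.+1).
have hpt k : exists a, J' 1%N ('X_k - a *: 'X_i) by apply: Jpt; rewrite mem_enum.
pose a : 'rV[K]_n.+1 := \row_k (if k == i then 1 else sval (cid (hpt k))).
have ha k : J' 1%N ('X_k - a 0 k *: 'X_i).
  rewrite mxE; case: eqP => [->|_]; last exact: (svalP (cid (hpt k))).
  by rewrite scale1r subrr; apply: graded0.
exists a.
  apply/eqP => /rowP /(_ i); rewrite !mxE eqxx => /eqP; by rewrite oner_eq0.
move=> d q Iq; apply: contrapT => /eqP qa; have [p pd] := pJ' d; apply.
have hJ := graded_point gJ' ha.
have Jq := JJ' _ _ (IJ _ _ Iq).
have Xi : J' d ('X_i ^+ d).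
  have -> : 'X_i ^+ d = (eval_at q a)^-1 *: (q + (-1) *: (q - eval_at q a *: 'X_i ^+ d)).
    by rewrite scaleN1r opprB addrC subrK scalerA mulVf ?scale1r.
  apply: gradedZ => //; apply: gradedD => //; apply: gradedZ => //.
  exact/hJ/(graded_homog gI Iq).
rewrite -(subrK (eval_at p a *: 'X_i ^+ d) p); apply: gradedD => //; first exact: hJ.
exact: gradedZ.
Qed.

(* The coefficients need not be homogeneous, only the products a i * g i. *)
Definition gen_ideal r (g : 'I_r -> S) d q :=
  exists2 a : 'I_r -> S, forall i, a i * g i \is d.-homog & q = \sum_i a i * g i.

Lemma gen_ideal_graded r (g : 'I_r -> S) : graded_ideal (gen_ideal g).
Proof.
split.
- by move=> d q [a ha ->]; apply: rpred_sum => i _; exact: ha.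
- move=> d; exists (fun=> 0); first by move=> i; rewrite mul0r rpred0.
  by rewrite big1 // => i _; rewrite mul0r.
- move=> d c p q [a ha ->] [b hb ->]; exists (fun i => c *: a i + b i).
    by move=> i; rewrite mulrDl -scalerAl rpredD ?rpredZ.
  rewrite scaler_sumr -big_split; apply: eq_bigr => i _ /=.
  by rewrite mulrDl -scalerAl.
move=> d k q [a ha ->]; exists (fun i => 'X_k * a i).
  by move=> i; rewrite -mulrA; apply: (dhomogM (dhomog_X K k) (ha i)).
by rewrite mulr_sumr; apply: eq_bigr => i _; rewrite mulrA.
Qed.

Corollary gen_ideal_full r (g : 'I_r -> S) (e : 'I_r -> nat) :
  (forall i, g i \is (e i).-homog) ->
  (forall v : 'rV[K]_n.+1, v != 0 -> exists i, eval_at (g i) v != 0) ->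
  exists D, forall d q, (D <= d)%N -> q \is d.-homog -> gen_ideal g d q.
Proof.
move=> hg nz; have gI := gen_ideal_graded g.
have [pI|npI] := pselect (proper (gen_ideal g)).
  have [v v0 hv] := projective_nullstellensatz gI pI.
  have [l] := nz v v0; rewrite (hv (e l)) ?eqxx //.
  exists (fun j => if j == l then 1 else 0).
    by move=> j; case: eqP => [->|_]; rewrite ?mul1r // mul0r rpred0.
  rewrite (bigD1 l) //= eqxx mul1r big1 ?addr0 // => j /negPf ->.
  by rewrite mul0r.
have [D hD] : exists D, forall q, q \is D.-homog -> gen_ideal g D q.
  apply: contrapT => h; apply: npI => d; apply: contrapT => h'; apply: h.
  exists d => q qd; apply: contrapT => nq; apply: h'; by exists q.
by exists D => d q Dd qd; apply: (graded_full gI hD Dd qd).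
Qed.

End Graded.
End ProjectiveNullstellensatz.

(** * The Jacobian ideal of a nodal quartic is saturated in large degrees *)

Module JacobianIdeal.
Import mpoly QuarticForms InfinitesimalSymmetry NodeConditions NodalQuartics NodeIndependence.
Import ProjectiveNullstellensatz.
Local Open Scope classical_set_scope.
Local Open Scope ring_scope.

Section HomogeneousCoefficients.
Variables (K : numClosedFieldType) (n : nat).
Notation S := {mpoly K[n.+1]}.

Lemma pihomogM d e (a g : S) : g \is e.-homog -> (e <= d)%N ->
  pihomog mdeg d (a * g) = pihomog mdeg (d - e) a * g.
Proof.
move=> hg ed; rewrite [in LHS](@pihomog_partitionE _ _ mdeg (mmeasure mdeg a) a) //.
rewrite mulr_suml raddf_sum /=.
have E i : pihomog mdeg d (pihomog mdeg i a * g) =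
    if i == (d - e)%N then pihomog mdeg i a * g else 0.
  have h := dhomogM (pihomogP mdeg i a) hg.
  case: eqP => [ide|/eqP ide]; last first.
    by apply: (pihomog_ne0 _ h); apply: contraNneq ide => <-; rewrite addnK.
  by rewrite ide subnK // in h; rewrite ide; apply: pihomog_dE.
under eq_bigr => i _ do rewrite E.
have [lt|ge] := ltnP (d - e) (mmeasure mdeg a).
  rewrite (bigD1 (Ordinal lt)) //= eqxx big1 ?addr0 // => i /negPf.
  by rewrite -val_eqE /= => ->.
rewrite big1 => [|i _].
  have -> : pihomog mdeg (d - e) a = 0; last by rewrite mul0r.
  rewrite {1}(@pihomog_partitionE _ _ mdeg (mmeasure mdeg a) a) // raddf_sum big1 // => i _.
  apply: (@pihomog_ne0 _ _ mdeg i); last exact: pihomogP.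
  by apply: contraTneq (ltn_ord i) => ->; rewrite -leqNgt.
by case: eqP => // ide; have := ltn_ord i; rewrite ide ltnNge ge.
Qed.

Lemma gen_ideal_homog r (g : 'I_r -> S) (e : 'I_r -> nat) d q :
  (forall i, g i \is (e i).-homog) -> (forall i, (e i <= d)%N) -> gen_ideal g d q ->
  exists2 a : 'I_r -> S, forall i, a i \is (d - e i).-homog & q = \sum_i a i * g i.
Proof.
move=> hg he [a ha ->]; exists (fun i => pihomog mdeg (d - e i) (a i)).
  by move=> i; apply: pihomogP.
by apply: eq_bigr => i _; rewrite -pihomogM // pihomog_dE.
Qed.

Lemma gen_ideal_of_sum r (g : 'I_r -> S) (e : 'I_r -> nat) d q (a : 'I_r -> S) :
  (forall i, g i \is (e i).-homog) -> (forall i, (e i <= d)%N) -> q \is d.-homog ->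
  q = \sum_i a i * g i -> gen_ideal g d q.
Proof.
move=> hg he hq qE; exists (fun i => pihomog mdeg (d - e i) (a i)).
  move=> i; have := dhomogM (pihomogP mdeg (d - e i) (a i)) (hg i).
  by rewrite subnK.
rewrite -(pihomog_dE hq) qE raddf_sum; apply: eq_bigr => i _.
by rewrite -pihomogM.
Qed.

Lemma det_homog s (A : 'M[S]_s) d : (forall i j, A i j \is d.-homog) ->
  \det A \is (s * d).-homog.
Proof.
move=> hA; apply: rpred_sum => sg _; rewrite -signr_odd.
have hp : \prod_i A i (perm.fun_of_perm.body sg i) \is (s * d).-homog.
  have -> : (s * d = \sum_(i < s) d)%N by rewrite sum_nat_const card_ord.
  elim/big_rec2: _ => [|i m q _ hq]; first exact: dhomog1.
  exact: dhomogM.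
by case: (odd _); rewrite ?expr1 ?mulN1r ?expr0 ?mul1r ?rpredN.
Qed.

(** This is [graded_point] for the ideal of the point, with remainder q(a) times a power of [X_i],
    which is zero. *)
Lemma point_ideal (a : 'rV[K]_n.+1) i d q : a 0 i = 1 -> q \is d.+1.-homog -> eval_at q a = 0 ->
  exists2 b : 'I_n.+1 -> S, forall k, b k \is d.-homog &
    q = \sum_k b k * ('X_k - a 0 k *: 'X_i).
Proof.
move=> ai hq qa.
pose l k : S := 'X_k - a 0 k *: 'X_i.
have hl k : l k \is 1.-homog by rewrite rpredB ?rpredZ // dhomog_X.
have gI := gen_ideal_graded l.
have hI k : gen_ideal l 1 (l k).
  exists (fun j => if j == k then 1 else 0).
    by move=> j; case: eqP => [->|_]; rewrite ?mul1r // mul0r rpred0.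
  rewrite (bigD1 k) //= eqxx mul1r big1 ?addr0 // => j /negPf ->.
  by rewrite mul0r.
have := graded_point gI hI hq; rewrite qa scale0r subr0.
move=> /(gen_ideal_homog (e := fun=> 1%N) hl) [//|b hb ->].
by exists b => // k; have := hb k; rewrite subn1.
Qed.

End HomogeneousCoefficients.

Section Jacobian.
Variables (K : numClosedFieldType) (F : {mpoly K[4]}).
Hypothesis F4 : F \is 4.-homog.
Notation G := (fun j : 'I_4 => F^`M(j)).

Lemma jac_homog j : G j \is 3.-homog. Proof. exact: mderiv_homog. Qed.

Definition in_jac q := exists a : 'I_4 -> {mpoly K[4]}, q = \sum_j a j * G j.

Lemma in_jacM p q : in_jac q -> in_jac (p * q).
Proof.
move=> [a ->]; exists (fun j => p * a j); rewrite mulr_sumr.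
by apply: eq_bigr => j _; rewrite mulrA.
Qed.

Lemma in_jac_sum (I : Type) (r : seq I) (f : I -> {mpoly K[4]}) :
  (forall i, in_jac (f i)) -> in_jac (\sum_(i <- r) f i).
Proof.
move=> h; apply: (big_ind in_jac) => //.
  by exists (fun=> 0); rewrite big1 // => j _; rewrite mul0r.
move=> _ _ [a ->] [b ->]; exists (fun j => a j + b j); rewrite -big_split.
by apply: eq_bigr => j _; rewrite mulrDl.
Qed.

Lemma eval_in_jac q v : in_jac q -> (forall j, eval_at (G j) v = 0) -> eval_at q v = 0.
Proof.
move=> [a ->] h; rewrite /eval_at raddf_sum big1 // => j _ /=.
by rewrite mevalM [X in _ * X]h mulr0.
Qed.

(* Write the partials of F in terms of the linear forms through the point: the
   matrix of coefficients specializes to the Hessian, and Cramer's rule applies. *)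
Lemma node_local P : singular_locus F P -> is_node F P ->
  exists2 u : {mpoly K[4]}, u \is 6.-homog /\ eval_at u (hcoord P) != 0 &
    forall d q, q \is d.-homog -> eval_at q (hcoord P) = 0 -> in_jac (u * q).
Proof.
move=> Psing [i [Pi [_ _ hdet]]].
have /(singular_locusP F4) Fsing := Psing.
pose a := (hcoord P ord0 i)^-1 *: hcoord P.
have ai : a 0 i = 1 by rewrite mxE mulVf.
have Pa : hcoord P = hcoord P ord0 i *: a by rewrite scalerA mulfV // scale1r.
have Ga j : eval_at (G j) a = 0 by rewrite (eval_at_scale _ _ (jac_homog j)) Fsing mulr0.
pose l k : {mpoly K[4]} := 'X_k - a 0 k *: 'X_i.
have la k : eval_at (l k) a = 0.
  by rewrite /eval_at mevalB mevalZ !mevalXU ai mulr1 subrr.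
have dl k b : (l (lift i k))^`M(lift i b) = (k == b)%:R.
  rewrite mderivB mderivZ !mderivX !mnm1E (inj_eq lift_inj) eq_sym (negPf (neq_lift _ _)).
  rewrite scale0r scaler0 subr0; case: eqP => [->|]; last by rewrite scale0r.
  have mm (c : 'X_{1..4}) : (c - c = 0)%MM by apply/mnmP => t; rewrite mnmBE mnm0E subnn.
  by rewrite mm scale1r mpolyX0.
have li : l i = 0 by rewrite /l ai scale1r subrr.
have hA j : exists2 b : 'I_4 -> {mpoly K[4]}, forall k, b k \is 2.-homog &
    G j = \sum_k b k * l k by apply: point_ideal; rewrite ?jac_homog.
pose A j k := sval (cid2 (hA j)) k.
have A2 j k : A j k \is 2.-homog by rewrite /A; case: (cid2 (hA j)) => /= b hb _.
have AE j : G j = \sum_k A j (lift i k) * l (lift i k).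
  rewrite /A; case: (cid2 (hA j)) => /= b _ ->.
  by rewrite (bigD1_ord i) //= li mulr0 add0r.
move: A A2 AE => A A2 AE {hA}.
pose B : 'M[{mpoly K[4]}]_3 := \matrix_(j, k) A (lift i j) (lift i k).
have hB : map_mx (fun q => eval_at q a) B
    = \matrix_(j, k) eval_at F^`M(lift i j)^`M(lift i k) a.
  apply/matrixP => j k; rewrite !mxE AE raddf_sum /= /eval_at raddf_sum /=.
  rewrite (bigD1 k) //= big1 ?addr0 => [|b bk]; rewrite mderivM mevalD !mevalM.
    by rewrite [X in _ * X]la mulr0 add0r dl eqxx meval1 mulr1.
  by rewrite [X in _ * X + _]la mulr0 add0r dl (negPf bk) meval0 mulr0.
pose u := \det B.
have ua : eval_at u a != 0.
  have -> : eval_at u a = \det (map_mx (fun q => eval_at q a) B).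
    by rewrite -[LHS]/(meval _ u) -det_map_mx.
  rewrite hB; have := hdet.
  have haff : affine_vec i (affine_coord i P) = (a ord0 i)^-1 *: a.
    by rewrite affine_vec_coord // ai invr1 scale1r.
  by rewrite (hess_chart F4 haff) ai invr1 expr1n scale1r.
have hu : u \is 6.-homog by rewrite (_ : 6 = 3 * 2)%N //; apply: det_homog => j k; rewrite mxE.
exists u.
  by split=> //; rewrite Pa (eval_at_scale _ _ hu) mulf_neq0 ?expf_neq0.
have ul k : in_jac (u * l (lift i k)).
  exists (fun j => if unlift i j is Some j' then (\adj B) k j' else 0).
  rewrite (bigD1_ord i) //= unlift_none mul0r add0r.
  under eq_bigr => j _ do rewrite liftK AE mulr_sumr.
  rewrite exchange_big /= (bigD1 k) //= [X in _ + X]big1 ?addr0 => [|k' k'k].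
    under eq_bigr => j _ do rewrite mulrA.
    rewrite -mulr_suml; congr (_ * _).
    transitivity ((\adj B *m B) k k); first by rewrite mul_adj_mx [RHS]mxE eqxx mulr1n.
    by rewrite [LHS]mxE; apply: eq_bigr => j _; rewrite [B _ _]mxE.
  under eq_bigr => j _ do rewrite mulrA.
  rewrite -mulr_suml (_ : \sum_j _ = 0) ?mul0r //.
  transitivity ((\adj B *m B) k k').
    by rewrite [RHS]mxE; apply: eq_bigr => j _; rewrite [B _ _]mxE.
  by rewrite mul_adj_mx mxE eq_sym (negPf k'k) mulr0n.
move=> [|d] q hq; rewrite Pa (eval_at_scale _ _ hq) => /eqP.
  rewrite expr0 mul1r => /eqP qa.
  have -> : q = 0; last by exists (fun=> 0); rewrite mulr0 big1 // => j _; rewrite mul0r.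
  by have := homog0 hq; move: qa; set c := q@_0%MM => + qc; rewrite qc /eval_at mevalC => ->.
rewrite mulf_eq0 expf_eq0 (negPf Pi) andbF /= => /eqP qa.
have [b _ ->] := point_ideal ai hq qa.
rewrite mulr_sumr; apply: in_jac_sum => k; rewrite mulrCA; apply: in_jacM.
case: (unliftP i k) => [k' ->|->]; first exact: ul.
rewrite [X in _ * X](_ : _ = 0) ?mulr0; last by rewrite -/(l i) li.
by exists (fun=> 0); rewrite big1 // => j _; rewrite mul0r.
Qed.

Lemma nonprop_minor n (v w : 'rV[K]_n) : v != 0 -> (forall c, w <> c *: v) ->
  exists a b, v 0 a * w 0 b != v 0 b * w 0 a.
Proof.
move=> /rV0Pn [a va] h; apply: contrapT => nE; apply: (h (w 0 a / v 0 a)).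
apply/rowP => b; rewrite mxE; apply: (mulfI va).
rewrite mulrA [v 0 a * (_ / _)]mulrC mulfVK // [RHS]mulrC; apply: contrapT => /eqP E.
by apply: nE; exists a, b.
Qed.

Lemma separating_linear (P Q : projspace K 3) : P <> Q ->
  exists2 l : {mpoly K[4]}, l \is 1.-homog &
    eval_at l (hcoord P) = 0 /\ eval_at l (hcoord Q) != 0.
Proof.
move=> PQ; have [c /projspace_eq h|a [b ab]] := nonprop_minor (w := hcoord Q) (hcoord_neq0 P).
  by apply: PQ.
exists (hcoord P 0 a *: 'X_b - hcoord P 0 b *: 'X_a).
  by rewrite rpredB ?rpredZ // dhomog_X.
rewrite /eval_at !mevalB !mevalZ !mevalXU; split; last by rewrite subr_eq0.
by rewrite mulrC subrr.
Qed.

(** The partials and the local forms [u i] have no common zero, so they generate all forms of large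
    degree. At [P i] the partials and the other [u j] vanish; a form vanishing there thus has a
    coefficient of [u i] that vanishes there too, and [node_local] puts its product with [u i] into
    the Jacobian ideal. *)
Theorem jacobian_saturated m (P : 'I_m -> projspace K 3) : nodal F -> injective P ->
  (forall Q, singular_locus F Q <-> exists i, Q = P i) ->
  exists D, forall d q, (D <= d)%N -> q \is d.-homog ->
    (forall i, eval_at q (hcoord (P i)) = 0) -> gen_ideal G d q.
Proof.
move=> Fnod Pinj Psing.
have Ps i : singular_locus F (P i) by apply/Psing; exists i.
have Gs i j : eval_at (G j) (hcoord (P i)) = 0 by have /(singular_locusP F4) := Ps i.
pose loc i := cid2 (node_local (Ps i) (Fnod _ (Ps i))).
pose u i := sval (loc i).
have u6 i : u i \is 6.-homog by rewrite /u; case: (loc i) => /= x [].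
have ui i : eval_at (u i) (hcoord (P i)) != 0 by rewrite /u; case: (loc i) => /= x [].
have uq i d q : q \is d.-homog -> eval_at q (hcoord (P i)) = 0 -> in_jac (u i * q).
  by rewrite /u; case: (loc i) => /= x _ h; apply: h.
clearbody u; clear loc.
(* For a linear form through [P i] but not through [P j], its product with [u i] lies in the
   Jacobian ideal and so vanishes at [P j]. *)
have uij i j : i != j -> eval_at (u i) (hcoord (P j)) = 0.
  move=> ij; have [|l hl [lPi lPj]] := @separating_linear (P i) (P j).
    by move=> /Pinj /eqP; rewrite (negPf ij).
  have /eqP := eval_in_jac (uq i _ _ hl lPi) (Gs j).
  by rewrite /eval_at mevalM mulf_eq0 [X in _ || X](negPf lPj) orbF => /eqP.
pose g (k : 'I_(4 + m)) := match fintype.split k with inl j => G j | inr i => u i end.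
pose e (k : 'I_(4 + m)) := match fintype.split k with inl _ => 3%N | inr _ => 6%N end.
have hg k : g k \is (e k).-homog.
  by rewrite /g /e; case: fintype.split => i //; exact: jac_homog.
have [v v0|D hD] := gen_ideal_full hg.
  have [h|[j Gj]] : (forall j, eval_at (G j) v = 0) \/ exists j, eval_at (G j) v != 0.
  - have [h|h] := pselect (forall j, eval_at (G j) v = 0); first by left.
    by right; apply: contrapT => h'; apply: h => j; apply/eqP; apply: contra_notT h' => ?; exists j.
  - have [c c0 cv] := hcoord_line_of v0.
    have [|i Pi] := (Psing (line_of v0)).1.
      apply/(singular_locusP F4) => j; rewrite cv (eval_at_scale _ _ (jac_homog j)).
      by rewrite [X in _ * X]h mulr0.
    exists (rshift 4 i); rewrite /g (unsplitK (inr i)).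
    have := ui i; rewrite -Pi cv (eval_at_scale _ _ (u6 i)).
    by rewrite mulf_eq0 negb_or => /andP[].
  - by exists (lshift m j); rewrite /g (unsplitK (inl j)).
(* The bound 6 is the largest degree of a generator; it allows homogeneous coefficients. *)
exists (maxn 6 D) => d q; rewrite geq_max => /andP[d6 dD] hq qP.
have ed k : (e k <= d)%N by apply: leq_trans d6; rewrite /e; case: fintype.split.
have [a ha qE] := gen_ideal_homog hg ed (hD d q dD hq).
have qE2 : q = \sum_j a (lshift m j) * G j + \sum_i a (rshift 4 i) * u i.
  rewrite [LHS]qE big_split_ord /=; congr (_ + _); apply: eq_bigr => i _.
    by rewrite /g (unsplitK (inl i)).
  by rewrite /g (unsplitK (inr i)).
have aP i : eval_at (a (rshift 4 i)) (hcoord (P i)) = 0.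
  have := qP i; rewrite qE2 /eval_at mevalD !raddf_sum /= big1 => [|j _]; last first.
    by rewrite mevalM [X in _ * X]Gs mulr0.
  rewrite add0r (bigD1 i) //= big1 ?addr0 => [|j ji]; last first.
    by rewrite mevalM [X in _ * X]uij ?mulr0.
  by rewrite mevalM => /eqP; rewrite mulf_eq0 [X in _ || X](negPf (ui i)) orbF => /eqP.
have [c qc] : in_jac q.
  rewrite qE2.
  have [b ->] : in_jac (\sum_i a (rshift 4 i) * u i).
    apply: in_jac_sum => i; rewrite mulrC; apply: uq (ha _) (aP i).
  exists (fun j => a (lshift m j) + b j); rewrite -big_split; apply: eq_bigr => j _ /=.
  by rewrite mulrDl.
apply: (gen_ideal_of_sum (e := fun=> 3%N) jac_homog _ hq qc) => j.
exact: leq_trans d6.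
Qed.

End Jacobian.
End JacobianIdeal.

(** * Semicontinuity of codimension, expressed by a determinant in the parameters *)

Module DeterminantalForms.
Import mpoly QuarticForms InfinitesimalSymmetry NodeConditions NodalQuartics NodeIndependence.
Import ProjectiveNullstellensatz JacobianIdeal.

Section PolynomialFamilies.
Variables (K : numClosedFieldType) (N n : nat).
Notation S := {mpoly K[n.+1]}.

Definition form_family (e : nat) (Q : 'rV[K]_N -> S) := forall m, is_form e (fun h => (Q h)@_m).

Lemma form_family_const q : form_family 0 (fun=> q).
Proof. by move=> m; apply: is_formC. Qed.

Lemma form_family0 e : form_family e (fun=> 0).
Proof. by move=> m; apply: is_form_ext (is_form0 e) => h; rewrite mcoeff0. Qed.

Lemma form_familyD e P Q : form_family e P -> form_family e Q ->
  form_family e (fun h => P h + Q h).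
Proof. by move=> hP hQ m; apply: is_form_ext (is_formD (hP m) (hQ m)) => h; rewrite mcoeffD. Qed.

Lemma form_familyM d e P Q : form_family d P -> form_family e Q ->
  form_family (d + e) (fun h => P h * Q h).
Proof.
move=> hP hQ m; apply: (is_form_ext (fun h => esym (mcoeffM (P h) (Q h) m))).
by apply: is_form_sum => k _; apply: is_formM.
Qed.

Lemma form_family_ext e P Q : P =1 Q -> form_family e P -> form_family e Q.
Proof. by move=> PQ hP m; apply: is_form_ext (hP m) => h; rewrite PQ. Qed.

Lemma form_family_sum e (I : Type) (r : seq I) (f : I -> 'rV[K]_N -> S) :
  (forall i, form_family e (f i)) -> form_family e (fun h => \sum_(i <- r) f i h).
Proof.
move=> hf; elim: r => [|i r IH].
  by apply: form_family_ext (form_family0 e) => h; rewrite big_nil.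
by apply: form_family_ext (form_familyD (hf i) IH) => h; rewrite big_cons.
Qed.

Lemma form_family_prod e (I : Type) (r : seq I) (f : I -> 'rV[K]_N -> S) :
  (forall i, form_family e (f i)) -> form_family (size r * e) (fun h => \prod_(i <- r) f i h).
Proof.
move=> hf; elim: r => [|i r IH].
  by apply: form_family_ext (form_family_const 1) => h; rewrite big_nil.
by apply: form_family_ext (form_familyM (hf i) IH) => h; rewrite big_cons.
Qed.

Lemma form_family_deriv e Q k : form_family e Q -> form_family e (fun h => (Q h)^`M(k)).
Proof.
move=> hQ m; apply: is_form_ext (is_formZ (m k).+1%:R (hQ (m + U_(k))%MM)) => h.
by rewrite mcoeff_deriv mulr_natl.
Qed.

Lemma form_family_linear (q : 'I_N -> S) :
  form_family 1 (fun h : 'rV[K]_N => \sum_j h ord0 j *: q j).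
Proof.
apply: form_family_sum => j m.
apply: is_form_ext (is_formZ (q j)@_m (is_formX j)) => h.
by rewrite mcoeffZ mulrC.
Qed.

Lemma form_family_det s e (A : 'rV[K]_N -> 'M[S]_s) :
  (forall i j, form_family e (fun h => A h i j)) ->
  form_family (s * e) (fun h => \det (A h)).
Proof.
move=> hA; apply: form_family_sum => sg.
have := form_familyM (form_family_const ((-1) ^+ perm.odd_perm sg))
  (form_family_prod (index_enum _) (fun i => hA i (perm.fun_of_perm.body sg i))).
by rewrite -[index_enum _]enumT -cardE card_ord add0n.
Qed.

Notation Sd d := (dhomog n.+1 K d).

Lemma indhomogE d (q : S) : q \is d.-homog -> mpoly_of_dhomog (indhomog d q) = q.
Proof. by move=> hq; rewrite /indhomog insubdK. Qed.

Lemma indhomog_id d (v : Sd d) : indhomog d v = v.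
Proof. by apply: val_inj; apply: indhomogE; apply: dhomog_is_dhomog. Qed.

(** A linear functional of a form is a fixed linear combination of its coefficients. *)
Lemma form_family_functional d e (Q : 'rV[K]_N -> S) (f : {linear Sd d -> K^o}) :
  (forall h, Q h \is d.-homog) -> form_family e Q ->
  is_form e (fun h => f (indhomog d (Q h))).
Proof.
move=> hQ fQ.
have E h : f (indhomog d (Q h)) = \sum_(m : 'X_{1..n.+1 < d.+1} | mdeg m == d)
    f (indhomog d 'X_[m]) * (Q h)@_m.
  have -> : indhomog d (Q h) = \sum_(m : 'X_{1..n.+1 < d.+1} | mdeg m == d)
     (Q h)@_m *: indhomog d 'X_[m] :> Sd d.
    apply: val_inj => /=; rewrite -[LHS]/(mpoly_of_dhomog _) -[RHS]/(mpoly_of_dhomog _).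
    rewrite indhomogE // raddf_sum /=.
    rewrite (eq_bigr (fun m : 'X_{1..n.+1 < d.+1} => (Q h)@_m *: 'X_[m])); last first.
      by move=> m /eqP md; congr (_ *: _); apply: indhomogE; rewrite dhomogX; apply/eqP.
    apply/mpolyP => m; rewrite raddf_sum /=.
    have [md|md] := eqVneq (mdeg m) d.
      have mb : (mdeg m < d.+1)%N by rewrite md.
      rewrite (bigD1 (BMultinom mb)) /=; last by rewrite md.
      rewrite mcoeffZ mcoeffX eqxx mulr1 big1 ?addr0 // => m' /andP[_ m'm].
      rewrite mcoeffZ mcoeffX; case: eqP => [mm|]; last by rewrite mulr0.
      by case/eqP: m'm; apply: val_inj.
    rewrite (dhomog_nemf_coeff (hQ h) md) big1 // => m' /eqP m'd.
    rewrite mcoeffZ mcoeffX; case: eqP => [mm|]; last by rewrite mulr0.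
    by case/eqP: md; rewrite -mm.
  rewrite linear_sum; apply: eq_bigr => m _; rewrite linearZ /= [RHS]mulrC; by [].
apply: (is_form_ext (fun h => esym (E h))).
by apply: is_form_sum => m _; apply: is_formZ.
Qed.

End PolynomialFamilies.

(** A free family in [X] of maximal length spans [X]. *)
Lemma basis_in_pred (K : fieldType) (V : vectType K) (U : {vspace V}) (X : V -> Prop) :
  (forall v, X v -> v \in U) ->
  (forall W : {vspace V}, (forall v, X v -> v \in W) -> (U <= W)%VS) ->
  exists b, basis_of U b /\ forall v, v \in b -> X v.
Proof.
move=> XU Umin.
pose ok k := `[< exists s, [/\ size s = k, free s & forall v, v \in s -> X v] >].
have ok0 : exists k, ok k.
  by exists 0%N; apply/asboolP; exists [::]; rewrite nil_free.
have okle k : ok k -> (k <= \dim U)%N.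
  move=> /asboolP [s [<- fs sX]]; move: fs; rewrite /free => /eqP <-.
  by apply: dimvS; apply/span_subvP => v /sX /XU.
case: (ex_maxnP ok0 okle) => k /asboolP [s [sk fs sX]] kmax.
exists s; split=> //; rewrite /basis_of fs andbT eqEsubv; apply/andP; split.
  by apply/span_subvP => v /sX /XU.
apply: Umin => v Xv; apply: contrapT => /negP vs.
have : ok k.+1.
  apply/asboolP; exists (v :: s); rewrite /= sk free_cons vs fs; split=> // w.
  by rewrite inE => /orP[/eqP ->|/sX].
by move=> /kmax; rewrite ltnn.
Qed.

Section DeterminantForm.
Variables (K : numClosedFieldType) (N n : nat).
Notation S := {mpoly K[n.+1]}.
Notation Sd d := (dhomog n.+1 K d).

(* P is the determinant, in coordinates of the space of forms of degree D, of a
   basis at h0 formed by multiples of the g l and by m' <= m fixed forms. *)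
Lemma separating_form r (g : 'I_r -> 'rV[K]_N -> S) (de e : 'I_r -> nat) D h0 m :
  (forall l, form_family (de l) (g l)) -> (forall l h, g l h \is (e l).-homog) ->
  (forall l, (e l <= D)%N) ->
  (forall U : {vspace Sd D}, (forall l p, p \is (D - e l).-homog ->
     indhomog D (p * g l h0) \in U) -> (\dim {: Sd D} - \dim U <= m)%N) ->
  exists d (P : {mpoly K[N]}), [/\ P \is d.-homog, eval_at P h0 != 0 &
    forall h (v : 'I_m.+1 -> 'rV[K]_n.+1),
      (forall c, (forall q, q \is D.-homog -> \sum_i c i * eval_at q (v i) = 0) ->
         forall i, c i = 0) ->
      (forall l i, eval_at (g l h) (v i) = 0) -> eval_at P h = 0].
Proof.
move=> fg hg eD cod.
have hgD l p h : p \is (D - e l).-homog -> p * g l h \is D.-homog.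
  by move=> hp; have := dhomogM hp (hg l h); rewrite subnK.
pose X (w : Sd D) := exists l p, p \is (D - e l).-homog /\ w = indhomog D (p * g l h0).
have [U UE] : exists U : {vspace Sd D}, forall w, w \in U <->
    forall W : {vspace Sd D}, (forall v, X v -> v \in W) -> w \in W.
  apply: vspace_of_pred; first by move=> W _; apply: mem0v.
  by move=> c u v hu hv W XW; rewrite memvD ?memvZ ?hu ?hv.
have XU w : X w -> w \in U by move=> Xw; apply/UE => W; apply.
have Umin (W : {vspace Sd D}) : (forall v, X v -> v \in W) -> (U <= W)%VS.
  by move=> XW; apply/subvP => w /UE; apply.
have [b [bU bX]] := basis_in_pred XU Umin.
pose B := b ++ vbasis (U^C)%VS.
have Bbasis : basis_of fullv B.
  rewrite -(addv_complf U); apply: cat_basis => //; last exact: vbasisP.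
  by apply/directv_addP; apply: capv_compl.
have sB : size B = (size b + \dim (U^C))%N by rewrite size_cat size_tuple.
have cb : (\dim (U^C) <= m)%N.
  rewrite dimv_compl; apply: cod => l p hp; apply: XU; by exists l, p.
pose T := in_tuple B.
(* Basis vectors that are multiples of some [g l h0] move with [h]; those from the complement stay
   fixed. *)
have hR (s : 'I_(size B)) : exists R : nat * ('rV[K]_N -> S),
    [/\ form_family R.1 R.2, forall h, R.2 h \is D.-homog, indhomog D (R.2 h0) = T`_s &
     (s < size b)%N -> exists l p, forall h, R.2 h = p * g l h].
  have [sb|sb] := ltnP s (size b).
    have : T`_s \in b by rewrite nth_cat sb mem_nth.
    move=> /bX [l [p [hp E]]]; exists ((0 + de l)%N, fun h => p * g l h); split=> //=.
    - exact: form_familyM (form_family_const _ p) (fg l).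
    - by move=> h; apply: hgD.
    - by move=> _; exists l, p.
  exists (0%N, fun=> mpoly_of_dhomog T`_s); split=> //=.
  - exact: form_family_const.
  - by move=> h; apply: dhomog_is_dhomog.
  - exact: indhomog_id.
pose R s := sval (cid (hR s)).
have R1 s : form_family (R s).1 (R s).2 by rewrite /R; case: (cid _) => /= x [].
have R2 s h : (R s).2 h \is D.-homog by rewrite /R; case: (cid _) => /= x [].
have R3 s : indhomog D ((R s).2 h0) = T`_s by rewrite /R; case: (cid _) => /= x [].
have R4 (s : 'I_(size B)) : (s < size b)%N -> exists l p, forall h, (R s).2 h = p * g l h.
  by rewrite /R; case: (cid _) => /= x [].
clearbody R; clear hR.
have Tbasis : basis_of fullv T by exact: Bbasis.
have Tfree := basis_free Tbasis.
pose A h : 'M[K]_(size B) := \matrix_(s, t) coord T t (indhomog D ((R s).2 h)).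
have [P hP AP] : is_form (\sum_s (R s).1) (fun h => \det (A h)).
  apply: is_form_sum => sg _; apply: is_formZ.
  apply: (@is_form_ext _ _ _ (fun h => \prod_(s <- index_enum _)
     coord T (perm.fun_of_perm.body sg s) (indhomog D ((R s).2 h)))).
    by move=> h; apply: eq_bigr => s _; rewrite mxE.
  elim: (index_enum _) => [|s r' IH].
    rewrite big_nil; apply: is_form_ext (is_formC 1) => h; by rewrite big_nil.
  rewrite big_cons; apply: is_form_ext (is_formM _ IH) => [h|]; first by rewrite big_cons.
  exact: (@form_family_functional _ _ _ _ _ _ (coord T (perm.fun_of_perm.body sg s))).
exists (\sum_s (R s).1)%N, P; split=> //.
  rewrite -AP; have -> : A h0 = 1%:M; last by rewrite det1 oner_neq0.
  by apply/matrixP => s t; rewrite !mxE R3 coord_free // eq_sym.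
move=> h v vind gv; rewrite -AP.
(* Evaluations of the fixed forms at the points. There are m + 1 points and at most m fixed forms,
   so some nonzero combination [c] of the evaluations kills all fixed forms. The index [size b + s]
   is always in range, and the default 0 does not occur. *)
pose E : 'M[K]_(m.+1, \dim (U^C)) := \matrix_(i, s)
  (if insub (size b + s)%N is Some s' then eval_at ((R s').2 h) (v i) else 0).
have [c c0 cE] : exists2 c : 'rV[K]_m.+1, c != 0 & c *m E = 0.
  have : kermx E != 0.
    rewrite -mxrank_eq0 mxrank_ker subn_eq0 -ltnNge ltnS.
    exact: leq_trans (rank_leq_col _) cb.
  by move=> /rowV0Pn [c /sub_kermxP cE c0]; exists c.
(* The functional given by [c], in the basis [T]. It is nonzero because the evaluations are
   independent. The matrix [A h] kills it: moving rows vanish at the points, fixed rows by the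
   choice of [c]. *)
pose z : 'cV[K]_(size B) := \col_t \sum_i c 0 i * eval_at (mpoly_of_dhomog T`_t) (v i).
have evT q y : q \is D.-homog ->
    eval_at q y = \sum_t coord T t (indhomog D q) * eval_at (mpoly_of_dhomog T`_t) y.
  move=> hq; have wE := coord_basis Tbasis (memvf (indhomog D q)).
  have := congr1 (fun w : Sd D => eval_at (mpoly_of_dhomog w) y) wE.
  rewrite indhomogE // => ->; rewrite /eval_at !raddf_sum /=; apply: eq_bigr => t _.
  by rewrite -mevalZ; congr (meval _ _); rewrite linearZ.
have z0 : z != 0.
  apply: contraNneq c0 => z0; apply/eqP/rowP => i; rewrite mxE.
  apply: (vind (fun i => c 0 i)) => q hq.
  under eq_bigr => j _ do rewrite (evT q _ hq) mulr_sumr.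
  rewrite exchange_big big1 // => t _.
  under eq_bigr => j _ do rewrite mulrCA.
  rewrite -mulr_sumr; have := congr1 (fun M : 'cV_(size B) => M t 0) z0.
  by rewrite !mxE => ->; rewrite mulr0.
have Az : A h *m z = 0.
  apply/matrixP => s j; rewrite ord1 [RHS]mxE mxE.
  transitivity (\sum_i c 0 i * eval_at ((R s).2 h) (v i)).
    under [RHS]eq_bigr => i _ do rewrite (evT _ _ (R2 s h)) mulr_sumr.
    rewrite exchange_big; apply: eq_bigr => t _; rewrite !mxE mulr_sumr.
    by apply: eq_bigr => i _; rewrite mulrCA.
  have [sb|sb] := ltnP s (size b).
    have [l [p pE]] := R4 s sb; rewrite big1 // => i _.
    by rewrite pE /eval_at mevalM [X in _ * (_ * X)]gv !mulr0.
  have sc : (s - size b < \dim (U^C))%N.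
    by rewrite ltn_subLR // -sB; apply: ltn_ord.
  transitivity ((c *m E) 0 (Ordinal sc)); last by rewrite cE mxE.
  rewrite [RHS]mxE; apply: eq_bigr => i _; congr (_ * _); rewrite [RHS]mxE.
  have ss : (size b + Ordinal sc = s)%N by rewrite /= subnKC.
  by rewrite ss valK.
rewrite -det_tr; apply/eqP/det0P; exists z^T.
  by rewrite -(inj_eq (@trmx_inj _ _ _)) trmxK trmx0.
by rewrite -trmx_mul Az trmx0.
Qed.

End DeterminantForm.
End DeterminantalForms.

(** * The strata of nodal quartics are Zariski locally closed *)

Module ZariskiNodal.
Import mpoly QuarticForms InfinitesimalSymmetry NodeConditions NodalQuartics NodeIndependence.
Import ProjectiveNullstellensatz JacobianIdeal DeterminantalForms.
Local Open Scope classical_set_scope.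
Local Open Scope ring_scope.

Lemma zariski_closedP (K : fieldType) n (Z : set (projspace K n)) :
  (forall p, ~ Z p -> exists d (F : {mpoly K[n.+1]}), [/\ F \is d.-homog,
     eval_at F (hcoord p) != 0 & forall q, Z q -> eval_at F (hcoord q) = 0]) ->
  zariski_closed Z.
Proof.
move=> h; exists [set F | (exists d : nat, F \is d.-homog) /\
  forall q, Z q -> eval_at F (hcoord q) = 0]; split; first by move=> F [].
apply/seteqP; split=> p /=; first by move=> Zp F [_]; apply.
move=> hp; apply: contrapT => /h [d [F [Fd Fp FZ]]].
by case/eqP: Fp; apply: hp; split=> //; exists d.
Qed.

Lemma card_ordP T (A : set T) m :
  (A #= `I_m)%card <-> exists2 f : 'I_m -> T, injective f & forall x, A x <-> exists i, x = f i.
Proof.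
split.
  move=> /card_set_bijP [g [gfun ginj gsurj]].
  have hs (i : 'I_m) : exists x, A x /\ g x = i.
    by have [x Ax gx] := gsurj i (ltn_ord i); exists x.
  pose f i := sval (cid (hs i)).
  have fE i : A (f i) /\ g (f i) = i by apply: (svalP (cid (hs i))).
  exists f => [i j fij|x].
    by apply: val_inj; rewrite -[LHS](fE i).2 -[RHS](fE j).2 fij.
  split=> [Ax|[i ->]]; last exact: (fE i).1.
  have gx : (g x < m)%N by apply: gfun.
  exists (Ordinal gx); apply: ginj; rewrite ?inE //; first exact: (fE _).1.
  by rewrite (fE _).2.
move=> [f finj Af]; apply/card_set_bijP.
pose g x := if pselect (exists i, x = f i) is left h then val (sval (cid h)) else 0%N.
have gE i : g (f i) = i.
  rewrite /g; case: pselect => [h|[]]; last by exists i.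
  by case: (cid h) => j /= /finj ->.
exists g; split.
- by move=> x /Af [i ->]; rewrite gE; apply: ltn_ord.
- by move=> x y; rewrite !inE => /Af [i ->] /Af [j ->]; rewrite !gE => /val_inj ->.
- by move=> k km; exists (f (Ordinal km)); [apply/Af; exists (Ordinal km)|rewrite gE].
Qed.

Section Closed.
Variable K : numClosedFieldType.

(** A product of linear forms, one through each of the other m points, isolates the point [P i];
    this uses degree m, and a power of a form nonzero at [P i] fills up the rest. *)
Lemma eval_independent m (P : 'I_m.+1 -> projspace K 3) D : injective P -> (m <= D)%N ->
  forall c : 'I_m.+1 -> K, (forall q : {mpoly K[4]}, q \is D.-homog ->
    \sum_i c i * eval_at q (hcoord (P i)) = 0) -> forall i, c i = 0.
Proof.
move=> Pinj mD c hc i.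
have hl j : exists l : {mpoly K[4]}, l \is 1.-homog /\
    eval_at l (hcoord (P i)) != 0 /\ (j != i -> eval_at l (hcoord (P j)) = 0).
  have [->|ji] := eqVneq j i.
    have [k Pk] := exists_hcoord (P i); exists 'X_k; split; first exact: dhomog_X.
    by rewrite /eval_at mevalXU.
  have [|l l1 [lj li]] := @separating_linear K (P j) (P i).
    by move=> /Pinj /eqP; rewrite (negPf ji).
  by exists l.
pose l j := sval (cid (hl j)).
have l1 j : l j \is 1.-homog by rewrite /l; case: (cid _) => /= x [].
have li j : eval_at (l j) (hcoord (P i)) != 0 by rewrite /l; case: (cid _) => /= x [_ []].
have lj j : j != i -> eval_at (l j) (hcoord (P j)) = 0.
  by rewrite /l; case: (cid _) => /= x [_ []].
clearbody l; clear hl.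
pose q := \prod_(j | j != i) l j * l i ^+ (D - m).
have qD : q \is D.-homog.
  have -> : D = (m + 1 * (D - m))%N by rewrite mul1n subnKC.
  apply: dhomogM; last exact: dhomogMn.
  have : \prod_(j | j != i) l j \is (\sum_(j : 'I_m.+1 | j != i) 1)%N.-homog.
    elim/big_rec2: _ => [|j a b _ hab]; first exact: dhomog1.
    exact: dhomogM.
  by rewrite sum1_card cardC1 card_ord.
have := hc q qD; rewrite (bigD1 i) //= big1 ?addr0 => [|j ji].
  move=> /eqP; rewrite mulf_eq0 => /orP[/eqP //|].
  rewrite /eval_at /q mevalM rmorph_prod rmorphXn /= mulf_eq0 expf_eq0.
  rewrite [meval _ (l i) == 0](negPf (li i)) andbF orbF => /prodf_eq0 [j ji].
  by rewrite [_ == 0](negPf (li j)).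
by rewrite /q (bigD1 j) //= /eval_at !mevalM [meval _ (l j)]lj // !mul0r mulr0.
Qed.

(** Having at least [k] singular points is not closed, since nodes may merge into a worse
    singularity. The union with the non-nodal quartics is closed. *)
Definition bad_or_many k : set (projspace K 34) :=
  [set H | ~ nodal (quartic_of H) \/ exists2 P : 'I_k -> projspace K 3,
     injective P & forall i, singular_locus (quartic_of H) (P i)].

Lemma quartic_partial_family k : form_family 1 (fun h : 'rV[K]_35 => (quartic_form h)^`M(k)).
Proof. by apply: form_family_deriv; apply: form_family_linear. Qed.

Definition principal_minor (h : 'rV[K]_35) (i : 'I_4) : {mpoly K[4]} :=
  \det (\matrix_(a < 3, b < 3) (quartic_form h)^`M(lift i a)^`M(lift i b)).

Lemma principal_minor_family i : form_family 3 (fun h => principal_minor h i).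
Proof.
have := @form_family_det K 35 3 3 1 (fun h =>
  \matrix_(a < 3, b < 3) (quartic_form h)^`M(lift i a)^`M(lift i b)).
apply=> a b; apply: form_family_ext (form_family_deriv (lift i b)
  (quartic_partial_family (lift i a))) => h.
by rewrite mxE.
Qed.

Lemma principal_minor_homog h i : principal_minor h i \is 6.-homog.
Proof.
rewrite (_ : 6 = 3 * 2)%N //; apply: det_homog => a b; rewrite mxE.
exact/mderiv_homog/mderiv_homog/quartic_form_homog.
Qed.

Lemma eval_principal_minor h i v (A := \matrix_(a, b) eval_at (quartic_form h)^`M(a)^`M(b) v) :
  eval_at (principal_minor h i) v = \det (\matrix_(a < 3, b < 3) A (lift i a) (lift i b)).
Proof.
rewrite -[LHS]/(meval _ (principal_minor h i)) -det_map_mx; congr (\det _).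
by apply/matrixP => a b; rewrite !mxE.
Qed.

(** For an index [i] with [v 0 i = 0] the principal minor vanishes, as the remaining coordinates of
    [v] give a kernel vector. So a nonzero minor occurs where [minor_kernel] applies. *)
Lemma bad_minors h v : v != 0 -> (forall j, eval_at (quartic_form h)^`M(j) v = 0) ->
  (exists i, eval_at (principal_minor h i) v != 0) <->
  nondeg_kernel (quartic_tensor (quartic_form h)) v.
Proof.
move=> v0 hv; have F4 := quartic_form_homog h.
set A : 'M[K]_4 := \matrix_(a, b) eval_at (quartic_form h)^`M(a)^`M(b) v.
have AT : A^T = A by apply/matrixP => a b; rewrite !mxE mderiv_comm.
have vA : v *m A = 0 by apply: singular_kernel.
rewrite (kernel_tensor F4) -/A; split=> [h'|ker].
  have [i hi] := h'; move: hi.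
  have [vi|vi] := eqVneq (v 0 i) 0; last first.
    by rewrite eval_principal_minor => /(minor_kernel AT vA vi).
  rewrite eval_principal_minor => /negP []; apply/det0P.
  exists (\row_a v 0 (lift i a)).
    apply: contraNneq v0 => v'0; apply/eqP/rowP => a; rewrite [RHS]mxE.
    case: (unliftP i a) => [b ->|->] //.
    by have := congr1 (fun z : 'rV_3 => z 0 b) v'0; rewrite !mxE.
  apply/rowP => b; transitivity ((v *m A) 0 (lift i b)); last by rewrite vA !mxE.
  rewrite [RHS]mxE (bigD1_ord i) //= vi mul0r add0r mxE.
  by apply: eq_bigr => a _; rewrite !mxE.
have /rV0Pn [i vi] := v0; exists i; rewrite eval_principal_minor.
exact/(minor_kernel AT vA vi).
Qed.

Lemma nodal_tensor (F : {mpoly K[4]}) v : F \is 4.-homog -> nodal F -> v != 0 ->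
  (forall j, eval_at F^`M(j) v = 0) -> nondeg_kernel (quartic_tensor F) v.
Proof.
move=> F4 Fnod v0 hv; have [d d0 hq] := hcoord_line_of v0.
have Qs : singular_locus F (line_of v0).
  by apply/(singular_locusP F4) => j; rewrite hq (eval_at_scale _ _ (mderiv_homog j F4)) hv mulr0.
have /(is_nodeP F4 Qs) := Fnod _ Qs; rewrite hq => nd w wq.
have [|e ->] := nd w; last by exists (e * d); rewrite scalerA.
by move=> x; rewrite PhiZ1 PhiZ2 wq !mulr0.
Qed.

(** For a nodal quartic the partials and the principal minors of the Hessian have no common zero, so
    they generate everything in large degree. This is [separating_form] with codimension 0 and the
    single point [v]. *)
Lemma bad_form h0 : nodal (quartic_form h0) -> exists d (P : {mpoly K[35]}),
  [/\ P \is d.-homog, eval_at P h0 != 0 &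
    forall h v, v != 0 -> (forall j, eval_at (quartic_form h)^`M(j) v = 0) ->
     ~ nondeg_kernel (quartic_tensor (quartic_form h)) v -> eval_at P h = 0].
Proof.
move=> Fnod; have F4 := quartic_form_homog h0.
pose g (k : 'I_(4 + 4)) (h : 'rV[K]_35) := match fintype.split k with
  inl j => (quartic_form h)^`M(j) | inr i => principal_minor h i end.
pose e (k : 'I_(4 + 4)) := match fintype.split k with inl _ => 3%N | inr _ => 6%N end.
pose de (k : 'I_(4 + 4)) := match fintype.split k with inl _ => 1%N | inr _ => 3%N end.
have fg l : form_family (de l) (g l).
  rewrite /de /g; case: fintype.split => i; first exact: quartic_partial_family.
  exact: principal_minor_family.
have hg l h : g l h \is (e l).-homog.
  rewrite /e /g; case: fintype.split => i; last exact: principal_minor_homog.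
  exact/mderiv_homog/quartic_form_homog.
have [v v0|D hD] := gen_ideal_full (fun l => hg l h0).
  have [h|[j Gj]] : (forall j, eval_at (quartic_form h0)^`M(j) v = 0) \/
      exists j, eval_at (quartic_form h0)^`M(j) v != 0.
  - have [h|h] := pselect (forall j, eval_at (quartic_form h0)^`M(j) v = 0); first by left.
    by right; apply: contrapT => h'; apply: h => j; apply/eqP; apply: contra_notT h' => ?; exists j.
  - have [i hi] := (bad_minors v0 h).2 (nodal_tensor F4 Fnod v0 h).
    by exists (rshift 4 i); rewrite /g (unsplitK (inr i)).
  - by exists (lshift 4 j); rewrite /g (unsplitK (inl j)).
have eD l : (e l <= maxn 6 D)%N by apply: leq_trans (leq_maxl _ _); rewrite /e; case: fintype.split.
have [|d [P [hP P0 PZ]]] := @separating_form K 35 3 _ g de e (maxn 6 D) h0 0 fg hg eD.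
  move=> U hU; rewrite leqn0 subn_eq0; apply/dimvS/subvP => w _.
  have [a ha wE] := gen_ideal_homog (fun l => hg l h0) eD
     (hD _ _ (leq_maxr _ _) (dhomog_is_dhomog w)).
  have -> : w = \sum_l indhomog (maxn 6 D) (a l * g l h0).
    apply: val_inj; rewrite /= -[LHS]/(mpoly_of_dhomog _) -[RHS]/(mpoly_of_dhomog _).
    rewrite raddf_sum wE; apply: eq_bigr => l _; rewrite /= indhomogE //.
    by have := dhomogM (ha l) (hg l h0); rewrite subnK.
  by apply: memv_suml => l _; apply: hU.
exists d, P; split=> // h v v0 hv bad; apply: (PZ h (fun=> v)).
  have /rV0Pn [k vk] := v0; move=> c /(_ ('X_k ^+ maxn 6 D)).
  have hX : ('X_k : {mpoly K[4]}) ^+ maxn 6 D \is (maxn 6 D).-homog.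
    by have := dhomogMn (maxn 6 D) (dhomog_X K k); rewrite mul1n.
  move=> /(_ hX); rewrite big_ord1 /eval_at rmorphXn /= mevalXU => /eqP.
  by rewrite mulf_eq0 expf_eq0 (negPf vk) andbF orbF => /eqP c0 i; rewrite ord1.
move=> l _; rewrite /g; case: fintype.split => i //.
by apply/eqP/negP => /negP hi; apply: bad; apply/(bad_minors v0 hv); exists i.
Qed.

(** In a large degree the multiples of the partials contain all forms vanishing at the m nodes,
    hence have codimension at most m, whereas m + 1 singular points would give m + 1 independent
    functionals killing them. *)
Lemma many_form h0 m (P : 'I_m -> projspace K 3) : nodal (quartic_form h0) -> injective P ->
  (forall Q, singular_locus (quartic_form h0) Q <-> exists i, Q = P i) ->
  exists d (G : {mpoly K[35]}), [/\ G \is d.-homog, eval_at G h0 != 0 &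
    forall h (Q : 'I_m.+1 -> projspace K 3), injective Q ->
      (forall i, singular_locus (quartic_form h) (Q i)) -> eval_at G h = 0].
Proof.
move=> Fnod Pinj Psing; have F4 := quartic_form_homog h0.
have [D0 hD0] := jacobian_saturated F4 Fnod Pinj Psing.
(* The bound 3 is the degree of the partials, [m] serves [eval_independent], and [D0] comes from
   saturation. *)
pose D := maxn (maxn 3 m) D0.
pose g (j : 'I_4) (h : 'rV[K]_35) := (quartic_form h)^`M(j).
have fg j : form_family 1 (g j) := quartic_partial_family j.
have hg j h : g j h \is 3.-homog by exact/mderiv_homog/quartic_form_homog.
have D3 : (3 <= D)%N by rewrite /D !leq_max leqnn.
have Dm : (m <= D)%N by rewrite /D !leq_max leqnn orbT.
have [|d [G [hG G0 GZ]]] := @separating_form K 35 3 _ g (fun=> 1%N) (fun=> 3%N) D h0 m fg hg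
    (fun=> D3).
  move=> U hU.
  pose ev (w : dhomog 4 K D) : 'rV[K]_m := \row_i eval_at (w : {mpoly K[4]}) (hcoord (P i)).
  have evlin : linear ev.
    by move=> c u w; apply/rowP => i; rewrite !mxE /eval_at linearP /= ?mevalD ?mevalZ.
  pose evL : {linear dhomog 4 K D -> 'rV[K]_m} := HB.pack ev (GRing.isLinear.Build _ _ _ _ ev evlin).
  have kerU : (lker (linfun evL) <= U)%VS.
    apply/subvP => w; rewrite memv_ker lfunE /= => /eqP ev0.
    have wP i : eval_at (w : {mpoly K[4]}) (hcoord (P i)) = 0.
      by have := congr1 (fun z : 'rV_m => z 0 i) ev0; rewrite !mxE.
    have [a ha wE] := gen_ideal_homog (hg^~ h0) (fun=> D3)
       (hD0 D _ (leq_maxr _ _) (dhomog_is_dhomog w) wP).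
    have -> : w = \sum_l indhomog D (a l * g l h0).
      apply: val_inj; rewrite /= -[LHS]/(mpoly_of_dhomog _) -[RHS]/(mpoly_of_dhomog _).
      rewrite raddf_sum wE; apply: eq_bigr => l _; rewrite /= indhomogE //.
      by have := dhomogM (ha l) (hg l h0); rewrite subnK.
    by apply: memv_suml => l _; apply: hU.
  rewrite leq_subLR; apply: leq_trans (leq_add (dimvS kerU) (leqnn m)).
  have := limg_ker_dim (linfun evL) fullv; rewrite capfv => <-.
  rewrite leq_add2l; apply: leq_trans (dimvS (subvf _)) _.
  by rewrite dimvf /dim /= mul1n.
exists d, G; split=> // h Q Qinj Qsing; apply: (GZ h (fun i => hcoord (Q i))).
  exact: eval_independent.
by move=> l i; have /(singular_locusP (quartic_form_homog h)) := Qsing i; apply.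
Qed.

(** A family of distinct singular points of maximal length exhausts the singular locus. *)
Lemma singular_enum H k : ~ bad_or_many k H -> nodal (quartic_of H) /\
  exists m (P : 'I_m -> projspace K 3), [/\ (m < k)%N, injective P &
    forall Q, singular_locus (quartic_of H) Q <-> exists i, Q = P i].
Proof.
move=> nb; have nod : nodal (quartic_of H) by apply: contrapT => h; apply: nb; left.
split=> //.
pose ok m := `[< exists2 P : 'I_m -> projspace K 3, injective P &
   forall i, singular_locus (quartic_of H) (P i) >].
have ok0 : exists m, ok m.
  exists 0%N; apply/asboolP; have f0 : 'I_0 -> projspace K 3 by case.
  by exists f0; case.
have okle m : ok m -> (m <= k)%N.
  move=> /asboolP [P Pinj Ps]; rewrite leqNgt; apply/negP => km; apply: nb; right.
  exists (fun i => P (widen_ord (ltnW km) i)) => [i j /Pinj /(congr1 val) /= ij|i]; last exact: Ps.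
  exact: val_inj.
case: (ex_maxnP ok0 okle) => m /asboolP [P Pinj Ps] mmax.
exists m, P; split=> //.
  have := okle m; rewrite leq_eqVlt => /(_ _) h.
  have /h /orP[/eqP mk|//] : ok m by apply/asboolP; exists P.
  by case: nb; right; rewrite -mk; exists P.
move=> Q; split=> [Qs|[i ->]]; last exact: Ps.
apply: contrapT => nQ.
have : ok m.+1.
  apply/asboolP; exists (fun i => if unlift ord_max i is Some j then P j else Q).
    move=> i j; case: (unliftP ord_max i) => [i' ->|->]; case: (unliftP ord_max j) => [j' ->|->] //.
    - by move=> /Pinj ->.
    - by move=> e; case: nQ; exists i'.
    - by move=> e; case: nQ; exists j'.
  by move=> i; case: unliftP => [j _|_].
by move=> /mmax; rewrite ltnn.
Qed.

Lemma bad_or_many_closed k : zariski_closed (bad_or_many k).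
Proof.
apply: zariski_closedP => H /singular_enum [nod [m [P [mk Pinj Psing]]]].
have [d [A [hA A0 AZ]]] := bad_form nod.
have [e [B [hB B0 BZ]]] := many_form nod Pinj Psing.
exists (d + e)%N, (A * B); split; first exact: dhomogM.
  by rewrite /eval_at mevalM mulf_neq0.
move=> H' [bad|[Q Qinj Qs]]; rewrite /eval_at mevalM.
  have [Q [Qs Qn]] : exists Q, singular_locus (quartic_of H') Q /\ ~ is_node (quartic_of H') Q.
    apply: contrapT => h; apply: bad => Q Qs; apply: contrapT => Qn; apply: h; by exists Q.
  have F4 := quartic_form_homog (hcoord H').
  rewrite [X in X * _](_ : _ = 0) ?mul0r //; apply: (AZ (hcoord H') (hcoord Q)).
  - exact: hcoord_neq0.
  - by have /(singular_locusP F4) := Qs.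
  - by move=> /(is_nodeP F4 Qs).
rewrite [X in _ * X](_ : _ = 0) ?mulr0 //.
apply: (BZ (hcoord H') (fun i => Q (widen_ord mk i))) => [i j /Qinj /(congr1 val) /= ij|i].
  exact: val_inj.
exact: Qs.
Qed.

Lemma dual_varietyP (H : projspace K 34) :
  dual_variety K H <-> exists P, singular_locus (quartic_of H) P.
Proof.
have F4 := quartic_form_homog (hcoord H).
have E k p : \sum_j hcoord H ord0 j * eval_at ((veronese K j)^`M(k)) p
    = eval_at (quartic_of H)^`M(k) p.
  rewrite /quartic_of !raddf_sum /= /eval_at !raddf_sum; apply: eq_bigr => j _ /=.
  by rewrite mderivZ mevalZ.
split=> [[P h]|[P /(singular_locusP F4) h]]; exists P.
  by apply/(singular_locusP F4) => j; rewrite -E.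
by move=> j; rewrite E h.
Qed.

Lemma nodal_quartics_diff delta : (0 < delta)%N ->
  nodal_quartics K delta = bad_or_many delta `\` bad_or_many delta.+1.
Proof.
move=> d0; apply/seteqP; split=> H.
  move=> [_ /card_ordP [f finj fE] nod]; split.
    by right; exists f => // i; apply/fE; exists i.
  move=> [//|[P Pinj Ps]].
  have hQ i : exists j, P i = f j by apply/fE.
  pose s i := sval (cid (hQ i)).
  have sE i : P i = f (s i) by apply: (svalP (cid (hQ i))).
  have sinj : injective s by move=> i j sij; apply: Pinj; rewrite !sE sij.
  by have := leq_card s sinj; rewrite !card_ord ltnn.
move=> [hb /singular_enum [nod [m [Q [md Qinj Qs]]]]].
have [//|[P Pinj Ps]] := hb.
have hP i : exists j, P i = Q j by apply/Qs.
pose s i := sval (cid (hP i)).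
have sE i : P i = Q (s i) by apply: (svalP (cid (hP i))).
have sinj : injective s by move=> i j sij; apply: Pinj; rewrite !sE sij.
have dm : (delta <= m)%N by have := leq_card s sinj; rewrite !card_ord.
have {}dm : m = delta by apply/eqP; rewrite eqn_leq dm andbT -ltnS.
subst m; split=> //; last by apply/card_ordP; exists Q.
by apply/dual_varietyP; exists (P (Ordinal d0)).
Qed.

Theorem nodal_quartics_locally_closed delta : (0 < delta)%N ->
  zariski_locally_closed (nodal_quartics K delta).
Proof.
move=> d0; exists (bad_or_many delta), (bad_or_many delta.+1).
by split; [exact: bad_or_many_closed|exact: bad_or_many_closed|exact: nodal_quartics_diff].
Qed.

End Closed.
End ZariskiNodal.

(** * A Kummer quartic with sixteen nodes *)

Module KummerQuartic.
Import mpoly QuarticForms InfinitesimalSymmetry NodalQuartics NodeIndependence.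

Section Scaling.
Variables (K : fieldType) (n : nat) (c : K) (c0 : c != 0).

Lemma singular_locus_scale (F : {mpoly K[n.+1]}) Q :
  singular_locus (c *: F) Q <-> singular_locus F Q.
Proof.
have E (p : {mpoly K[n.+1]}) x : eval_at (c *: p) x = c * eval_at p x by apply: mevalZ.
split=> -[h1 h2]; split.
- by move: h1; rewrite E => /eqP; rewrite mulf_eq0 (negPf c0) => /eqP.
- by move=> j; have /eqP := h2 j; rewrite mderivZ E mulf_eq0 (negPf c0) => /eqP.
- by rewrite E h1 mulr0.
- by move=> j; rewrite mderivZ E h2 mulr0.
Qed.

Lemma is_node_scale (F : {mpoly K[n.+1]}) Q : is_node F Q -> is_node (c *: F) Q.
Proof.
move=> [i [Qi [h1 h2 h3]]]; exists i; split; first exact: Qi.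
have E (p : {mpoly K[n]}) x : eval_at (c *: p) x = c * eval_at p x by apply: mevalZ.
have -> : dehomogenize i (c *: F) = c *: dehomogenize i F by apply: comp_mpolyZ.
split; first by rewrite E h1 mulr0.
  by move=> a; rewrite mderivZ E h2 mulr0.
have -> : hessian (c *: dehomogenize i F) (affine_coord i Q) =
    c *: hessian (dehomogenize i F) (affine_coord i Q).
  by apply/matrixP => a b; rewrite !mxE !mderivZ E.
by rewrite detZ mulf_neq0 ?expf_neq0.
Qed.

End Scaling.

Section Kummer.
Variable K : numClosedFieldType.
Implicit Types (x w : 'rV[K]_4) (Q : projspace K 3).

(** Chosen for its symmetry and because its partials factor. Up to scaling, the nodes have one
    coordinate 0 and the other three equal to 1 or -1. *)
Definition kummer : {mpoly K[4]} :=
  3 *: (\sum_i 'X_i ^+ 4) - (\sum_i 'X_i ^+ 2) ^+ 2.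

Definition sumsq x : K := \sum_i x ord0 i ^+ 2.

Lemma kummer_homog : kummer \is 4.-homog.
Proof.
have hX k (i : 'I_4) : 'X_i ^+ k \is (k.-homog : qualifier _ {mpoly K[4]}).
  by have := dhomogMn k (dhomog_X K i); rewrite mul1n.
apply: rpredB.
  by apply/rpredZ/rpred_sum => i _; apply: hX.
have hS : \sum_(i < 4) 'X_i ^+ 2 \is (2.-homog : qualifier _ {mpoly K[4]}).
  by apply: rpred_sum => i _; apply: hX.
exact: (dhomogMn 2 hS).
Qed.

Lemma mderivXn (i j : 'I_4) k :
  ('X_i ^+ k.+1)^`M(j) = ((i == j)%:R * k.+1%:R) *: 'X_i ^+ k :> {mpoly K[4]}.
Proof.
have X1 : ('X_i)^`M(j) = (i == j)%:R :> {mpoly K[4]}.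
  rewrite mderivX mnm1E; case: eqP => [->|_]; last by rewrite scale0r.
  rewrite scale1r (_ : (_ - _)%MM = 0%MM) ?mpolyX0 //.
  by apply/mnmP => l; rewrite mnmBE mnm0E subnn.
elim: k => [|k ih].
  by rewrite expr1 expr0 mulr1 X1 -mulr_natl mulr1 -scaler_nat.
rewrite exprS mderivM ih X1 -scalerAr -exprS.
case: (i == j); last by rewrite !mul0r !scale0r addr0.
by rewrite !mul1r -[k.+2%:R]natr1 scalerDl scale1r addrC.
Qed.

Lemma kummer_deriv j : kummer^`M(j) =
  4 *: ('X_j * (3 *: 'X_j ^+ 2 - \sum_i 'X_i ^+ 2)).
Proof.
have D k : (\sum_i 'X_i ^+ k.+1)^`M(j) = k.+1%:R *: 'X_j ^+ k :> {mpoly K[4]}.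
  rewrite linear_sum /= (bigD1 j) //= mderivXn eqxx mul1r big1 ?addr0 // => i ij.
  by rewrite mderivXn (negPf ij) mul0r scale0r.
rewrite /kummer mderivB mderivZ D [(\sum_i 'X_i ^+ 2) ^+ 2]expr2 mderivM D.
set S := \sum_i _; rewrite expr1 -!mul_mpolyC.
by ring.
Qed.

Lemma eval_kummer_deriv j x : eval_at kummer^`M(j) x =
  4 * (x ord0 j * (3 * x ord0 j ^+ 2 - sumsq x)).
Proof.
rewrite kummer_deriv /eval_at mevalZ mevalM mevalB mevalZ rmorphXn /= mevalXU.
rewrite rmorph_sum /=; congr (_ * (_ * (_ - _))).
by apply: eq_bigr => i _; rewrite rmorphXn /= mevalXU.
Qed.

Lemma eval_kummer_hess a b x : eval_at kummer^`M(a)^`M(b) x =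
  (a == b)%:R * (4 * (9 * x ord0 a ^+ 2 - sumsq x))
  - 8 * (x ord0 a * x ord0 b).
Proof.
have D k j : (\sum_i 'X_i ^+ k.+1)^`M(j) = k.+1%:R *: 'X_j ^+ k :> {mpoly K[4]}.
  rewrite linear_sum /= (bigD1 j) //= mderivXn eqxx mul1r big1 ?addr0 // => i ij.
  by rewrite mderivXn (negPf ij) mul0r scale0r.
have X1 : ('X_a)^`M(b) = (a == b)%:R :> {mpoly K[4]}.
  by have := mderivXn a b 0; rewrite expr1 expr0 mulr1 scaler_nat.
rewrite kummer_deriv mderivZ mderivM X1 mderivB mderivZ D mderivXn expr1.
rewrite /eval_at mevalZ mevalD !mevalM !mevalB !mevalZ !rmorphXn /= !mevalXU.
rewrite rmorph_nat rmorph_sum /= (_ : \sum_i _ = sumsq x); last first.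
  by apply: eq_bigr => i _; rewrite rmorphXn /= mevalXU.
rewrite expr1; case: (a == b); ring.
Qed.

Lemma singular_kummer Q : singular_locus kummer Q <->
  forall j, hcoord Q ord0 j = 0 \/ 3 * hcoord Q ord0 j ^+ 2 = sumsq (hcoord Q).
Proof.
have n4 : 4 != 0 :> K by rewrite pnatr_eq0.
rewrite singular_locusP; last exact: kummer_homog.
split=> h j.
  have /eqP := h j; rewrite eval_kummer_deriv !mulf_eq0 (negPf n4) subr_eq0 /=.
  by case/orP => /eqP; [left | right].
rewrite eval_kummer_deriv; case: (h j) => ->; first by rewrite mul0r mulr0.
by rewrite subrr !mulr0.
Qed.

(** Let S be the sum of squares and k the number of nonzero coordinates. Adding up the equations 3
    q_j^2 = S over these gives k S = 3 S, and S is nonzero, so k = 3. *)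
Lemma singular_kummer_coords Q : singular_locus kummer Q ->
  exists z, [/\ hcoord Q ord0 z = 0, sumsq (hcoord Q) != 0
    & forall k, 3 * hcoord Q ord0 (lift z k) ^+ 2 = sumsq (hcoord Q)].
Proof.
move=> /singular_kummer; set q := hcoord Q; set S := sumsq q => h.
have S0 : S != 0.
  have [j qj] := exists_hcoord Q; case: (h j) => [e|<-].
    by rewrite -/q e eqxx in qj.
  by rewrite mulf_neq0 ?expf_neq0 ?pnatr_eq0.
have [z qz] : exists z, q ord0 z = 0.
  apply: contrapT => hno; case/eqP: S0.
  have E j : 3 * q ord0 j ^+ 2 = S by case: (h j) => // e; case: hno; exists j.
  have : 3 * S = 4 * S.
    rewrite {1}/S /sumsq mulr_sumr (eq_bigr (fun=> S)) // sumr_const card_ord.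
    by rewrite mulr_natl.
  by move=> e; apply: (addrI (3 * S)); rewrite addr0 [RHS]e; ring.
exists z; split=> //.
pose t k := 3 * q ord0 (lift z k) ^+ 2.
have tE k : t k = 0 \/ t k = S.
  by rewrite /t; case: (h (lift z k)) => ->; [left; rewrite expr0n mulr0 | right].
have tS : t 0 + t 1 + t 2 = 3 * S.
  rewrite {1}/S /sumsq (bigD1_ord z) //= qz expr0n add0r !big_ord_recl big_ord0.
  rewrite addr0 !mulrDr addrA; congr (_ + _ + _); rewrite /t;
    congr (_ * q ord0 (lift z _) ^+ 2); exact: val_inj.
have nS n : n.+1%:R * S <> 0.
  by move/eqP; rewrite mulf_eq0 pnatr_eq0 (negPf S0).
have t_all : t 0 = S /\ t 1 = S /\ t 2 = S.
  have sub e' : e' = 3 * S -> 3 * S - e' = 0 by move=> ->; rewrite subrr.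
  case: (tE 0) (tE 1) (tE 2) tS => [] -> [] -> [] -> /sub e; try by split.
  - by case: (nS 2%N); rewrite -e; ring.
  - by case: (nS 1%N); rewrite -e; ring.
  - by case: (nS 1%N); rewrite -e; ring.
  - by case: (nS 0%N); rewrite -e; ring.
  - by case: (nS 1%N); rewrite -e; ring.
  - by case: (nS 0%N); rewrite -e; ring.
  - by case: (nS 0%N); rewrite -e; ring.
move=> k; have [e0 [e1 e2]] := t_all; rewrite -/(t k).
by case: k => [[|[|[|//]]] hk]; [rewrite -e0|rewrite -e1|rewrite -e2];
  congr (t _); apply: val_inj.
Qed.

(** The Hessian is a diagonal matrix minus 8 times the rank one matrix of [q]. Its diagonal part is
    -4S at the zero coordinate and 8S elsewhere, so a kernel vector is determined by its product
    [sg] with [q] and equals [sg / S] times [q]. *)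
Lemma kummer_nodal : nodal kummer.
Proof.
move=> Q Qs; have [z [qz S0 qS]] := singular_kummer_coords Qs.
apply/(is_nodeP kummer_homog Qs)/(kernel_tensor kummer_homog).
set q := hcoord Q in qz S0 qS *; set S := sumsq q in S0 qS.
move=> w /rowP wA; pose sg := \sum_a w ord0 a * q ord0 a.
have E b : w ord0 b * (4 * (9 * q ord0 b ^+ 2 - S)) = 8 * (q ord0 b * sg).
  have := wA b; rewrite [LHS]mxE [RHS]mxE.
  rewrite (eq_bigr (fun a => (a == b)%:R * (w ord0 a * (4 * (9 * q ord0 a ^+ 2 - S)))
      - 8 * q ord0 b * (w ord0 a * q ord0 a))) => [|a _]; last first.
    by rewrite mxE eval_kummer_hess -/S; ring.
  rewrite sumrB -mulr_sumr -/sg (bigD1 b) //= eqxx mul1r big1 ?addr0 => [|a ab].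
    by move/eqP; rewrite subr_eq0 => /eqP ->; rewrite mulrA.
  by rewrite (negPf ab) mul0r.
exists (sg / S); apply/rowP => b; rewrite mxE.
case: (unliftP z b) => [k|] ->; last first.
  have := E z; rewrite qz mul0r !mulr0 expr0n mulr0 sub0r => /eqP.
  by rewrite !mulf_eq0 oppr_eq0 (negPf S0) pnatr_eq0 !orbF => /eqP.
have := E (lift z k); rewrite (_ : 9 * _ - S = 2 * S); last first.
  by rewrite -(qS k); ring.
move=> e; apply: (mulfI (_ : 8 * S != 0)); first by rewrite mulf_neq0 ?pnatr_eq0.
rewrite (_ : 8 * S * (_ / _ * _) = 8 * (q ord0 (lift z k) * sg)).
  by rewrite -e; ring.
by field.
Qed.

(** The index records the position of the zero and two signs; the first nonzero coordinate is 1,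
    which selects one vector on each line. *)
Definition kummer_vec (t : 'I_4 * (bool * bool)) : 'rV[K]_4 := \row_j
  if unlift t.1 j is Some k then (-1) ^+ (nth false [:: false; t.2.1; t.2.2] k) else 0.

Lemma kummer_vec0 t : kummer_vec t ord0 t.1 = 0.
Proof. by rewrite mxE unlift_none. Qed.

Lemma kummer_vec_lift t k : kummer_vec t ord0 (lift t.1 k) =
  (-1) ^+ (nth false [:: false; t.2.1; t.2.2] k).
Proof. by rewrite mxE liftK. Qed.

Lemma kummer_vec_neq0 t : kummer_vec t != 0.
Proof.
apply/eqP => /rowP/(_ (lift t.1 ord0)); rewrite kummer_vec_lift mxE => /eqP.
by rewrite signr_eq0.
Qed.

Definition kummer_pt t : projspace K 3 := line_of (kummer_vec_neq0 t).

Lemma sign_inj (b b' : bool) : (-1) ^+ b = (-1) ^+ b' :> K -> b = b'.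
Proof.
have n1 : (1 : K) != -1.
  by rewrite -subr_eq0 opprK -(natrD _ 1 1) pnatr_eq0.
case: b b' => [] [] //; rewrite expr0 expr1 => /eqP; first by rewrite eq_sym (negPf n1).
by rewrite (negPf n1).
Qed.

Lemma kummer_pt_inj : injective kummer_pt.
Proof.
move=> t t' e; have [c c0 hc] := hcoord_line_of (kummer_vec_neq0 t).
have [d d0 hd] := hcoord_line_of (kummer_vec_neq0 t').
have V j : c * kummer_vec t ord0 j = d * kummer_vec t' ord0 j.
  by have := congr1 (fun P => hcoord P ord0 j) e; rewrite /kummer_pt hc hd !mxE.
have tz : t.1 = t'.1.
  have := V t.1; rewrite kummer_vec0 mulr0 => /esym/eqP; rewrite mulf_eq0 (negPf d0) /=.
  by case: (unliftP t'.1 t.1) => [k ->|//]; rewrite kummer_vec_lift signr_eq0.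
have W (k : 'I_3) : c * (-1) ^+ (nth false [:: false; t.2.1; t.2.2] k) =
    d * (-1) ^+ (nth false [:: false; t'.2.1; t'.2.2] k).
  by have := V (lift t.1 k); rewrite kummer_vec_lift => ->; rewrite tz kummer_vec_lift.
have cd : c = d by have := W ord0; rewrite /= !mulr1.
have sgn (k : 'I_3) :
    nth false [:: false; t.2.1; t.2.2] k = nth false [:: false; t'.2.1; t'.2.2] k.
  by apply: sign_inj; apply: (mulfI d0); rewrite -W cd.
move: (sgn 1) (sgn 2) tz => /=; case: (t) (t') => [z [s1 s2]] [z' [s1' s2']] /=.
by move=> -> -> ->.
Qed.

Lemma sumsqZ c x : sumsq (c *: x) = c ^+ 2 * sumsq x.
Proof. by rewrite /sumsq mulr_sumr; apply: eq_bigr => j _; rewrite mxE exprMn. Qed.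

Lemma sumsq_kummer_vec t : sumsq (kummer_vec t) = 3.
Proof.
rewrite /sumsq (bigD1_ord t.1) //= kummer_vec0 expr0n add0r.
by under eq_bigr => k _ do rewrite kummer_vec_lift sqrr_sign; rewrite sumr_const card_ord.
Qed.

Lemma kummer_singularP Q : singular_locus kummer Q <-> exists t, Q = kummer_pt t.
Proof.
split=> [Qs|[t ->]]; last first.
  apply/singular_kummer => j; have [c c0 hc] := hcoord_line_of (kummer_vec_neq0 t).
  rewrite /kummer_pt hc sumsqZ sumsq_kummer_vec mxE exprMn.
  case: (unliftP t.1 j) => [k|] ->; last by left; rewrite kummer_vec0 mulr0.
  by right; rewrite kummer_vec_lift sqrr_sign mulr1 mulrC.
have [z [qz S0 qS]] := singular_kummer_coords Qs.
set q := hcoord Q in qz S0 qS; set c := q ord0 (lift z ord0).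
have qk k : exists s : bool, q ord0 (lift z k) = c * (-1) ^+ s.
  have : q ord0 (lift z k) ^+ 2 == c ^+ 2.
    by apply/eqP/(mulfI (_ : 3 != 0)); rewrite ?pnatr_eq0 // !qS.
  rewrite eqf_sqr => /orP[] /eqP ->; first by exists false; rewrite expr0 mulr1.
  by exists true; rewrite expr1 mulrN1.
have [s1 e1] := qk 1; have [s2 e2] := qk 2.
pose t := (z, (s1, s2)); exists t.
have [d d0 hd] := hcoord_line_of (kummer_vec_neq0 t).
apply: (@projspace_eq _ _ _ _ (c / d)); rewrite /kummer_pt hd scalerA divfK // -/q.
apply/rowP => j; rewrite mxE; case: (unliftP z j) => [k|] ->; last first.
  by rewrite -[z]/(t.1) kummer_vec0 mulr0.
rewrite -[z]/(t.1) kummer_vec_lift /=.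
case: k => [[|[|[|//]]] hk] /=.
- by rewrite mulr1 /c; congr (q _ (lift _ _)); apply: val_inj.
- by rewrite -e1; congr (q _ (lift _ _)); apply: val_inj.
- by rewrite -e2; congr (q _ (lift _ _)); apply: val_inj.
Qed.

Theorem sixteen_nodes : exists (i0 : 'I_35) (y0 : 'rV[K]_34) (P : 'I_16 -> projspace K 3),
  [/\ nodal (quartic_form (affine_vec i0 y0)), injective P
    & forall Q, singular_locus (quartic_form (affine_vec i0 y0)) Q <-> exists i, Q = P i].
Proof.
have [h kh] := veronese_span kummer_homog.
have [i0 hi0] : exists i0, h ord0 i0 != 0.
  (* A zero coefficient vector would make every point singular, but (1 : 1 : 1 : 1) has no zero
     coordinate. *)
  apply/rV0Pn; apply: contraTneq isT => h0.
  have [c c0 hc] := hcoord_line_of (affine_vec_neq0 0 (const_mx 1 : 'rV[K]_3)).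
  have : singular_locus kummer (affine_chart 0 (const_mx 1)).
    apply/(singular_locusP kummer_homog) => j.
    rewrite kh h0 /quartic_form big1 ?mderiv0 /eval_at ?meval0 // => l _.
    by rewrite mxE scale0r.
  move=> /singular_kummer_coords [z [/eqP + _ _]].
  rewrite /affine_chart hc !mxE; case: unliftP => [k|] _; last by rewrite mulr1 (negPf c0).
  by rewrite mxE mulr1 (negPf c0).
pose y0 : 'rV[K]_34 := \row_k (h ord0 (lift i0 k) / h ord0 i0).
have E : quartic_form (affine_vec i0 y0) = (h ord0 i0)^-1 *: kummer.
  rewrite kh /quartic_form scaler_sumr; apply: eq_bigr => j _.
  rewrite scalerA; congr (_ *: _); rewrite mxE.
  by case: (unliftP i0 j) => [k|] ->; rewrite ?liftK ?unlift_none ?mxE ?mulVf // mulrC.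
have c0 : (h ord0 i0)^-1 != 0 by rewrite invr_eq0.
have card16 : #|{: 'I_4 * (bool * bool)}| = 16%N by rewrite !card_prod card_ord card_bool.
exists i0, y0, (fun i => kummer_pt (enum_val (cast_ord (esym card16) i))).
rewrite E; split.
- by move=> Q /(singular_locus_scale c0) /kummer_nodal; apply: is_node_scale.
- by move=> i j /kummer_pt_inj /enum_val_inj /cast_ord_inj.
- move=> Q; rewrite singular_locus_scale // kummer_singularP.
  split=> [[t ->]|[i ->]]; last by eexists.
  by exists (cast_ord card16 (enum_rank t)); rewrite cast_ordK enum_rankK.
Qed.

End Kummer.
End KummerQuartic.

(** * Strict differentiability and the inverse function theorem over the complex numbers *)

Module StrictDifferentiability.
Section Norm.
Variable R : realType.
Notation K := (R[i]).

Definition modC (z : K) : R := complex.Re `|z|.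

Lemma modCE (z : K) : `|z| = (modC z)%:C%C.
Proof. by rewrite /modC RRe_real // normr_real. Qed.

Lemma modC_ge0 (z : K) : 0 <= modC z.
Proof. by rewrite -lecR -modCE normr_ge0. Qed.

Lemma modCD (x y : K) : modC (x + y) <= modC x + modC y.
Proof. by rewrite -lecR rmorphD /= -!modCE ler_normD. Qed.

Lemma modCM (x y : K) : modC (x * y) = modC x * modC y.
Proof. by apply: complexI; rewrite rmorphM /= -!modCE normrM. Qed.

Lemma modCN (x : K) : modC (- x) = modC x.
Proof. by rewrite /modC normrN. Qed.

Lemma modC0 : modC 0 = 0.
Proof. by rewrite /modC normr0. Qed.

Lemma modC1 : modC 1 = 1.
Proof. by rewrite /modC normr1. Qed.

Lemma modC_eq0 (x : K) : modC x = 0 -> x = 0.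
Proof. by move=> x0; apply/eqP; rewrite -normr_eq0 modCE x0. Qed.

Lemma modC_gt0 (x : K) : x != 0 -> 0 < modC x.
Proof.
move=> x0; rewrite lt0r modC_ge0 andbT; apply: contra_neq x0 => /modC_eq0 //.
Qed.

Lemma modCB (x y : K) : modC (x - y) = modC (y - x).
Proof. by rewrite -modCN opprB. Qed.

Lemma modC_sum (I : Type) (s : seq I) (P : pred I) (F : I -> K) :
  modC (\sum_(i <- s | P i) F i) <= \sum_(i <- s | P i) modC (F i).
Proof.
elim/big_rec2: _ => [|i y1 y2 _ h]; first by rewrite modC0.
by apply: le_trans (modCD _ _) _; rewrite lerD2l.
Qed.

Lemma modC_prod (I : Type) (s : seq I) (P : pred I) (F : I -> K) :
  modC (\prod_(i <- s | P i) F i) = \prod_(i <- s | P i) modC (F i).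
Proof.
elim/big_rec2: _ => [|i y1 y2 _ h]; first by rewrite modC1.
by rewrite modCM h.
Qed.

(* The library's norm on 'rV[K]_n takes its values in K, whose order is only
   partial; norm1 and modC are real-valued. *)
Definition norm1 n (v : 'rV[K]_n) : R := \sum_j modC (v ord0 j).

Lemma norm1_ge0 n (v : 'rV[K]_n) : 0 <= norm1 v.
Proof. by apply: sumr_ge0 => j _; apply: modC_ge0. Qed.

Lemma norm1D n (v w : 'rV[K]_n) : norm1 (v + w) <= norm1 v + norm1 w.
Proof.
by rewrite /norm1 -big_split /=; apply: ler_sum => j _; rewrite mxE modCD.
Qed.

Lemma norm1N n (v : 'rV[K]_n) : norm1 (- v) = norm1 v.
Proof. by apply: eq_bigr => j _; rewrite mxE modCN. Qed.

Lemma norm1_dist n (v w : 'rV[K]_n) : norm1 (v - w) = norm1 (w - v).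
Proof. by rewrite -norm1N opprB. Qed.

Lemma norm1_tri n (u v w : 'rV[K]_n) :
  norm1 (u - w) <= norm1 (u - v) + norm1 (v - w).
Proof. by rewrite (le_trans _ (norm1D _ _)) // addrA subrK. Qed.

Lemma norm1_0 n : norm1 (0 : 'rV[K]_n) = 0.
Proof. by rewrite /norm1 big1 // => j _; rewrite mxE modC0. Qed.

Lemma modC_le_norm1 n (v : 'rV[K]_n) j : modC (v ord0 j) <= norm1 v.
Proof.
by rewrite /norm1 (bigD1 j) //= lerDl sumr_ge0 // => k _; apply: modC_ge0.
Qed.

Lemma norm1_eq0 n (v : 'rV[K]_n) : norm1 v = 0 -> v = 0.
Proof.
move=> v0; apply/rowP => j; rewrite mxE; apply: modC_eq0; apply/eqP.
by rewrite eq_le modC_ge0 andbT -v0 modC_le_norm1.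
Qed.

Lemma mulmx_col m n p (v : 'M[K]_(m, n)) (A : 'M[K]_(n, p)) i j :
  (v *m A) i j = (v *m col j A) i ord0.
Proof. by rewrite !mxE; apply: eq_bigr => k _; rewrite !mxE. Qed.

Lemma cV1_col n (A : 'cV[K]_n) j : col j A = A.
Proof. by apply/matrixP => a b; rewrite !mxE !ord1. Qed.

Definition opnorm m n (A : 'M[K]_(m, n)) : R := \sum_i \sum_j modC (A i j).

Lemma opnorm_ge0 m n (A : 'M[K]_(m, n)) : 0 <= opnorm A.
Proof. by apply: sumr_ge0 => i _; apply: sumr_ge0 => j _; apply: modC_ge0. Qed.

Lemma norm1_mulmx m n (A : 'M[K]_(m, n)) (v : 'rV[K]_m) :
  norm1 (v *m A) <= opnorm A * norm1 v.
Proof.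
rewrite /norm1 /opnorm.
have -> : (\sum_i \sum_j modC (A i j)) * \sum_j modC (v ord0 j) =
    \sum_j \sum_i (modC (A i j) * \sum_j modC (v ord0 j)).
  by rewrite exchange_big /= mulr_suml; apply: eq_bigr => i _; rewrite mulr_suml.
apply: ler_sum => j _; rewrite mxE; apply: le_trans (modC_sum _ _ _) _.
apply: ler_sum => i _; rewrite modCM mulrC ler_wpM2l ?modC_ge0 //.
exact: (modC_le_norm1 v i).
Qed.

Lemma sum_cst n (c : R) : \sum_(j < n) c = n%:R * c.
Proof. by rewrite sumr_const card_ord mulr_natl. Qed.

Lemma geometric_small (D e : R) : 0 < e -> exists k, D / 2 ^+ k < e.
Proof.
move=> e0; exists (Num.bound (D / e)); set k := Num.bound _.
rewrite ltr_pdivrMr ?exprn_gt0 // mulrC -ltr_pdivrMr //.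
apply: le_lt_trans (ler_norm _) _.
rewrite (lt_le_trans (archi_boundP (normr_ge0 _))) //.
rewrite -natrX ler_nat; apply: leq_trans (ltnW (ltn_expl k (ltnSn 1))).
by rewrite /k /Num.bound normr_id.
Qed.

(** The intervals of radius [e k] around [u k] are nested, and the supremum of their left ends lies
    in all of them. *)
Lemma geometric_limit_real (u : nat -> R) (C : R) :
  (forall k, `|u k.+1 - u k| <= C / 2 ^+ k) ->
  exists l, forall k, `|u k - l| <= 2 * C / 2 ^+ k.
Proof.
move=> hu.
have C0 : 0 <= C by have := le_trans (normr_ge0 _) (hu 0%N); rewrite expr0 divr1.
pose e k := 2 * C / 2 ^+ k.
have eS k : e k = e k.+1 + C / 2 ^+ k.
  rewrite /e exprS; have : (2 ^+ k : R) != 0 by apply: expf_neq0; rewrite pnatr_eq0.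
  by move: (2 ^+ k : R) => t t0; field.
have e0 k : 0 <= e k by rewrite /e divr_ge0 ?exprn_ge0 ?mulr_ge0.
have lo k d : u k - e k <= u (k + d)%N - e (k + d)%N.
  elim: d => [|d ih]; first by rewrite addn0.
  apply: le_trans ih _; rewrite addnS (eS (k + d)%N).
  by have := hu (k + d)%N; rewrite ler_norml => /andP[h _]; lra.
have hi k d : u (k + d)%N + e (k + d)%N <= u k + e k.
  elim: d => [|d ih]; first by rewrite addn0.
  apply: le_trans ih; rewrite addnS (eS (k + d)%N).
  by have := hu (k + d)%N; rewrite ler_norml => /andP[_ h]; lra.
have lohi k l : u k - e k <= u l + e l.
  apply: (le_trans (lo k l)); apply: le_trans (hi l k); rewrite addnC.
  by have := e0 (l + k)%N; lra.
pose A : set R := fun x => exists k, x = u k - e k.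
have hA : has_sup A.
  split; first by exists (u 0%N - e 0%N), 0%N.
  by exists (u 0%N + e 0%N) => _ [k ->]; apply: lohi.
exists (sup A) => k; rewrite ler_norml -/(e k); apply/andP; split.
  have : sup A <= u k + e k by apply: ge_sup hA.1 _ => _ [l ->]; apply: lohi.
  by lra.
have : u k - e k <= sup A by apply: (ub_le_sup hA.2); exists k.
by lra.
Qed.

Lemma Re_le_modC (z : K) : `|complex.Re z| <= modC z.
Proof. by rewrite -lecR -modCE normc_ge_Re. Qed.

Lemma Im_le_modC (z : K) : `|complex.Im z| <= modC z.
Proof.
have -> : complex.Im z = - complex.Re ('i * z)%C.
  by case: z => a b /=; rewrite mul0r mul1r sub0r opprK.
rewrite normrN; apply: le_trans (Re_le_modC _) _; rewrite modCM.
suff -> : modC 'i%C = 1 by rewrite mul1r.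
by rewrite /modC normc_def /= expr0n expr1n add0r sqrtr1.
Qed.

Lemma modC_le_ReIm (z : K) : modC z <= `|complex.Re z| + `|complex.Im z|.
Proof.
have -> : z = (complex.Re z)%:C%C + (complex.Im z)%:C%C * 'i%C.
  by case: z => a b; rewrite /= ; simpc.
have real_mod (r : R) : modC r%:C%C = `|r|.
  by rewrite /modC normc_def /= expr0n addr0 sqrtr_sqr.
have i1 : modC 'i%C = 1 by rewrite /modC normc_def /= expr0n expr1n add0r sqrtr1.
apply: le_trans (modCD _ _) _.
rewrite modCM !real_mod i1 mulr1; apply: lerD.
  by case: z => a b; rewrite /=; simpc.
by case: z => a b; rewrite /=; simpc.
Qed.

Lemma geometric_limit n (u : nat -> 'rV[K]_n) (C : R) :
  (forall k, norm1 (u k.+1 - u k) <= C / 2 ^+ k) ->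
  exists l D, forall k, norm1 (u k - l) <= D / 2 ^+ k.
Proof.
move=> hu.
have hre j : exists l, forall k,
    `|complex.Re (u k ord0 j) - l| <= 2 * C / 2 ^+ k.
  apply: geometric_limit_real => k; apply: le_trans (hu k).
  apply: le_trans (modC_le_norm1 _ j).
  rewrite !mxE (_ : _ - _ = complex.Re (u k.+1 ord0 j - u k ord0 j)).
    exact: Re_le_modC.
  by case: (u k.+1 _ _) (u k _ _) => ? ? [].
have him j : exists l, forall k,
    `|complex.Im (u k ord0 j) - l| <= 2 * C / 2 ^+ k.
  apply: geometric_limit_real => k; apply: le_trans (hu k).
  apply: le_trans (modC_le_norm1 _ j).
  rewrite !mxE (_ : _ - _ = complex.Im (u k.+1 ord0 j - u k ord0 j)).
    exact: Im_le_modC.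
  by case: (u k.+1 _ _) (u k _ _) => ? ? [].
have [a ha] := choice hre; have [b hb] := choice him.
exists (\row_j (a j +i* b j)%C), (n%:R * (4 * C)) => k.
have -> : n%:R * (4 * C) / 2 ^+ k = \sum_(j < n) (4 * C / 2 ^+ k).
  by rewrite sum_cst [RHS]mulrA.
apply: ler_sum => j _; rewrite !mxE; apply: le_trans (modC_le_ReIm _) _.
have -> : 4 * C / 2 ^+ k = 2 * C / 2 ^+ k + 2 * C / 2 ^+ k by lra.
apply: lerD.
  by have := ha j k; case: (u k _ _).
by have := hb j k; case: (u k _ _).
Qed.

Definition nbhd n (q : 'rV[K]_n) (P : 'rV[K]_n -> Prop) : Prop :=
  exists d : R, 0 < d /\ forall y, norm1 (y - q) < d -> P y.

Lemma nbhd_all n (q : 'rV[K]_n) (P : 'rV[K]_n -> Prop) :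
  (forall y, P y) -> nbhd q P.
Proof. by move=> h; exists 1. Qed.

Lemma nbhd_self n (q : 'rV[K]_n) (P : 'rV[K]_n -> Prop) : nbhd q P -> P q.
Proof. by case=> d [d0]; apply; rewrite subrr norm1_0. Qed.

Lemma nbhd_mono n (q : 'rV[K]_n) (P Q : 'rV[K]_n -> Prop) :
  nbhd q P -> (forall y, P y -> Q y) -> nbhd q Q.
Proof. by case=> d [d0 h] hPQ; exists d; split=> // y /h /hPQ. Qed.

Lemma nbhdI n (q : 'rV[K]_n) (P Q : 'rV[K]_n -> Prop) :
  nbhd q P -> nbhd q Q -> nbhd q (fun y => P y /\ Q y).
Proof.
case=> d [d0 hP] [e [e0 hQ]]; exists (Order.min d e).
by split=> [|y]; [rewrite lt_min d0|rewrite lt_min => /andP[/hP ? /hQ ?]].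
Qed.

Lemma nbhd_forall (I : finType) n (q : 'rV[K]_n) (P : I -> 'rV[K]_n -> Prop) :
  (forall i, nbhd q (P i)) -> nbhd q (fun y => forall i, P i y).
Proof.
move=> h.
suff /(_ (enum I)) hs : forall s : seq I,
    nbhd q (fun y => forall i, i \in s -> P i y).
  by apply: nbhd_mono hs _ => y hy i; apply: hy; rewrite mem_enum.
elim=> [|i s ih]; first by apply: nbhd_all.
apply: nbhd_mono (nbhdI (h i) ih) _ => y [h1 h2] j.
by rewrite inE => /orP[/eqP ->|/h2].
Qed.

Lemma nbhd_ball n (q : 'rV[K]_n) (d : R) :
  0 < d -> nbhd q (fun y => norm1 (y - q) < d).
Proof. by move=> d0; exists d. Qed.

Lemma nbhd_nbhd n (q : 'rV[K]_n) (P : 'rV[K]_n -> Prop) :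
  nbhd q P -> nbhd q (fun y => nbhd y P).
Proof.
case=> d [d0 hP]; exists d; split=> // y hy; exists (d - norm1 (y - q)).
split=> [|z hz]; first by rewrite subr_gt0.
by apply: hP; apply: le_lt_trans (norm1_tri _ y _) _; rewrite -ltrBrDr.
Qed.

Definition open1 n (U : 'rV[K]_n -> Prop) : Prop := forall z, U z -> nbhd z U.

Lemma open1_ball n (q : 'rV[K]_n) (r : R) : open1 (fun y => norm1 (y - q) < r).
Proof.
move=> y hy; exists (r - norm1 (y - q)); split=> [|z hz].
  by rewrite subr_gt0.
by apply: le_lt_trans (norm1_tri _ y _) _; rewrite -ltrBrDr.
Qed.

Lemma open1_nbhd n (q : 'rV[K]_n) (P : 'rV[K]_n -> Prop) :
  open1 (fun y => nbhd y P).
Proof. by move=> y; apply: nbhd_nbhd. Qed.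

(* Unlike Frechet differentiability at one point, strict differentiability makes
   the inverse function theorem available without any continuity of the
   differential. *)
Definition sdiff m n (f : 'rV[K]_m -> 'rV[K]_n) (x : 'rV[K]_m)
    (A : 'M[K]_(m, n)) : Prop :=
  forall e : R, 0 < e -> exists d : R, 0 < d /\ forall y z,
    norm1 (y - x) < d -> norm1 (z - x) < d ->
    norm1 (f y - f z - (y - z) *m A) <= e * norm1 (y - z).

Definition sdiff1 m (f : 'rV[K]_m -> K) (x : 'rV[K]_m) (A : 'cV[K]_m) : Prop :=
  forall e : R, 0 < e -> exists d : R, 0 < d /\ forall y z,
    norm1 (y - x) < d -> norm1 (z - x) < d ->
    modC (f y - f z - ((y - z) *m A) ord0 ord0) <= e * norm1 (y - z).

Lemma sdiff_lip m n (f : 'rV[K]_m -> 'rV[K]_n) x A : sdiff f x A ->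
  exists d : R, 0 < d /\ forall y z,
    norm1 (y - x) < d -> norm1 (z - x) < d ->
    norm1 (f y - f z) <= (opnorm A + 1) * norm1 (y - z).
Proof.
case/(_ 1 ltr01) => d [d0 h]; exists d; split=> // y z hy hz.
have -> : f y - f z = (f y - f z - (y - z) *m A) + (y - z) *m A.
  by rewrite subrK.
apply: le_trans (norm1D _ _) _; rewrite mulrDl addrC lerD ?h //.
exact: norm1_mulmx.
Qed.

Lemma sdiff_continuous m n (f : 'rV[K]_m -> 'rV[K]_n) x A P :
  sdiff f x A -> nbhd (f x) P -> nbhd x (fun y => P (f y)).
Proof.
move=> /sdiff_lip [d [d0 h]] [e [e0 hP]].
have C0 : 0 < opnorm A + 1 by have := opnorm_ge0 A; lra.
exists (Order.min d (e / (opnorm A + 1))); split.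
  by rewrite lt_min d0 divr_gt0.
move=> y; rewrite lt_min => /andP[h1 h2]; apply: hP.
have h0 : norm1 (x - x) < d by rewrite subrr norm1_0.
by apply: le_lt_trans (h _ _ h1 h0) _; rewrite mulrC -ltr_pdivlMr.
Qed.

Lemma sdiff_ext m n (f g : 'rV[K]_m -> 'rV[K]_n) x A :
  nbhd x (fun y => f y = g y) -> sdiff f x A -> sdiff g x A.
Proof.
move=> [d [d0 h]] hf e /hf [d' [d0' h']]; exists (Order.min d d').
split=> [|y z]; first by rewrite lt_min d0.
by rewrite !lt_min => /andP[/h <- hy] /andP[/h <- hz]; apply: h'.
Qed.

Lemma sdiff_comp m n p (f : 'rV[K]_m -> 'rV[K]_n) (g : 'rV[K]_n -> 'rV[K]_p)
    x A B : sdiff f x A -> sdiff g (f x) B ->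
  sdiff (fun y => g (f y)) x (A *m B).
Proof.
move=> hf hg e e0; have [dl [dl0 hl]] := sdiff_lip hf.
set C := opnorm A + 1 in hl; set D := opnorm B + 1.
have C0 : 0 < C by have := opnorm_ge0 A; rewrite /C; lra.
have D0 : 0 < D by have := opnorm_ge0 B; rewrite /D; lra.
have eC0 : 0 < e / (2 * C) by rewrite divr_gt0 ?mulr_gt0.
have eD0 : 0 < e / (2 * D) by rewrite divr_gt0 ?mulr_gt0.
have [dg [dg0 hdg]] := hg _ eC0; have [df [df0 hdf]] := hf _ eD0.
have near y : norm1 (y - x) < Order.min dl (dg / C) -> norm1 (f y - f x) < dg.
  rewrite lt_min => /andP[h1 h2].
  have h0 : norm1 (x - x) < dl by rewrite subrr norm1_0.
  by apply: le_lt_trans (hl _ _ h1 h0) _; rewrite mulrC -ltr_pdivlMr.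
exists (Order.min (Order.min dl (dg / C)) df); split.
  by rewrite !lt_min dl0 df0 divr_gt0.
move=> y z; rewrite lt_min => /andP[hy1 hy2]; rewrite lt_min => /andP[hz1 hz2].
have := hdg _ _ (near _ hy1) (near _ hz1).
move: (hdf _ _ hy2 hz2) => h1 h2.
have -> : g (f y) - g (f z) - (y - z) *m (A *m B) =
  (g (f y) - g (f z) - (f y - f z) *m B) + (f y - f z - (y - z) *m A) *m B.
  by rewrite (mulmxBl _ (_ *m A)) mulmxA addrA subrK.
apply: le_trans (norm1D _ _) _.
have h3 : norm1 ((f y - f z - (y - z) *m A) *m B) <= e / 2 * norm1 (y - z).
  apply: le_trans (norm1_mulmx _ _) _.
  apply: (@le_trans _ _ (D * (e / (2 * D) * norm1 (y - z)))).
    apply: ler_pM => //; try exact: norm1_ge0; first exact: opnorm_ge0.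
    by rewrite /D; lra.
  by rewrite le_eqVlt; apply/orP; left; apply/eqP; field; rewrite lt0r_neq0.
have h4 : norm1 (g (f y) - g (f z) - (f y - f z) *m B) <= e / 2 * norm1 (y - z).
  apply: le_trans h2 _.
  move: hy1 hz1; rewrite !lt_min => /andP[hy1 _] /andP[hz1 _].
  apply: (@le_trans _ _ (e / (2 * C) * (C * norm1 (y - z)))).
    by apply: ler_wpM2l (hl _ _ hy1 hz1); rewrite divr_ge0 ?mulr_ge0 // ltW.
  by rewrite le_eqVlt; apply/orP; left; apply/eqP; field; rewrite lt0r_neq0.
lra.
Qed.

Lemma sdiff_coords m n (f : 'rV[K]_m -> 'rV[K]_n) x A :
  (forall j, sdiff1 (fun y => f y ord0 j) x (col j A)) -> sdiff f x A.
Proof.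
move=> h e e0.
have en0 : 0 < e / n.+1%:R by rewrite divr_gt0.
have /choice [d hd] : forall j, exists d : R, 0 < d /\ forall y z,
    norm1 (y - x) < d -> norm1 (z - x) < d ->
    modC (f y ord0 j - f z ord0 j - ((y - z) *m col j A) ord0 ord0)
      <= e / n.+1%:R * norm1 (y - z).
  by move=> j; apply: (h j).
have [d' [d0' hd']] : nbhd x (fun y => forall j, norm1 (y - x) < d j).
  by apply: nbhd_forall => j; apply: nbhd_ball; have [] := hd j.
exists d'; split=> // y z /hd' hy /hd' hz.
apply: (@le_trans _ _ (\sum_(j < n) e / n.+1%:R * norm1 (y - z))).
  apply: ler_sum => j _; have [_ hj] := hd j.
  by move: (hj y z (hy j) (hz j)); rewrite -mulmx_col !mxE.
rewrite sum_cst mulrA ler_wpM2r ?norm1_ge0 //.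
rewrite mulrCA -[leRHS]mulr1 ler_wpM2l ?(ltW e0) //.
by rewrite ler_pdivrMr // mul1r ler_nat.
Qed.

Lemma coord_sdiff m n (f : 'rV[K]_m -> 'rV[K]_n) x A j :
  sdiff f x A -> sdiff1 (fun y => f y ord0 j) x (col j A).
Proof.
move=> h e /h [d [d0 hd]]; exists d; split=> // y z hy hz.
apply: le_trans (hd _ _ hy hz); apply: le_trans (modC_le_norm1 _ j).
by rewrite -mulmx_col !mxE.
Qed.

Lemma sdiff1_row m (f : 'rV[K]_m -> K) x (A : 'cV[K]_m) :
  sdiff1 f x A -> sdiff (fun y => \row_(j < 1) f y) x A.
Proof.
move=> h; apply: sdiff_coords => j; rewrite cV1_col.
move=> e /h [d [d0 hd]]; exists d; split=> // y z hy hz.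
by rewrite !mxE; have := hd _ _ hy hz; rewrite !mxE.
Qed.

Lemma sdiff1_comp m n (f : 'rV[K]_m -> 'rV[K]_n) (g : 'rV[K]_n -> K) x A B :
  sdiff f x A -> sdiff1 g (f x) B -> sdiff1 (fun y => g (f y)) x (A *m B).
Proof.
move=> hf /sdiff1_row hg; have := coord_sdiff 0 (sdiff_comp hf hg).
rewrite cV1_col; move=> h e /h [d [d0 hd]]; exists d; split=> // y z hy hz.
by have := hd _ _ hy hz; rewrite !mxE.
Qed.

Lemma sdiff1_continuous m (f : 'rV[K]_m -> K) x A (e : R) :
  sdiff1 f x A -> 0 < e -> nbhd x (fun y => modC (f y - f x) < e).
Proof.
move=> /sdiff1_row hf e0.
have := sdiff_continuous hf (nbhd_ball (\row_(j < 1) f x) e0).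
by move/nbhd_mono; apply=> y; rewrite /norm1 big_ord1 !mxE.
Qed.

Lemma sdiff1_neq0 m (f : 'rV[K]_m -> K) x A :
  sdiff1 f x A -> f x != 0 -> nbhd x (fun y => f y != 0).
Proof.
move=> hf fx0; apply: nbhd_mono (sdiff1_continuous hf (modC_gt0 fx0)) _ => y.
by apply: contraTneq => ->; rewrite sub0r modCN ltxx.
Qed.

Lemma sdiff1_cst m (c : K) (x : 'rV[K]_m) : sdiff1 (fun=> c) x 0.
Proof.
move=> e e0; exists 1; split=> // y z _ _.
by rewrite mulmx0 mxE subrr subr0 modC0 mulr_ge0 ?norm1_ge0 // ltW.
Qed.

Lemma sdiff_linear m n (A : 'M[K]_(m, n)) (b : 'rV[K]_n) (x : 'rV[K]_m) :
  sdiff (fun y => y *m A + b) x A.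
Proof.
move=> e e0; exists 1; split=> // y z _ _.
rewrite mulmxBl opprD addrACA subrr addr0 subrr norm1_0.
by rewrite mulr_ge0 ?norm1_ge0 // ltW.
Qed.

Lemma sdiff1_coord m j (x : 'rV[K]_m) :
  sdiff1 (fun y => y ord0 j) x (delta_mx j ord0).
Proof.
have := coord_sdiff j (sdiff_linear 1%:M 0 x).
rewrite (_ : col j 1%:M = delta_mx j ord0); last first.
  by apply/matrixP => a b; rewrite !mxE ord1 eqxx andbT.
move=> h e /h [d [d0 hd]]; exists d; split=> // y z hy hz.
by have := hd _ _ hy hz; rewrite !addr0 !mulmx1.
Qed.

Lemma sdiff1D m (f g : 'rV[K]_m -> K) x A B :
  sdiff1 f x A -> sdiff1 g x B -> sdiff1 (fun y => f y + g y) x (A + B).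
Proof.
move=> hf hg e e0; have e20 : 0 < e / 2 by rewrite divr_gt0.
have [d [d0 hd]] := hf _ e20; have [d' [d0' hd']] := hg _ e20.
exists (Order.min d d'); split; first by rewrite lt_min d0.
move=> y z; rewrite !lt_min => /andP[hy hy'] /andP[hz hz'].
rewrite mulmxDr [(_ + _ : 'M_1) _ _]mxE.
rewrite (_ : _ - _ - _ = (f y - f z - ((y - z) *m A) ord0 ord0) +
  (g y - g z - ((y - z) *m B) ord0 ord0)); last first.
  by move: (_ ord0 ord0) (_ ord0 ord0) => a b; ring.
apply: le_trans (modCD _ _) _.
by have := hd _ _ hy hz; have := hd' _ _ hy' hz'; lra.
Qed.

Lemma sdiff1M m (f g : 'rV[K]_m -> K) x A B :
  sdiff1 f x A -> sdiff1 g x B ->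
  sdiff1 (fun y => f y * g y) x (g x *: A + f x *: B).
Proof.
move=> hf hg.
move=> e e0; have A0 := opnorm_ge0 A; have B0 := opnorm_ge0 B.
have f0 := modC_ge0 (f x); have g0 := modC_ge0 (g x).
(* The increment of the product is split below into four terms, each with one factor at most [e / S]
   up to [norm1 (y - z)]; [S] is the sum of the bounds of the remaining factors. *)
set S := modC (g x) + 1 + opnorm A + (modC (f x) + 1) + opnorm B.
have S0 : 0 < S by rewrite /S; lra.
have eS0 : 0 < e / S by rewrite divr_gt0.
have [df [df0 hdf]] := hf _ eS0; have [dg [dg0 hdg]] := hg _ eS0.
have [df' [df0' hdf']] := sdiff1_continuous hf eS0.
have [dg' [dg0' hdg']] := sdiff1_continuous hg eS0.
have [df1 [df10 hdf1]] := sdiff1_continuous hf ltr01.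
have [dg1 [dg10 hdg1]] := sdiff1_continuous hg ltr01.
exists (Order.min (Order.min df dg)
  (Order.min (Order.min df' dg') (Order.min df1 dg1))); split.
  by rewrite !lt_min df0 dg0 df0' dg0' df10.
move=> y z; rewrite !lt_min.
move=> /andP[/andP[y1 y2] /andP[/andP[y3 y4] /andP[y5 y6]]].
move=> /andP[/andP[z1 z2] /andP[/andP[z3 z4] /andP[z5 z6]]].
move: (hdf _ _ y1 z1) (hdg _ _ y2 z2) (hdf' _ z3) (hdg' _ y4).
move: (hdf1 _ z5) (hdg1 _ y6).
rewrite mulmxDr -!scalemxAr [(_ + _ : 'M_1) _ _]mxE.
rewrite ![(_ *: _ : 'M_1) _ _]mxE.
have ha : modC (((y - z) *m A) ord0 ord0) <= opnorm A * norm1 (y - z).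
  by apply: le_trans (norm1_mulmx _ _); apply: modC_le_norm1.
have hb : modC (((y - z) *m B) ord0 ord0) <= opnorm B * norm1 (y - z).
  by apply: le_trans (norm1_mulmx _ _); apply: modC_le_norm1.
move: ha hb; move: (_ ord0 ord0) (_ ord0 ord0) (norm1_ge0 (y - z)) => b a.
move: (norm1 (y - z)) => v v0 ha hb h1 h2 h3 h4 h5 h6.
rewrite (_ : _ - _ = (f y - f z - a) * g y + a * (g y - g x) +
  f z * (g y - g z - b) + (f z - f x) * b); last by ring.
have gy : modC (g y) <= modC (g x) + 1.
  by have := modCD (g y - g x) (g x); rewrite subrK; lra.
have fz : modC (f z) <= modC (f x) + 1.
  by have := modCD (f z - f x) (f x); rewrite subrK; lra.
have -> : e * v = e / S * v * (modC (g x) + 1) + opnorm A * v * (e / S) +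
  (modC (f x) + 1) * (e / S * v) + e / S * (opnorm B * v).
  by rewrite /S; field; rewrite lt0r_neq0.
have le_mul (a1 a2 : K) (r1 r2 : R) :
    modC a1 <= r1 -> modC a2 <= r2 -> modC (a1 * a2) <= r1 * r2.
  by move=> *; rewrite modCM ler_pM // modC_ge0.
by do 3 (apply: le_trans (modCD _ _) _; apply: lerD; last by apply: le_mul => //;
  exact: ltW); apply: le_mul.
Qed.

Lemma sdiff1Z m (c : K) (f : 'rV[K]_m -> K) x A :
  sdiff1 f x A -> sdiff1 (fun y => c * f y) x (c *: A).
Proof.
by move=> hf; have := sdiff1M (sdiff1_cst c x) hf; rewrite scaler0 add0r.
Qed.

Lemma sdiff1_sum (I : finType) m (f : I -> 'rV[K]_m -> K) x A :
  (forall i, sdiff1 (f i) x (A i)) ->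
  sdiff1 (fun y => \sum_i f i y) x (\sum_i A i).
Proof.
move=> h; rewrite -[index_enum I]/(index_enum I).
elim: (index_enum I) => [|i s ih].
  rewrite big_nil (_ : (fun _ => _) = (fun=> 0)); first exact: sdiff1_cst.
  by apply/funext => y; rewrite big_nil.
rewrite big_cons (_ : (fun _ => _) = (fun y => f i y + \sum_(j <- s) f j y)).
  exact: sdiff1D.
by apply/funext => y; rewrite big_cons.
Qed.

(** The iteration x + (w - f x), started at [q]: the defect halves at each step, so the iterates
    stay within twice the initial defect [c] of [q] and converge geometrically. *)
Lemma sdiff_near_id n (f : 'rV[K]_n -> 'rV[K]_n) (q : 'rV[K]_n) (r : R)
    (w : 'rV[K]_n) : 0 < r ->
  (forall y z, norm1 (y - q) < r -> norm1 (z - q) < r ->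
     norm1 (f y - f z - (y - z)) <= 2^-1 * norm1 (y - z)) ->
  2 * norm1 (w - f q) < r ->
  exists x, norm1 (x - q) < r /\ f x = w.
Proof.
move=> r0 hf hw; set c := norm1 (w - f q) in hw.
have c0 : 0 <= c := norm1_ge0 _.
pose x := fix x k := if k is k'.+1 then x k' + (w - f (x k')) else q.
have p2 k : 0 < 2 ^+ k :> R by rewrite exprn_gt0.
have inv k : norm1 (x k - q) <= 2 * c * (1 - (2 ^+ k)^-1) /\
             norm1 (w - f (x k)) <= c / 2 ^+ k.
  elim: k => [|k [ih1 ih2]].
    by rewrite /= subrr norm1_0 expr0 invr1 subrr mulr0 mulr1.
  have t0 : 0 < (2 ^+ k)^-1 :> R by rewrite invr_gt0.
  have e2 : (2 ^+ k.+1)^-1 = 2^-1 * (2 ^+ k)^-1 :> R by rewrite exprS invfM.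
  have h1 : norm1 (x k.+1 - q) <= 2 * c * (1 - (2 ^+ k.+1)^-1).
    rewrite /= addrAC; apply: le_trans (norm1D _ _) _; rewrite e2.
    by move: ih1 ih2; move: ((2 ^+ k)^-1) => t h1 h2; lra.
  have small k' t : norm1 (x k' - q) <= 2 * c * (1 - t) -> 0 < t ->
      norm1 (x k' - q) < r.
    move=> h t1; apply: le_lt_trans h _; apply: le_lt_trans hw.
    by rewrite -[leRHS]mulr1 ler_wpM2l ?mulr_ge0 //; lra.
  split=> //.
  have t1 : 0 < (2 ^+ k.+1)^-1 :> R by rewrite invr_gt0.
  have := hf _ _ (small _ _ h1 t1) (small _ _ ih1 t0).
  rewrite (_ : x k.+1 - x k = w - f (x k)); last by rewrite /= addrC addKr.
  rewrite -norm1N (_ : - _ = w - f (x k.+1)); last first.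
    by rewrite [x k.+1]lock !opprB addrA subrK -lock.
  move=> h; apply: le_trans h _; rewrite e2.
  by move: ih2; move: ((2 ^+ k)^-1) => t h2; lra.
have [l [D hl]] : exists l D, forall k, norm1 (x k - l) <= D / 2 ^+ k.
  apply: (@geometric_limit _ _ c) => k; rewrite /= addrAC subrr add0r.
  by have [] := inv k.
exists l.
have hlq : norm1 (l - q) < r.
  rewrite ltNge; apply/negP => hr; pose e := r - 2 * c.
  have e0 : 0 < e by rewrite /e; lra.
  have [k hk] := geometric_small D e0.
  have := norm1_tri l (x k) q; rewrite (norm1_dist l (x k)).
  have := hl k; have [h _] := inv k.
  have t1 : 0 < (2 ^+ k)^-1 :> R by rewrite invr_gt0.
  have : 2 * c * (1 - (2 ^+ k)^-1) <= 2 * c.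
    by rewrite -[leRHS]mulr1 ler_wpM2l ?mulr_ge0 //; lra.
  by rewrite /e in hk; lra.
split=> //; apply/eqP; rewrite -subr_eq0; apply/eqP; apply: norm1_eq0; apply/eqP.
rewrite eq_le norm1_ge0 andbT leNgt; apply/negP => h0.
(* Near [q] the map has Lipschitz constant 3/2, so for every k the defect at the limit is at most
   [c + 3 / 2 * D] divided by 2^k. *)
have [k] := geometric_small (c + 3 / 2 * D) h0; apply/negP; rewrite -leNgt.
have hk : norm1 (x k - q) < r.
  have [h _] := inv k; apply: le_lt_trans h _; apply: le_lt_trans hw.
  have : 0 < (2 ^+ k)^-1 :> R by rewrite invr_gt0.
  by move=> ?; rewrite -[leRHS]mulr1 ler_wpM2l ?mulr_ge0 //; lra.
have h1 := hf _ _ hlq hk; have h2 := hl k; have [_ h3] := inv k.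
have h4 := norm1_tri (f l) (f (x k)) w.
have h5 := norm1D (f l - f (x k) - (l - x k)) (l - x k).
move: h4 h1 h2 h3 h5; rewrite subrK (norm1_dist (f (x k))) (norm1_dist l).
by rewrite mulrDl -(mulrA (3 / 2)); move: (D / 2 ^+ k) (c / 2 ^+ k) => *; lra.
Qed.

Lemma sdiff_perturbation n (f : 'rV[K]_n -> 'rV[K]_n) (q : 'rV[K]_n)
    (A : 'M[K]_n) : sdiff f q A -> A \in unitmx ->
  exists r : R, 0 < r /\ forall y z, norm1 (y - q) < r -> norm1 (z - q) < r ->
    norm1 (f y *m invmx A - f z *m invmx A - (y - z)) <= 2^-1 * norm1 (y - z).
Proof.
move=> hf uA; set B := invmx A; have B0 : 0 < opnorm B + 1.
  by have := opnorm_ge0 B; lra.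
have e0 : 0 < (2 * (opnorm B + 1))^-1 by rewrite invr_gt0 mulr_gt0.
have [r [r0 hr]] := hf _ e0; exists r; split=> // y z hy hz.
have -> : f y *m B - f z *m B - (y - z) = (f y - f z - (y - z) *m A) *m B.
  by rewrite !(mulmxBl _ (_ *m A)) mulmxK // mulmxBl.
apply: le_trans (norm1_mulmx _ _) _.
apply: (@le_trans _ _ ((opnorm B + 1) * ((2 * (opnorm B + 1))^-1 * norm1 (y - z)))).
  apply: ler_pM; rewrite ?norm1_ge0 ?opnorm_ge0 //; first by lra.
  exact: hr.
by rewrite le_eqVlt; apply/orP; left; apply/eqP; field; rewrite lt0r_neq0.
Qed.

(** In the direction of a kernel vector of [A] the increments of [f] would be of smaller order than
    those of the argument, against the lower bound. *)
Lemma sdiff_unit n (f : 'rV[K]_n -> 'rV[K]_n) (z : 'rV[K]_n) (A : 'M[K]_n)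
    (C : R) : sdiff f z A -> 0 <= C ->
  nbhd z (fun y => norm1 (y - z) <= C * norm1 (f y - f z)) -> A \in unitmx.
Proof.
move=> hf C0 [d [d0 hd]].
suff inj (v : 'rV[K]_n) : v *m A = 0 -> v = 0.
  rewrite -row_free_unit -kermx_eq0; apply/eqP/row_matrixP => i.
  by rewrite row0; apply: inj; rewrite -row_mul mulmx_ker row0.
move=> vA; apply: norm1_eq0; apply/eqP; rewrite eq_le norm1_ge0 andbT leNgt.
apply/negP => v0.
have e0 : 0 < (2 * (C + 1))^-1 by rewrite invr_gt0 mulr_gt0 //; lra.
have [d' [d0' hd']] := hf _ e0.
set m := Order.min d d'; have m0 : 0 < m by rewrite lt_min d0.
pose t := m / 2 / norm1 v; have t0 : 0 < t by rewrite !divr_gt0.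
have nt : norm1 (z + t%:C%C *: v - z) = m / 2.
  rewrite addrAC subrr add0r /norm1.
  rewrite (eq_bigr (fun j => t * modC (v ord0 j))) => [|j _].
    by rewrite -mulr_sumr -/(norm1 v) /t divfK // lt0r_neq0.
  by rewrite mxE modCM; congr (_ * _); rewrite /modC normc_def /= expr0n addr0
    sqrtr_sqr gtr0_norm.
have mm : m / 2 < m by lra.
have [md md'] : m <= d /\ m <= d' by rewrite !ge_min !lexx orbT.
have h1 := hd (z + t%:C%C *: v); have h2 := hd' (z + t%:C%C *: v) z.
move: h1 h2; rewrite nt subrr norm1_0 => /(_ (lt_le_trans mm md)) h1.
move/(_ (lt_le_trans mm md') d0').
rewrite [_ + _ - z]addrAC subrr add0r -scalemxAl vA scaler0 subr0 => h2.
have : m / 2 <= C * ((2 * (C + 1))^-1 * (m / 2)).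
  apply: le_trans h1 _; rewrite ler_wpM2l // (le_trans h2) //.
rewrite mulrA ler_pMl ?divr_gt0 // ler_pdivlMr ?mulr_gt0 //; lra.
Qed.

(** On the ball [U] the map composed with the inverse of [A] differs from the identity by a map of
    Lipschitz constant 1/2. This gives a lower Lipschitz bound, hence injectivity and, by
    [sdiff_unit], invertible differentials on all of [U]; [sdiff_near_id] makes the image open. The
    property [O] is carried along to control how small [U] is. *)
Theorem inverse_function n (f : 'rV[K]_n -> 'rV[K]_n) (q : 'rV[K]_n)
    (A : 'M[K]_n) (O : 'rV[K]_n -> Prop) :
  sdiff f q A -> A \in unitmx ->
  nbhd q (fun y => O y /\ exists B, sdiff f y B) ->
  exists U s, [/\ open1 U, U q,
    open1 (fun w => exists z, U z /\ f z = w),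
    forall z, U z -> [/\ O z, s (f z) = z & exists B, sdiff f z B]
  & forall z B, U z -> sdiff f z B ->
      B \in unitmx /\ sdiff s (f z) (invmx B)].
Proof.
move=> hf uA hO; have [r1 [r10 hr1]] := sdiff_perturbation hf uA.
have [r2 [r20 hr2]] := hO; set r := Order.min r1 r2.
have r0 : 0 < r by rewrite lt_min r10.
set iA := invmx A in hr1; pose g y := f y *m iA.
pose U y := norm1 (y - q) < r.
have gU y z : U y -> U z -> norm1 (g y - g z - (y - z)) <= 2^-1 * norm1 (y - z).
  by rewrite /U !lt_min => /andP[hy _] /andP[hz _]; apply: hr1.
have lipg y z : U y -> U z -> norm1 (y - z) <= 2 * norm1 (g y - g z).
  move=> hy hz; have := gU _ _ hy hz.
  have := norm1D (g y - g z) (- (g y - g z - (y - z))).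
  by rewrite norm1N subKr; move: (norm1 _) (norm1 _) => a b; lra.
have oU : open1 U by apply: open1_ball.
pose L := 2 * (opnorm iA + 1).
have L0 : 0 < L by rewrite /L; have := opnorm_ge0 iA; lra.
have lipf y z : U y -> U z -> norm1 (y - z) <= L * norm1 (f y - f z).
  move=> hy hz; apply: le_trans (lipg _ _ hy hz) _; rewrite /g -mulmxBl /L.
  rewrite -mulrA ler_wpM2l //; apply: le_trans (norm1_mulmx _ _) _.
  by rewrite ler_wpM2r ?norm1_ge0 //; lra.
pose s w := xget 0 [set z | U z /\ f z = w]%classic.
have sK z : U z -> s (f z) = z.
  move=> hz; have [h1 h2] : U (s (f z)) /\ f (s (f z)) = f z.
    by apply: (@xgetPex _ 0 [set y | U y /\ f y = f z]%classic); exists z.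
  apply/eqP; rewrite -subr_eq0; apply/eqP/norm1_eq0/eqP.
  by rewrite eq_le norm1_ge0 andbT (le_trans (lipf _ _ h1 hz)) // h2 subrr
    norm1_0 mulr0.
have oV : open1 (fun w => exists z, U z /\ f z = w).
  move=> _ [z [hz <-]]; have [d [d0 hd]] := oU z hz.
  exists (d / L); split=> [|w hw]; first exact: divr_gt0.
  have [x [hx gx]] : exists x, norm1 (x - z) < d /\ g x = w *m iA.
    apply: sdiff_near_id => // [y1 y2 /hd hy1 /hd hy2|]; first exact: gU.
    rewrite /g -mulmxBl; apply: le_lt_trans (_ : L * norm1 (w - f z) < d).
      rewrite /L -mulrA ler_wpM2l //; apply: le_trans (norm1_mulmx _ _) _.
      by rewrite ler_wpM2r ?norm1_ge0 //; lra.
    by rewrite mulrC -ltr_pdivlMr.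
  exists x; split; first exact: hd.
  by move: gx => /(congr1 (mulmx^~ A)); rewrite /g !mulmxKV.
exists U, s; split=> //; first by rewrite /U subrr norm1_0.
  move=> z hz; have [h1 h2] : O z /\ exists B, sdiff f z B.
    by apply: hr2; move: hz; rewrite /U lt_min => /andP[].
  by split=> //; apply: sK.
move=> z B hz hB.
have uB : B \in unitmx.
  apply: (sdiff_unit hB (ltW L0)).
  by apply: nbhd_mono (oU z hz) _ => y hy; apply: lipf.
split=> // e e0; pose M := L * (opnorm (invmx B) + 1).
have M0 : 0 < M by rewrite mulr_gt0 //; have := opnorm_ge0 (invmx B); lra.
have [d [d0 hd]] := hB _ (divr_gt0 e0 M0).
have [d' [d0' hd']] : nbhd (f z) (fun w => exists y,
    U y /\ f y = w) by apply: oV; exists z.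
exists (Order.min d' (d / L)); split; first by rewrite lt_min d0' divr_gt0.
move=> w1 w2; rewrite !lt_min => /andP[/hd' [y1 [u1 <-]] h1].
move=> /andP[/hd' [y2 [u2 <-]] h2]; rewrite !sK //.
have near y : U y -> norm1 (f y - f z) < d / L -> norm1 (y - z) < d.
  move=> hy h; apply: le_lt_trans (lipf _ _ hy hz) _.
  by rewrite mulrC -ltr_pdivlMr.
have := hd _ _ (near _ u1 h1) (near _ u2 h2) => h3.
have -> : y1 - y2 - (f y1 - f y2) *m invmx B =
    - ((f y1 - f y2 - (y1 - y2) *m B) *m invmx B).
  by rewrite (mulmxBl _ (_ *m B)) mulmxK // opprB.
rewrite norm1N; apply: le_trans (norm1_mulmx _ _) _.
apply: (@le_trans _ _
    ((opnorm (invmx B) + 1) * (e / M * (L * norm1 (f y1 - f y2))))).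
  apply: ler_pM; rewrite ?norm1_ge0 ?opnorm_ge0 //; first by lra.
  apply: le_trans h3 _; rewrite ler_wpM2l ?divr_ge0 ?(ltW e0) ?(ltW M0) //.
  exact: lipf.
rewrite le_eqVlt; apply/orP; left; apply/eqP; rewrite /M; field.
by rewrite !lt0r_neq0 //; have := opnorm_ge0 (invmx B); lra.
Qed.

End Norm.
End StrictDifferentiability.

(** * The implicit function theorem *)

Module ImplicitFunction.
Import StrictDifferentiability.
Section Implicit.
Variable R : realType.
Notation K := (R[i]).

Lemma norm1_row_mx m n (u : 'rV[K]_m) (v : 'rV[K]_n) :
  norm1 (row_mx u v) = norm1 u + norm1 v.
Proof.
rewrite /norm1 big_split_ord /=; congr (_ + _); apply: eq_bigr => j _.
  by rewrite row_mxEl.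
by rewrite row_mxEr.
Qed.

Lemma sdiff_row_mx m n p (f : 'rV[K]_m -> 'rV[K]_n) (g : 'rV[K]_m -> 'rV[K]_p)
    x A B : sdiff f x A -> sdiff g x B ->
  sdiff (fun y => row_mx (f y) (g y)) x (row_mx A B).
Proof.
move=> hf hg e e0; have e20 : 0 < e / 2 by rewrite divr_gt0.
have [d [d0 hd]] := hf _ e20; have [d' [d0' hd']] := hg _ e20.
exists (Order.min d d'); split; first by rewrite lt_min d0.
move=> y z; rewrite !lt_min => /andP[hy hy'] /andP[hz hz'].
rewrite mul_mx_row !(opp_row_mx, add_row_mx) norm1_row_mx.
by have := hd _ _ hy hz; have := hd' _ _ hy' hz'; lra.
Qed.

Lemma sdiff_mulmx m n (A : 'M[K]_(m, n)) (x : 'rV[K]_m) :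
  sdiff (fun y => y *m A) x A.
Proof.
by apply: sdiff_ext (sdiff_linear A 0 x); apply: nbhd_all => y; rewrite addr0.
Qed.

Lemma lsubmx_mulmx m n p (q : 'M[K]_(m, n + p)) :
  lsubmx q = q *m col_mx 1%:M 0.
Proof. by rewrite -{2}[q]hsubmxK mul_row_col mulmx1 mulmx0 addr0. Qed.

Lemma rsubmx_mulmx m n p (q : 'M[K]_(m, n + p)) :
  rsubmx q = q *m col_mx 0 1%:M.
Proof. by rewrite -{2}[q]hsubmxK mul_row_col mulmx1 mulmx0 add0r. Qed.

Lemma sdiff_lsubmx n p (q : 'rV[K]_(n + p)) :
  sdiff (fun y => lsubmx y) q (col_mx 1%:M 0).
Proof.
by apply: sdiff_ext (sdiff_mulmx _ q); apply: nbhd_all => y; rewrite lsubmx_mulmx.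
Qed.

Lemma sdiff_rsubmx n p (q : 'rV[K]_(n + p)) :
  sdiff (fun y => rsubmx y) q (col_mx 0 1%:M).
Proof.
by apply: sdiff_ext (sdiff_mulmx _ q); apply: nbhd_all => y; rewrite rsubmx_mulmx.
Qed.

Lemma sdiff_id n (q : 'rV[K]_n) : sdiff (fun y => y) q 1%:M.
Proof.
by apply: sdiff_ext (sdiff_mulmx _ q); apply: nbhd_all => y; rewrite mulmx1.
Qed.

(** The inverse function theorem for the map sending (y, x) to (y, G(y, x)). The radius [r] does not
    depend on [y]; this uniformity later identifies all singular points near a node. *)
Theorem implicit_function n k (G : 'rV[K]_(n + k) -> 'rV[K]_k)
    (y0 : 'rV[K]_n) (x0 : 'rV[K]_k) (A : 'M[K]_(n + k, k)) :
  (forall q, exists B, sdiff G q B) ->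
  sdiff G (row_mx y0 x0) A -> dsubmx A \in unitmx -> G (row_mx y0 x0) = 0 ->
  exists (phi : 'rV[K]_n -> 'rV[K]_k) (r : R), [/\ 0 < r, phi y0 = x0
    & nbhd y0 (fun y => [/\ exists B, sdiff phi y B,
        G (row_mx y (phi y)) = 0
      & forall x, norm1 (x - x0) < r -> 
          (G (row_mx y x) = 0 -> x = phi y) /\
          forall B, sdiff G (row_mx y x) B -> dsubmx B \in unitmx])].
Proof.
move=> dG hA uA G0; pose f q := row_mx (lsubmx q) (G q).
pose J (B : 'M[K]_(n + k, k)) : 'M[K]_(n + k) := row_mx (col_mx 1%:M 0) B.
have uJ B : (J B \in unitmx) = (dsubmx B \in unitmx).
  rewrite /J -{1}[B]vsubmxK -block_mxEh !unitmxE det_ublock det1.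
  by rewrite mul1r.
have hf q B : sdiff G q B -> sdiff f q (J B).
  by move=> hB; apply: sdiff_row_mx hB; apply: sdiff_lsubmx.
have uJA : J A \in unitmx by rewrite uJ.
have [|U [s [oU Uq oV hU hs]]] := inverse_function (O := fun=> True) (hf _ _ hA) uJA.
  by apply: nbhd_all => q; split=> //; have [B hB] := dG q; exists (J B); apply: hf.
have f0 : f (row_mx y0 x0) = row_mx y0 0 by rewrite /f row_mxKl G0.
have [d [d0 hd]] := oU _ Uq.
exists (fun y => rsubmx (s (row_mx y 0))), (d / 2).
have near y : norm1 (row_mx y 0 - row_mx y0 (0 : 'rV[K]_k)) = norm1 (y - y0).
  by rewrite opp_row_mx add_row_mx norm1_row_mx subrr norm1_0 addr0.
split; first exact: divr_gt0.
  by rewrite -f0; have [_ -> _] := hU _ Uq; rewrite row_mxKr.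
have h1 : nbhd y0 (fun y => exists q, U q /\ f q = row_mx y 0).
  have [e [e0 he]] : nbhd (row_mx y0 0) (fun w => exists q, U q /\ f q = w).
    by apply: oV; exists (row_mx y0 x0).
  by exists e; split=> // y hy; apply: he; rewrite near.
apply: nbhd_mono (nbhdI h1 (nbhd_ball y0 (divr_gt0 d0 (ltr0Sn R 1)))) _.
move=> y [[q [Uq' fq]] hy].
have [_ sq [Bq hBq]] := hU _ Uq'.
have [lq Gq] : lsubmx q = y /\ G q = 0.
  by move: fq => /eq_row_mx [].
have eq : row_mx y (rsubmx (s (row_mx y 0))) = q.
  by rewrite -fq sq -lq hsubmxK.
split.
- have hs' : sdiff s (row_mx y 0) (invmx Bq).
    by rewrite -fq; have [] := hs _ _ Uq' hBq.
  have hl := sdiff_mulmx (row_mx 1%:M 0 : 'M[K]_(n, n + k)) y.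
  have el z : z *m row_mx 1%:M 0 = row_mx z 0 :> 'rV[K]_(n + k).
    by rewrite mul_mx_row mulmx1 mulmx0.
  have hl' : sdiff (fun z => row_mx z (0 : 'rV[K]_k)) y (row_mx 1%:M 0).
    by apply: sdiff_ext hl; apply: nbhd_all => z.
  exists (row_mx 1%:M 0 *m (invmx Bq *m col_mx 0 1%:M)).
  apply: (sdiff_comp (f := fun z => row_mx z (0 : 'rV[K]_k))
    (g := fun w => rsubmx (s w)) hl').
  exact: sdiff_comp hs' (sdiff_rsubmx _).
- by rewrite eq.
- move=> x hx; have Ux : U (row_mx y x).
    apply: hd; rewrite opp_row_mx add_row_mx norm1_row_mx.
    by rewrite [ltRHS]splitr ltrD.
  split=> [Gx|B hB].
    have fx : f (row_mx y x) = row_mx y 0 by rewrite /f row_mxKl Gx.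
    by have [_ sx _] := hU _ Ux; rewrite -fx sx row_mxKr.
  by have [+ _] := hs _ _ Ux (hf _ _ hB); rewrite uJ.
Qed.

End Implicit.
End ImplicitFunction.

(** * Differentials of polynomials and of linear families of polynomials *)

Module PolynomialMaps.
Import mpoly StrictDifferentiability ImplicitFunction.
Section Gradient.
Variable K : fieldType.

Definition pgrad n (p : {mpoly K[n]}) (x : 'rV[K]_n) : 'cV[K]_n :=
  \col_j eval_at p^`M(j) x.

Lemma eval_atD n (p q : {mpoly K[n]}) x :
  eval_at (p + q) x = eval_at p x + eval_at q x.
Proof. exact: mevalD. Qed.

Lemma eval_atM n (p q : {mpoly K[n]}) x :
  eval_at (p * q) x = eval_at p x * eval_at q x.
Proof. exact: mevalM. Qed.

Lemma eval_atZ n c (p : {mpoly K[n]}) x :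
  eval_at (c *: p) x = c * eval_at p x.
Proof. exact: mevalZ. Qed.

Lemma eval_atX n i (x : 'rV[K]_n) : eval_at 'X_i x = x ord0 i.
Proof. exact: mevalXU. Qed.

Lemma eval_atC n (c : K) (x : 'rV[K]_n) : eval_at c%:MP x = c.
Proof. exact: mevalC. Qed.

Lemma pgradC n c (x : 'rV[K]_n) : pgrad c%:MP x = 0.
Proof. by apply/colP => j; rewrite !mxE mderivC /eval_at meval0. Qed.

Lemma pgradD n (p q : {mpoly K[n]}) x :
  pgrad (p + q) x = pgrad p x + pgrad q x.
Proof. by apply/colP => j; rewrite !mxE mderivD eval_atD. Qed.

Lemma pgradZ n c (p : {mpoly K[n]}) x : pgrad (c *: p) x = c *: pgrad p x.
Proof. by apply/colP => j; rewrite !mxE mderivZ eval_atZ. Qed.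

Lemma pgradM n (p q : {mpoly K[n]}) x :
  pgrad (p * q) x = eval_at q x *: pgrad p x + eval_at p x *: pgrad q x.
Proof.
apply/colP => j; rewrite !mxE mderivM eval_atD !eval_atM.
by rewrite [_ * eval_at q x]mulrC.
Qed.

Lemma pgradX n (i : 'I_n) (x : 'rV[K]_n) : pgrad 'X_i x = delta_mx i ord0.
Proof.
apply/colP => j; rewrite !mxE mderivX mnm1E eqxx andbT eq_sym.
case: eqVneq => [->|ij]; last by rewrite mulr0n scale0r /eval_at meval0.
rewrite mulr1n scale1r (_ : (_ - _)%MM = 0%MM) ?mpolyX0 /eval_at ?meval1 //.
by apply/mnmP => k; rewrite mnmBE mnm0E subnn.
Qed.

Lemma sum_col_mx (I : finType) m n (A : I -> 'cV[K]_m) (B : I -> 'cV[K]_n) :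
  \sum_i col_mx (A i) (B i) = col_mx (\sum_i A i) (\sum_i B i).
Proof.
elim/big_rec3: _ => [|i y z _ _ ->]; first by rewrite col_mx0.
by rewrite add_col_mx.
Qed.

Lemma sum_lift n (i : 'I_n.+1) (c : 'I_n.+1 -> K) :
  \sum_j c j *: \col_a (j == lift i a)%:R = \col_a c (lift i a).
Proof.
apply/colP => a; rewrite summxE [RHS]mxE (bigD1 (lift i a)) //= !mxE eqxx mulr1.
by rewrite big1 ?addr0 // => j ja; rewrite !mxE (negPf ja) mulr0.
Qed.

Lemma delta_lift n k (i : 'I_n.+1) a :
  delta_mx (lshift k a) ord0 =
  col_mx (\col_b (lift i a == lift i b)%:R) 0 :> 'cV[K]_(n + k).
Proof.
apply/colP => b; case: (split_ordP b) => b' ->.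
  rewrite col_mxEu !mxE (inj_eq (@lift_inj _ i)) (inj_eq (@lshift_inj _ _)).
  by rewrite eqxx andbT eq_sym.
by rewrite col_mxEd !mxE eq_rlshift.
Qed.

End Gradient.

Section Polynomial.
Variable R : realType.
Notation K := (R[i]).

Lemma sdiff1_ext m (f g : 'rV[K]_m -> K) x A B :
  (forall y, f y = g y) -> A = B -> sdiff1 f x A -> sdiff1 g x B.
Proof. by move=> /funext <- <-. Qed.

Lemma sdiff1_eval n (p : {mpoly K[n]}) (x : 'rV[K]_n) :
  sdiff1 (eval_at p) x (pgrad p x).
Proof.
have hC (c : K) : sdiff1 (eval_at c%:MP_[n]) x (pgrad c%:MP x).
  rewrite pgradC; apply: sdiff1_ext (sdiff1_cst c x) => // y.
  by rewrite eval_atC.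
elim/mpolyind: p => [|c m p _ _ ih]; first exact: (hC 0).
rewrite pgradD.
have hcX : sdiff1 (eval_at (c *: 'X_[m])) x (pgrad (c *: 'X_[m]) x).
  rewrite pgradZ.
  apply: (sdiff1_ext (f := fun y => c * eval_at 'X_[m] y) (fun y => esym (eval_atZ c _ y)) erefl).
  apply: sdiff1Z; rewrite mpolyXE_id.
  elim/big_rec: _ => [|i q _ ihq]; first exact: (hC 1).
  elim: (m i) => [|k ihk]; first by rewrite expr0 mul1r.
  rewrite exprS -mulrA pgradM pgradX.
  apply: (sdiff1_ext (f := fun y => y ord0 i * eval_at ('X_i ^+ k * q) y)
    _ _ (sdiff1M (sdiff1_coord i x) ihk)) => [y|].
    by rewrite [RHS]eval_atM eval_atX.
  by rewrite (eval_atX i).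
exact: (sdiff1_ext (fun y => esym (eval_atD _ p y)) erefl (sdiff1D hcX ih)).
Qed.

Lemma sdiff1_family n k (i : 'I_n.+1) (p : 'I_n.+1 -> {mpoly K[k]})
    (q : 'rV[K]_(n + k)) :
  sdiff1 (fun q => \sum_j affine_vec i (lsubmx q) ord0 j *
                          eval_at (p j) (rsubmx q)) q
    (col_mx (\col_a eval_at (p (lift i a)) (rsubmx q))
            (\sum_j affine_vec i (lsubmx q) ord0 j *: pgrad (p j) (rsubmx q))).
Proof.
have haff j : sdiff1 (fun q : 'rV[K]_(n + k) => affine_vec i (lsubmx q) ord0 j) q
    (col_mx (\col_a (j == lift i a)%:R) 0).
  case: (unliftP i j) => [a|] ej.
    rewrite ej -delta_lift.
    apply: (sdiff1_ext _ _ (sdiff1_coord (lshift k a) q)) => // y.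
    by rewrite !mxE liftK mxE.
  apply: (sdiff1_ext _ _ (sdiff1_cst 1 q)) => [y|].
    by rewrite ej !mxE unlift_none.
  rewrite ej -[LHS](col_mx0 _ n k); congr col_mx.
  by apply/colP => a; rewrite !mxE (negPf (neq_lift _ _)).
have hp j : sdiff1 (fun q => eval_at (p j) (rsubmx q)) q
    (col_mx 0 (pgrad (p j) (rsubmx q))).
  have := sdiff1_comp (sdiff_rsubmx q) (sdiff1_eval (p j) (rsubmx q)).
  by rewrite mul_col_mx mul0mx mul1mx.
apply: (sdiff1_ext _ _ (sdiff1_sum (fun j => sdiff1M (haff j) (hp j)))) => //.
rewrite -(sum_lift i (fun j => eval_at (p j) (rsubmx q))) -sum_col_mx.
apply: eq_bigr => j _.
by rewrite !scale_col_mx !scaler0 add_col_mx addr0 add0r.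
Qed.

End Polynomial.
End PolynomialMaps.

(** * Deformation of a nondegenerate critical point and of its critical value *)

Module CriticalPoints.
Import mpoly StrictDifferentiability ImplicitFunction PolynomialMaps.

Section Family.
Variables (K : fieldType) (n k : nat) (i : 'I_n.+1).

Definition family (p : 'I_n.+1 -> {mpoly K[k]}) (y : 'rV[K]_n) : {mpoly K[k]} :=
  \sum_j affine_vec i y ord0 j *: p j.

Lemma eval_family p y x :
  eval_at (family p y) x = \sum_j affine_vec i y ord0 j * eval_at (p j) x.
Proof.
rewrite /eval_at /family raddf_sum /=; apply: eq_bigr => j _; exact: mevalZ.
Qed.

Lemma mderiv_family p y a :
  (family p y)^`M(a) = family (fun j => (p j)^`M(a)) y.
Proof.
rewrite /family (linear_sum (mderiv a)); apply: eq_bigr => j _.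
exact: mderivZ.
Qed.

Lemma eval_family1 p y x a : eval_at (family p y)^`M(a) x =
  \sum_j affine_vec i y ord0 j * eval_at (p j)^`M(a) x.
Proof. by rewrite mderiv_family eval_family. Qed.

Lemma pgrad_family p y x :
  pgrad (family p y) x = \sum_j affine_vec i y ord0 j *: pgrad (p j) x.
Proof.
apply/colP => a; rewrite mxE eval_family1 summxE; apply: eq_bigr => j _.
by rewrite !mxE.
Qed.

Lemma hessian_family p y x : hessian (family p y) x =
  \matrix_(b, a) (\sum_j affine_vec i y ord0 j *: pgrad (p j)^`M(a) x) b ord0.
Proof.
apply/matrixP => b a; rewrite [LHS]mxE [RHS]mxE summxE mderiv_comm.
rewrite mderiv_family eval_family1.
by apply: eq_bigr => j _; rewrite !mxE.
Qed.

End Family.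

Section Deformation.
Variable R : realType.
Notation K := (R[i]).
Variables (n k : nat) (i : 'I_n.+1) (p : 'I_n.+1 -> {mpoly K[k]}).
Local Notation family := (family i p).

(** The implicit function theorem for the gradient. In the differential of the critical value the
    motion of the point drops out, because the point is critical; the derivative in the parameter
    remains, which is evaluation at [x0]. *)
Lemma critical_point_deformation (y0 : 'rV[K]_n) (x0 : 'rV[K]_k) :
  (forall a, eval_at (family y0)^`M(a) x0 = 0) ->
  \det (hessian (family y0) x0) != 0 ->
  exists (phi : 'rV[K]_n -> 'rV[K]_k) (r : R), [/\ 0 < r, phi y0 = x0,
    nbhd y0 (fun y => [/\ exists B, sdiff phi y B,
        exists B, sdiff1 (fun y => eval_at (family y) (phi y)) y B,
        forall a, eval_at (family y)^`M(a) (phi y) = 0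
      & forall x, norm1 (x - x0) < r ->
          ((forall a, eval_at (family y)^`M(a) x = 0) -> x = phi y) /\
          \det (hessian (family y) x) != 0])
  & sdiff1 (fun y => eval_at (family y) (phi y)) y0
      (\col_a eval_at (p (lift i a)) x0)].
Proof.
move=> crit hess.
pose G (q : 'rV[K]_(n + k)) : 'rV[K]_k := \row_a
  \sum_j affine_vec i (lsubmx q) ord0 j * eval_at (p j)^`M(a) (rsubmx q).
pose L (q : 'rV[K]_(n + k)) a : 'cV[K]_(n + k) :=
  col_mx (\col_b eval_at (p (lift i b))^`M(a) (rsubmx q))
    (\sum_j affine_vec i (lsubmx q) ord0 j *: pgrad (p j)^`M(a) (rsubmx q)).
pose B q : 'M[K]_(n + k, k) := \matrix_(b, a) L q a b ord0.
have hG q : sdiff G q (B q).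
  apply: sdiff_coords => a.
  apply: sdiff1_ext (sdiff1_family i (fun j => (p j)^`M(a)) q) => [y|].
    by rewrite mxE.
  by apply/colP => b; rewrite !mxE.
have dB y x : dsubmx (B (row_mx y x)) = hessian (family y) x.
  rewrite hessian_family; apply/matrixP => b a.
  by rewrite [LHS]mxE [LHS]mxE /L col_mxEd row_mxKl row_mxKr [RHS]mxE.
have GE y x : G (row_mx y x) = \row_a eval_at (family y)^`M(a) x.
  by apply/rowP => a; rewrite !mxE row_mxKl row_mxKr eval_family1.
have [||phi [r [r0 phi0 hphi]]] := @implicit_function R n k G y0 x0 (B (row_mx y0 x0))
    (fun q => ex_intro _ _ (hG q)) (hG _).
- by rewrite dB unitmxE unitfE.
- by rewrite GE; apply/rowP => a; rewrite !mxE.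
have dt y D : sdiff phi y D ->
    sdiff1 (fun y => eval_at (family y) (phi y)) y
      (row_mx 1%:M D *m col_mx (\col_a eval_at (p (lift i a)) (phi y))
         (pgrad (family y) (phi y))).
  move=> hD; have h1 := sdiff_row_mx (sdiff_id y) hD.
  have h2 := sdiff1_family i p (row_mx y (phi y)).
  have h3 := sdiff1_comp (f := fun z => row_mx z (phi z)) h1 h2.
  apply: sdiff1_ext h3 => [z|].
    by rewrite row_mxKl row_mxKr eval_family.
  by rewrite row_mxKl row_mxKr pgrad_family.
exists phi, r; split=> //; last first.
  have [[D hD] _ _] := nbhd_self hphi.
  have := dt _ _ hD; rewrite phi0 mul_row_col mul1mx.
  rewrite (_ : pgrad _ _ = 0) ?mulmx0 ?addr0 //.
  by apply/colP => a; rewrite !mxE crit.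
apply: nbhd_mono hphi _ => y [[D hD] Gy h].
have crity a : eval_at (family y)^`M(a) (phi y) = 0.
  by move: Gy; rewrite GE => /rowP/(_ a); rewrite !mxE.
split; [by exists D | | exact: crity | ].
  by exists (row_mx 1%:M D *m col_mx (\col_a eval_at (p (lift i a)) (phi y))
         (pgrad (family y) (phi y))); apply: dt.
move=> x hx; have [h1 h2] := h x hx; split.
  by move=> hc; apply: h1; rewrite GE; apply/rowP => a; rewrite !mxE.
by have := h2 _ (hG _); rewrite dB unitmxE unitfE.
Qed.

End Deformation.
End CriticalPoints.

(** * Singular points of nearby quartics are close to the nodes *)

Module NearbySingularities.
Import mpoly QuarticForms NodalQuartics NodeIndependence.
Import ProjectiveNullstellensatz JacobianIdeal ZariskiNodal.
Import StrictDifferentiability PolynomialMaps.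

Section Algebra.
Variable K : numClosedFieldType.

Lemma quartic_formB_deriv (h h' : 'rV[K]_35) v j :
  eval_at (quartic_form h)^`M(j) v - eval_at (quartic_form h')^`M(j) v =
  \sum_l (h - h') ord0 l * eval_at (veronese K l)^`M(j) v.
Proof.
have E g : eval_at (quartic_form g)^`M(j) v =
    \sum_l g ord0 l * eval_at (veronese K l)^`M(j) v.
  rewrite /quartic_form (linear_sum (mderiv j)) /eval_at raddf_sum /=.
  by apply: eq_bigr => l _; rewrite mderivZ mevalZ.
rewrite !E -sumrB; apply: eq_bigr => l _.
by rewrite !mxE mulrBl.
Qed.

Definition normalized (P : projspace K 3) (i : 'I_4) (k : 'I_4) : K :=
  hcoord P ord0 k / hcoord P ord0 i.

(* The left-hand side vanishes at the nodes, so it lies in the Jacobian ideal of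
   the quartic h0; the identity makes it small at the singular points of the
   nearby quartics h. *)
Lemma jacobian_products (h0 : 'rV[K]_35) m (P : 'I_m -> projspace K 3)
    (c : 'I_m -> 'I_4) :
  nodal (quartic_form h0) -> injective P ->
  (forall Q, singular_locus (quartic_form h0) Q <-> exists i, Q = P i) ->
  (forall i, hcoord (P i) ord0 (c i) != 0) ->
  forall (kappa : 'I_m -> 'I_4) (b : 'I_4),
  exists D (u : 'I_4 -> {mpoly K[4]}), forall h v,
    (forall j, eval_at (quartic_form h)^`M(j) v = 0) ->
    \prod_i (v ord0 (kappa i) - normalized (P i) (c i) (kappa i) * v ord0 (c i))
      * v ord0 b ^+ D =
    \sum_j eval_at (u j) v *
      \sum_l (h0 - h) ord0 l * eval_at (veronese K l)^`M(j) v.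
Proof.
move=> nod Pinj Psing hc kappa b.
have [D hD] := jacobian_saturated (quartic_form_homog h0) nod Pinj Psing.
pose l i : {mpoly K[4]} :=
  'X_(kappa i) - normalized (P i) (c i) (kappa i) *: 'X_(c i).
have lE i v : eval_at (l i) v =
    v ord0 (kappa i) - normalized (P i) (c i) (kappa i) * v ord0 (c i).
  by rewrite /eval_at mevalB mevalZ !mevalXU.
pose G := \prod_i l i * 'X_b ^+ D.
have Ghom : G \is (m + D).-homog.
  apply: dhomogM.
    rewrite -[m in m.-homog]card_ord -sum1_card.
    elim/big_rec2: _ => [|i q d _ hq]; first exact: dhomog1.
    by apply: dhomogM; rewrite ?rpredB ?rpredZ // dhomog_X.
  by have := dhomogMn D (dhomog_X K b); rewrite mul1n.
have GE v : eval_at G v = \prod_i (v ord0 (kappa i) -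
    normalized (P i) (c i) (kappa i) * v ord0 (c i)) * v ord0 b ^+ D.
  rewrite /eval_at mevalM rmorphXn /= mevalXU rmorph_prod /=; congr (_ * _).
  by apply: eq_bigr => i _; rewrite -lE.
have [|i|u _ Gu] := hD (m + D)%N G _ Ghom; first exact: leq_addl.
  rewrite GE (bigD1 i) //= /normalized divfK ?subrr ?mul0r //.
exists D, u => h v hv; rewrite -GE Gu /eval_at raddf_sum /=.
apply: eq_bigr => j _; rewrite mevalM -/(eval_at _ _); congr (_ * _).
by rewrite -quartic_formB_deriv hv subr0.
Qed.

End Algebra.

Section Bounds.
Variable R : realType.
Notation K := (R[i]).

Definition in_polydisc n (v : 'rV[K]_n) : Prop := forall k, modC (v ord0 k) <= 1.

Lemma eval_bounded n (p : {mpoly K[n]}) :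
  exists C, 0 <= C /\ forall v, in_polydisc v -> modC (eval_at p v) <= C.
Proof.
exists (\sum_(m <- msupp p) modC p@_m); split.
  by apply: sumr_ge0 => m _; apply: modC_ge0.
move=> v hv; rewrite /eval_at mevalE; apply: le_trans (modC_sum _ _ _) _.
apply: ler_sum => m _; rewrite modCM ler_piMr ?modC_ge0 // modC_prod.
apply: prodr_ile1 => i _; rewrite modC_ge0 /=.
elim: (m i) => [|k ih]; first by rewrite expr0 modC1.
by rewrite exprS modCM mulr_ile1 ?modC_ge0 //; apply: hv.
Qed.

(** On the unit polydisc the polynomials in [jacobian_products] are bounded; adding the bounds over
    the finitely many [kappa] and [b] makes the constant uniform. *)
Lemma singular_products (h0 : 'rV[K]_35) m (P : 'I_m -> projspace K 3)
    (c : 'I_m -> 'I_4) :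
  nodal (quartic_form h0) -> injective P ->
  (forall Q, singular_locus (quartic_form h0) Q <-> exists i, Q = P i) ->
  (forall i, hcoord (P i) ord0 (c i) != 0) ->
  exists C, 0 <= C /\ forall (kappa : 'I_m -> 'I_4) (b : 'I_4) h v,
    in_polydisc v -> v ord0 b = 1 ->
    (forall j, eval_at (quartic_form h)^`M(j) v = 0) ->
    \prod_i modC (v ord0 (kappa i) -
      normalized (P i) (c i) (kappa i) * v ord0 (c i)) <= C * norm1 (h0 - h).
Proof.
move=> nod Pinj Psing hc.
have J := jacobian_products nod Pinj Psing hc.
have /choice [C hC] : forall kb : {ffun 'I_m -> 'I_4} * 'I_4,
    exists C, 0 <= C /\ forall h v,
    in_polydisc v -> v ord0 kb.2 = 1 ->
    (forall j, eval_at (quartic_form h)^`M(j) v = 0) ->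
    \prod_i modC (v ord0 (kb.1 i) -
      normalized (P i) (c i) (kb.1 i) * v ord0 (c i)) <= C * norm1 (h0 - h).
  move=> [kappa b] /=; have [D [u hu]] := J kappa b.
  have /choice [Cu hCu] := fun j => eval_bounded (u j).
  have /choice [Cv hCv] : forall jl : 'I_4 * 'I_35, exists C, 0 <= C /\
      forall v, in_polydisc v ->
        modC (eval_at (veronese K jl.2)^`M(jl.1) v) <= C.
    by move=> jl; apply: eval_bounded.
  exists (\sum_j Cu j * \sum_l Cv (j, l)); split.
    apply: sumr_ge0 => j _; apply: mulr_ge0; first by have [] := hCu j.
    by apply: sumr_ge0 => l _; have [] := hCv (j, l).
  move=> h v hv vb hs; have := hu h v hs; rewrite vb expr1n mulr1 => E.
  rewrite -modC_prod E; apply: le_trans (modC_sum _ _ _) _.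
  rewrite mulr_suml; apply: ler_sum => j _; rewrite modCM -mulrA.
  apply: ler_pM; rewrite ?modC_ge0 //; first by have [_] := hCu j; apply.
  apply: le_trans (modC_sum _ _ _) _; rewrite mulr_suml.
  apply: ler_sum => l _; rewrite modCM mulrC.
  apply: ler_pM; rewrite ?modC_ge0 //; first by have [_] := hCv (j, l); apply.
  exact: modC_le_norm1.
exists (\sum_kb C kb); split; first by apply: sumr_ge0 => kb _; have [] := hC kb.
move=> kappa b h v hv vb hs.
have [_ /(_ h v hv vb hs)] := hC ([ffun i => kappa i], b).
rewrite (eq_bigr (fun i => modC (v ord0 (kappa i) -
  normalized (P i) (c i) (kappa i) * v ord0 (c i)))) => [le1|i _]; last first.
  by rewrite /= ffunE.
apply: le_trans le1 _; rewrite ler_wpM2r ?norm1_ge0 //.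
rewrite (bigD1 ([ffun i => kappa i], b)) //= lerDl.
by apply: sumr_ge0 => kb _; have [] := hC kb.
Qed.

(** Division by a coordinate of largest modulus brings every projective point into the polydisc,
    which takes the place of compactness. *)
Lemma max_coord n (v : 'rV[K]_n) : v != 0 ->
  exists b, v ord0 b != 0 /\ in_polydisc ((v ord0 b)^-1 *: v).
Proof.
move=> /rV0Pn [b0 vb0].
case: (@arg_maxP _ _ _ b0 xpredT (fun b => modC (v ord0 b)) isT) => b _ hb.
have vb : v ord0 b != 0.
  apply: contraNneq vb0 => vb; apply/eqP/modC_eq0/eqP.
  rewrite eq_le modC_ge0 andbT; apply: le_trans (hb b0 erefl) _.
  by rewrite vb modC0.
exists b; split=> // k; rewrite mxE modCM.
have := modCM (v ord0 b)^-1 (v ord0 b); rewrite mulVf // modC1 => e.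
by rewrite e ler_wpM2l ?modC_ge0 //; apply: hb.
Qed.

(** If for every [i] some coordinate [kappa i] of the singular point differed by at least [eta] from
    that of [P i], the product in [singular_products] would be at least eta^m, too large for a
    nearby quartic. *)
Lemma singular_near (h0 : 'rV[K]_35) m (P : 'I_m -> projspace K 3)
    (c : 'I_m -> 'I_4) (r : R) :
  nodal (quartic_form h0) -> injective P ->
  (forall Q, singular_locus (quartic_form h0) Q <-> exists i, Q = P i) ->
  (forall i, hcoord (P i) ord0 (c i) != 0) -> 0 < r ->
  nbhd h0 (fun h => forall Q, singular_locus (quartic_form h) Q ->
    exists i, hcoord Q ord0 (c i) != 0 /\
      norm1 (affine_coord (c i) Q - affine_coord (c i) (P i)) < r).
Proof.
move=> nod Pinj Psing hc r0.
have [C [C0 hC]] := singular_products nod Pinj Psing hc.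
pose W := 1 + \sum_i \sum_k modC (normalized (P i) (c i) k).
have W1 : 1 <= W.
  by rewrite lerDl; apply: sumr_ge0 => i _; apply: sumr_ge0 => k _; apply: modC_ge0.
have leW i k : modC (normalized (P i) (c i) k) <= W.
  rewrite /W (bigD1 i) //= (bigD1 k) //=.
  have h1 : 0 <= \sum_(j | j != k) modC (normalized (P i) (c i) j).
    by apply: sumr_ge0 => j _; apply: modC_ge0.
  have h2 : 0 <= \sum_(j | j != i) \sum_k modC (normalized (P j) (c j) k).
    by apply: sumr_ge0 => j _; apply: sumr_ge0 => k' _; apply: modC_ge0.
  by move: h1 h2; move: (\sum_(_ | _) _) (\sum_(_ | _) _) (modC _) => a1 a2 a3; lra.
(* The bound 1/2 forces coordinate [c i] of [v] to have modulus above 1 / (2 W), since [v] has a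
   coordinate 1. Then r / (8 W) bounds the error in each of the three affine coordinates by r /
   4. *)
pose eta := Order.min 2^-1 (r / (8 * W)).
have W0 : 0 < W by lra.
have eta0 : 0 < eta by rewrite lt_min invr_gt0 ltr0n divr_gt0 // mulr_gt0.
exists (eta ^+ m / (C + 1)); split.
  by rewrite divr_gt0 ?exprn_gt0 //; lra.
move=> h hh Q /(singular_locusP (quartic_form_homog h)) Qs.
have [b [vb hv]] := max_coord (hcoord_neq0 Q).
set v := _ *: _ in hv.
have vb1 : v ord0 b = 1 by rewrite mxE mulVf.
have vs j : eval_at (quartic_form h)^`M(j) v = 0.
  by rewrite (eval_at_scale _ _ (mderiv_homog j (quartic_form_homog h))) Qs mulr0.
have [i hi] : exists i, forall k,
    modC (v ord0 k - normalized (P i) (c i) k * v ord0 (c i)) < eta.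
  apply: contrapT => hno.
  have /choice [kappa hk] : forall i, exists k,
      eta <= modC (v ord0 k - normalized (P i) (c i) k * v ord0 (c i)).
    move=> i; apply: contrapT => hk; apply: hno; exists i => k.
    by rewrite ltNge; apply/negP => ?; apply: hk; exists k.
  have := hC kappa b h v hv vb1 vs; rewrite norm1_dist.
  have : eta ^+ m <= \prod_i modC (v ord0 (kappa i) -
      normalized (P i) (c i) (kappa i) * v ord0 (c i)).
    rewrite -[m in _ ^+ m]card_ord -prodr_const; apply: ler_prod => i _.
    by rewrite (ltW eta0) hk.
  move=> h1 h2; have := le_trans h1 h2.
  move: hh; rewrite ltr_pdivlMr; last by lra.
  by have := norm1_ge0 (h - h0); move: (norm1 _) => t; lra.
exists i.
have e12 : eta <= 2^-1 /\ eta <= r / (8 * W) by rewrite !ge_min !lexx orbT.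
have hbi : 1 < 2 * W * modC (v ord0 (c i)).
  have := hi b; rewrite vb1; set w := normalized _ _ _ => hb.
  have := modCD (1 - w * v ord0 (c i)) (w * v ord0 (c i)); rewrite subrK modC1 modCM.
  have : modC w * modC (v ord0 (c i)) <= W * modC (v ord0 (c i)).
    by rewrite ler_wpM2r ?modC_ge0 // leW.
  by move: hb e12.1; rewrite -mulrA; lra.
have vc : v ord0 (c i) != 0.
  by apply: contraTneq hbi => ->; rewrite modC0 mulr0 -leNgt ler01.
have Qc : hcoord Q ord0 (c i) != 0.
  by apply: contraNneq vc => Qc; rewrite mxE Qc mulr0.
split=> //.
have mvc : 0 < modC (v ord0 (c i)) by apply: modC_gt0.
have hk k : modC ((affine_coord (c i) Q - affine_coord (c i) (P i)) ord0 k) <= r / 4.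
  rewrite !mxE -/(normalized (P i) (c i) (lift (c i) k)).
  have -> : hcoord Q ord0 (lift (c i) k) / hcoord Q ord0 (c i) =
      v ord0 (lift (c i) k) / v ord0 (c i).
    by rewrite !mxE invfM invrK mulrACA mulVf ?mul1r.
  rewrite -(ler_pM2r mvc) -modCM mulrBl divfK //.
  apply: le_trans (ltW (hi _)) _; apply: le_trans e12.2 _.
  rewrite ler_pdivrMr ?mulr_gt0 //.
  have : r * 1 <= r * (2 * W * modC (v ord0 (c i))).
    by rewrite ler_pM2l // ltW.
  by move: (modC _) => t; lra.
apply: le_lt_trans (ler_sum _ (fun k _ => hk k)) _.
by rewrite sum_cst; lra.
Qed.

End Bounds.
End NearbySingularities.

(** * Local coordinates formed by the critical values at the nodes *)

Module LocalStructure.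
Import mpoly QuarticForms NodalQuartics NodeIndependence InfinitesimalSymmetry.
Import ProjectiveNullstellensatz JacobianIdeal ZariskiNodal.
Import StrictDifferentiability PolynomialMaps CriticalPoints NearbySingularities.

Section Charts.
Variable K : numClosedFieldType.

Lemma affine_chart_coord n i (Q : projspace K n) : hcoord Q ord0 i != 0 ->
  Q = affine_chart i (affine_coord i Q).
Proof.
move=> Qi; have [c c0 hc] := hcoord_line_of (affine_vec_neq0 i (affine_coord i Q)).
apply/esym/(@projspace_eq _ _ _ _ (c / hcoord Q ord0 i)).
by rewrite hc affine_vec_coord // scalerA.
Qed.

Lemma hcoord_chart_neq0 n i (x : 'rV[K]_n) : hcoord (affine_chart i x) ord0 i != 0.
Proof.
have [c c0 ->] := hcoord_line_of (affine_vec_neq0 i x).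
by rewrite !mxE unlift_none mulr1.
Qed.

Lemma affine_coord_chart n i (x : 'rV[K]_n) : affine_coord i (affine_chart i x) = x.
Proof.
apply/rowP => k; rewrite mxE.
have [c c0 ->] := hcoord_line_of (affine_vec_neq0 i x).
by rewrite !mxE unlift_none liftK mulr1 mulrC mulKf.
Qed.

Lemma singular_chart (F : {mpoly K[4]}) i (x : 'rV[K]_3) : F \is 4.-homog ->
  singular_locus F (affine_chart i x) <->
  eval_at (dehomogenize i F) x = 0 /\
  forall a, eval_at (dehomogenize i F)^`M(a) x = 0.
Proof.
move=> F4; rewrite singular_locusP //.
have [c c0 ->] := hcoord_line_of (affine_vec_neq0 i x).
set w := affine_vec i x.
have wi : w ord0 i = 1 by rewrite mxE unlift_none.
have scal j : eval_at F^`M(j) (c *: w) = c ^+ 3 * eval_at F^`M(j) w.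
  exact: (eval_at_scale _ _ (mderiv_homog j F4)).
have D a : eval_at (dehomogenize i F)^`M(a) x = eval_at F^`M(lift i a) w.
  by rewrite mderiv_dehomogenize eval_dehomogenize.
have eu := eval_euler w F4.
split=> [h|[h0 h]].
  have h' j : eval_at F^`M(j) w = 0.
    by have /eqP := h j; rewrite scal mulf_eq0 expf_eq0 (negPf c0) => /eqP.
  split=> [|a]; last by rewrite D.
  rewrite eval_dehomogenize; apply: (mulfI (_ : 4 != 0)).
    by rewrite pnatr_eq0.
  by rewrite -eu mulr0 big1 // => j _; rewrite h' mulr0.
suff h' j : eval_at F^`M(j) w = 0 by move=> j; rewrite scal h' mulr0.
have hl a : eval_at F^`M(lift i a) w = 0 by rewrite -D.
case: (unliftP i j) => [a|] -> //.
move: eu; rewrite -(eval_dehomogenize i F x) h0 mulr0 (bigD1_ord i) //= wi mul1r.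
by rewrite big1 ?addr0 // => a _; rewrite hl mulr0.
Qed.

Lemma node_chart (F : {mpoly K[4]}) i (x : 'rV[K]_3) : F \is 4.-homog ->
  singular_locus F (affine_chart i x) ->
  is_node F (affine_chart i x) <-> \det (hessian (dehomogenize i F) x) != 0.
Proof.
move=> F4 s; rewrite is_nodeP //.
have /(singular_locusP F4) h := s.
have := det_hess_chart F4 (hcoord_chart_neq0 i x) (affine_vec_coord (hcoord_chart_neq0 i x)) h.
by rewrite affine_coord_chart => ->.
Qed.

Lemma dehomogenize_family i0 i (y : 'rV[K]_34) :
  dehomogenize i (quartic_form (affine_vec i0 y)) =
  family i0 (fun j => dehomogenize i (veronese K j)) y.
Proof.
rewrite /dehomogenize /quartic_form /family raddf_sum /=.
by apply: eq_bigr => j _; rewrite comp_mpolyZ.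
Qed.

Lemma extend_columns n m (M : 'M[K]_(n, m)) :
  (forall c : 'cV_m, M *m c = 0 -> c = 0) ->
  exists (mn : (m <= n)%N) (B : 'M[K]_n), B \in unitmx /\
    forall a i, B a (widen_ord mn i) = M a i.
Proof.
move=> inj.
have fr : row_free M^T.
  rewrite -kermx_eq0; apply/eqP/row_matrixP => i; rewrite row0.
  apply: trmx_inj; rewrite trmx0; apply: inj; apply: trmx_inj.
  by rewrite trmx_mul trmxK -row_mul mulmx_ker row0 trmx0.
have mn : (m <= n)%N by rewrite -(eqP fr) rank_leq_col.
exists mn.
have E : (pid_mx m : 'M[K]_(m, n)) *m (pid_mx m *m M^T) = M^T.
  by rewrite mulmxA mul_pid_mx !minnn (minn_idPr mn) pid_mx_1 mul1mx.
have [|g gu Eg] := @complete_unitmx _ m n (pid_mx m) (pid_mx m *m M^T).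
  by rewrite E (eqP fr) rank_pid_mx.
exists g^T; split=> [|a i]; first by rewrite unitmx_tr.
rewrite mxE; have := congr1 (fun A : 'M_(m, n) => A i a) (etrans (esym E) Eg).
rewrite !mxE (bigD1 (widen_ord mn i)) //= !mxE eqxx ltn_ord mul1r big1 ?addr0 //.
move=> j ji; rewrite mxE; case: eqP => [e|_]; last by rewrite mul0r.
by case/eqP: ji; apply: val_inj.
Qed.

(** The parameters of the chart miss the monomial [i0]. Its coefficient is 1 and the quartic
    vanishes at the nodes, so a relation between the other evaluations extends to it. *)
Lemma evaluations_independent (i0 : 'I_35) (y0 : 'rV[K]_34) m
    (P : 'I_m -> projspace K 3) (c : 'I_m -> 'I_4) :
  nodal (quartic_form (affine_vec i0 y0)) -> injective P ->
  (forall i, singular_locus (quartic_form (affine_vec i0 y0)) (P i)) ->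
  (forall i, hcoord (P i) ord0 (c i) != 0) ->
  forall g : 'cV[K]_m, \matrix_(k < 34, i < m)
    eval_at (dehomogenize (c i) (veronese K (lift i0 k))) (affine_coord (c i) (P i)) *m g = 0
    -> g = 0.
Proof.
move=> nod Pinj Ps hc g; set M := \matrix_(_, _) _ => Mg.
have F4 := quartic_form_homog (affine_vec i0 y0).
pose w i := affine_vec (c i) (affine_coord (c i) (P i)).
pose V i j := eval_at (veronese K j) (w i).
have wP i : w i = (hcoord (P i) ord0 (c i))^-1 *: hcoord (P i).
  exact: affine_vec_coord.
have hl k : \sum_i V i (lift i0 k) * g i ord0 = 0.
  have -> : \sum_i V i (lift i0 k) * g i ord0 = (M *m g) k ord0.
    rewrite [RHS]mxE; apply: eq_bigr => i _.
    by rewrite [M k i]mxE eval_dehomogenize.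
  by rewrite Mg mxE.
have hi i : V i i0 = - \sum_k y0 ord0 k * V i (lift i0 k).
  have [e0 _] := Ps i.
  have : eval_at (quartic_form (affine_vec i0 y0)) (w i) = 0.
    by rewrite wP (eval_at_scale _ _ F4) e0 mulr0.
  rewrite /quartic_form /eval_at raddf_sum /= (bigD1_ord i0) //= mevalZ mxE unlift_none.
  rewrite mul1r => /eqP; rewrite addr_eq0 => /eqP e; rewrite /V /eval_at e; congr (- _).
  by apply: eq_bigr => k _; rewrite mevalZ mxE liftK.
have h0 : \sum_i V i i0 * g i ord0 = 0.
  under eq_bigr => i _ do rewrite hi mulNr mulr_suml.
  rewrite sumrN exchange_big /= big1 ?oppr0 // => k _.
  under eq_bigr => i _ do rewrite -mulrA.
  by rewrite -mulr_sumr hl mulr0.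
have hV j : \sum_i V i j * g i ord0 = 0.
  by case: (unliftP i0 j) => [k|] ->.
have := nodes_independent (c := fun i => g i ord0 * (hcoord (P i) ord0 (c i))^-1 ^+ 4)
  F4 nod Pinj Ps.
move=> hind; apply/colP => i; rewrite [RHS]mxE.
suff /hind/(_ i)/eqP : forall j, \sum_i g i ord0 *
    (hcoord (P i) ord0 (c i))^-1 ^+ 4 * eval_at (veronese K j) (hcoord (P i)) = 0.
  by rewrite mulf_eq0 expf_eq0 invr_eq0 (negPf (hc i)) andbF orbF => /eqP.
move=> j; rewrite -[RHS](hV j); apply: eq_bigr => i' _.
by rewrite /V wP (eval_at_scale _ _ (veronese_homog K j)) [RHS]mulrC [RHS]mulrA.
Qed.

End Charts.

Section Local.
Variable R : realType.
Notation K := (R[i]).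

(** The analogue of [analytic_coordinates] with strict differentials, to be translated by
    [coordinates_analytic]. *)
Definition coordinates n (q : 'rV[K]_n) (U : 'rV[K]_n -> Prop)
    (t : 'rV[K]_n -> 'rV[K]_n) : Prop :=
  [/\ open1 U, U q, t q = 0, forall z, U z -> exists B, sdiff t z B
    & exists s : 'rV[K]_n -> 'rV[K]_n,
        [/\ open1 (fun w => exists z, U z /\ t z = w),
            forall z, U z -> exists B, sdiff s (t z) B
          & forall z, U z -> s (t z) = z]].

(** Serves to recentre at a nearby point and to permute coordinates. The new image is open because
    the inverse is continuous. *)
Lemma coordinates_restrict n (q : 'rV[K]_n) U t (q' : 'rV[K]_n)
    (U' : 'rV[K]_n -> Prop) (A : 'M[K]_n) :
  coordinates q U t -> open1 U' -> (forall z, U' z -> U z) -> U' q' ->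
  A \in unitmx ->
  coordinates q' U' (fun z => (t z - t q') *m A).
Proof.
move=> [oU Uq tq dt [s [oV ds sK]]] oU' U'U Uq' uA.
have aff (B : 'M[K]_n) (b : 'rV[K]_n) (y : 'rV[K]_n) :
    sdiff (fun w => w *m B + b) y B by apply: sdiff_linear.
have iaff w : ((w - t q') *m A) *m invmx A + t q' = w.
  by rewrite mulmxK // subrK.
split=> // [|z Uz|]; first by rewrite subrr mul0mx.
  have [B hB] := dt z (U'U z Uz); exists (B *m A).
  have := sdiff_comp hB (aff A (- t q' *m A) (t z)).
  by apply: sdiff_ext; apply: nbhd_all => y; rewrite -mulmxDl.
pose s' w := s (w *m invmx A + t q').
have ds' z : U' z -> exists B, sdiff s' ((t z - t q') *m A) B.
  move=> Uz; have [B hB] := ds z (U'U z Uz); exists (invmx A *m B).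
  apply: (sdiff_comp (f := fun w => w *m invmx A + t q')) (aff _ _ _) _.
  by rewrite iaff.
exists s'; split=> // [|z Uz]; last by rewrite /s' iaff sK //; apply: U'U.
move=> w [z0 [Uz0 ew]].
have [B hB] := ds' z0 Uz0; rewrite ew in hB.
have s'w : s' w = z0 by rewrite /s' -ew iaff sK //; apply: U'U.
have n1 : nbhd w (fun w => U' (s' w)).
  by apply: sdiff_continuous hB _; rewrite s'w; apply: oU'.
have n2 : nbhd w (fun w => exists z, U z /\ t z = w *m invmx A + t q').
  apply: (sdiff_continuous (f := fun w => w *m invmx A + t q')
    (P := fun v => exists z, U z /\ t z = v) (aff _ _ w)).
  by apply: oV; exists z0; rewrite -ew iaff; split=> //; apply: U'U.
apply: nbhd_mono (nbhdI n1 n2) _ => v [hv [z [Uz tz]]]; exists z; split.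
  by move: hv; rewrite /s' -tz sK.
by rewrite tz addrK mulmxKV.
Qed.

Lemma norm1_affine_vec n (i : 'I_n.+1) (y z : 'rV[K]_n) :
  norm1 (affine_vec i y - affine_vec i z) = norm1 (y - z).
Proof.
rewrite /norm1 (bigD1_ord i) //= !mxE unlift_none subrr modC0 add0r.
by apply: eq_bigr => k _; rewrite !mxE liftK.
Qed.

Lemma sdiff1_affine_vec m n (i : 'I_n.+1) (phi : 'rV[K]_m -> 'rV[K]_n) y B a :
  sdiff phi y B -> exists B', sdiff1 (fun z => affine_vec i (phi z) ord0 a) y B'.
Proof.
move=> hB; case: (unliftP i a) => [k|] ->.
  exists (col k B); apply: sdiff1_ext (coord_sdiff k hB) => // z.
  by rewrite mxE liftK.
exists 0; apply: sdiff1_ext (sdiff1_cst 1 y) => // z.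
by rewrite mxE unlift_none.
Qed.

(** Distinctness of two projective points means that a 2 by 2 minor of their coordinates is nonzero,
    an open condition. *)
Lemma charts_distinct m n (i j : 'I_n.+1) (phi psi : 'rV[K]_m -> 'rV[K]_n) y B C :
  sdiff phi y B -> sdiff psi y C ->
  affine_chart i (phi y) <> affine_chart j (psi y) ->
  nbhd y (fun z => affine_chart i (phi z) <> affine_chart j (psi z)).
Proof.
move=> hB hC neq; pose v z := affine_vec i (phi z); pose w z := affine_vec j (psi z).
have [c c0 hc] := hcoord_line_of (affine_vec_neq0 i (phi y)).
have [d d0 hd] := hcoord_line_of (affine_vec_neq0 j (psi y)).
have [e he|a [b ab]] := nonprop_minor (v := v y) (w := w y) (affine_vec_neq0 _ _).
  apply: neq; apply/esym/(@projspace_eq _ _ _ _ (d * e / c)).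
  by rewrite hd hc -/(w y) he !scalerA divfK.
have [Ba hBa] := sdiff1_affine_vec i a hB; have [Bb hBb] := sdiff1_affine_vec i b hB.
have [Ca hCa] := sdiff1_affine_vec j a hC; have [Cb hCb] := sdiff1_affine_vec j b hC.
have := sdiff1D (sdiff1M hBa hCb) (sdiff1Z (-1) (sdiff1M hBb hCa)).
move/sdiff1_neq0; rewrite mulN1r subr_eq0 => /(_ ab).
move/nbhd_mono; apply=> z /negP nz eq; apply: nz.
have [c' c'0 hc'] := hcoord_line_of (affine_vec_neq0 i (phi z)).
have [d' d'0 hd'] := hcoord_line_of (affine_vec_neq0 j (psi z)).
have E : v z = (d' / c') *: w z.
  have : c' *: v z = d' *: w z by rewrite -hc' -hd' -/(affine_chart _ _) eq.
  by move/(congr1 (GRing.scale c'^-1)); rewrite !scalerA mulVf // scale1r mulrC.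
have E' k : v z ord0 k = d' / c' * w z ord0 k by rewrite E mxE.
rewrite -/(v z) -/(w z) !E'.
by rewrite mulN1r subr_eq0 mulrAC.
Qed.

Theorem local_structure (i0 : 'I_35) (y0 : 'rV[K]_34) m (P : 'I_m -> projspace K 3) :
  nodal (quartic_form (affine_vec i0 y0)) -> injective P ->
  (forall Q, singular_locus (quartic_form (affine_vec i0 y0)) Q <->
     exists i, Q = P i) ->
  exists (m34 : (m <= 34)%N) U t, coordinates y0 U t /\ forall z, U z ->
    nodal (quartic_form (affine_vec i0 z)) /\
    exists X : 'I_m -> projspace K 3, injective X /\
      forall Q, singular_locus (quartic_form (affine_vec i0 z)) Q <->
        exists i, Q = X i /\ t z ord0 (widen_ord m34 i) = 0.
Proof.
move=> nod Pinj Psing; pose F (y : 'rV[K]_34) : {mpoly K[4]} := quartic_form (affine_vec i0 y).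
have F4 y : F y \is 4.-homog by apply: quartic_form_homog.
have /choice [c hc] := fun i => exists_hcoord (P i).
pose a i := affine_coord (c i) (P i).
have Pa i : P i = affine_chart (c i) (a i) by apply: affine_chart_coord.
pose p i j := dehomogenize (c i) (veronese K j).
have Fp i y : dehomogenize (c i) (F y) = family i0 (p i) y by apply: dehomogenize_family.
have Ps i : singular_locus (F y0) (affine_chart (c i) (a i)).
  by rewrite -Pa; apply/Psing; exists i.
pose good i (phi : 'rV[K]_34 -> 'rV[K]_3) (r : R) (y : 'rV[K]_34) :=
  [/\ exists B, sdiff phi y B,
      exists B, sdiff1 (fun y => eval_at (family i0 (p i) y) (phi y)) y B,
      forall k, eval_at (family i0 (p i) y)^`M(k) (phi y) = 0
    & forall x, norm1 (x - a i) < r ->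
        ((forall k, eval_at (family i0 (p i) y)^`M(k) x = 0) -> x = phi y) /\
        \det (hessian (family i0 (p i) y) x) != 0].
have : forall i, exists phir : ('rV[K]_34 -> 'rV[K]_3) * R,
  [/\ 0 < phir.2, phir.1 y0 = a i, nbhd y0 (good i phir.1 phir.2)
  & sdiff1 (fun y => eval_at (family i0 (p i) y) (phir.1 y)) y0
      (\col_k eval_at (p i (lift i0 k)) (a i))].
  move=> i; have /(singular_chart _ _ (F4 y0)) [_ crit] := Ps i.
  have := nod _ (Ps i); rewrite (node_chart (F4 y0) (Ps i)) Fp => hess.
  have [|phi [r h]] := @critical_point_deformation R _ _ i0 (p i) y0 (a i) _ hess.
    by move=> k; rewrite -Fp.
  by exists (phi, r).
move=> /choice [phir hphi]; pose phi i := (phir i).1.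
pose X i z := affine_chart (c i) (phi i z).
pose tau i z := eval_at (family i0 (p i) z) (phi i z).
have [m34 [B [uB hB]]] := extend_columns
  (evaluations_independent nod Pinj (fun i => (Psing (P i)).2 (ex_intro _ i erefl)) hc).
exists m34.
(* The critical values come first; linear functions complete them so that the differential at [y0]
   is the invertible matrix [B], whose first columns are the evaluations at the nodes. *)
pose T z : 'rV[K]_34 := \row_j (if insub (val j) : option 'I_m is Some i then tau i z
  else ((z - y0) *m B) ord0 j).
have Ti z i : T z ord0 (widen_ord m34 i) = tau i z.
  by rewrite mxE (valK i).
have dlin z j : sdiff1 (fun z => ((z - y0) *m B) ord0 j) z (col j B).
  apply: sdiff1_ext (coord_sdiff j (sdiff_linear B (- y0 *m B) z)) => // z'.
  by rewrite -mulmxDl.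
have dT : sdiff T y0 B.
  apply: sdiff_coords => j; case Ej : (insub (val j) : option 'I_m) => [i|].
    have ej : j = widen_ord m34 i.
      by apply: val_inj; move: Ej; case: insubP => // i' _ <- [->].
    have [_ _ _ h] := hphi i; apply: sdiff1_ext h => [z|]; first by rewrite ej Ti.
    by apply/colP => k; rewrite [RHS]mxE ej hB !mxE.
  by apply: sdiff1_ext (dlin y0 j) => // z; rewrite [RHS]mxE Ej.
have n1 : nbhd y0 (fun z => forall i, good i (phi i) (phir i).2 z).
  by apply: nbhd_forall => i; have [] := hphi i.
have h1 := nbhd_self n1.
have n2 : nbhd y0 (fun z => forall ij : 'I_m * 'I_m, ij.1 != ij.2 -> X ij.1 z <> X ij.2 z).
  apply: nbhd_forall => -[i j] /=; have [->|ij] := eqVneq i j.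
    by apply: nbhd_all.
  have [_ pi _ _] := hphi i; have [_ pj _ _] := hphi j.
  have [[Bi hBi] _ _ _] := h1 i; have [[Bj hBj] _ _ _] := h1 j.
  apply: nbhd_mono (charts_distinct (i := c i) (j := c j) hBi hBj _) _ => [|z h _]; last exact: h.
  by rewrite /phi pi pj -!Pa => /Pinj e; rewrite e eqxx in ij.
(* A common lower bound [rho] for the finitely many radii, obtained from a neighbourhood of 0. *)
have [rho [rho0 hrho]] : nbhd (0 : 'rV[K]_3) (fun x => forall i, norm1 (x - 0) < (phir i).2).
  by apply: nbhd_forall => i; apply: nbhd_ball; have [] := hphi i.
(* Every singular point of a nearby quartic lies in one of the balls in which the critical point is
   unique. *)
have n3 : nbhd y0 (fun z => forall Q, singular_locus (F z) Q ->
    exists i, hcoord Q ord0 (c i) != 0 /\ norm1 (affine_coord (c i) Q - a i) < (phir i).2).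
  have [d [d0 hd]] := singular_near nod Pinj Psing hc rho0.
  exists d; split; [exact: d0 | move=> z hz Q Qs].
  have [|i [Qi hi]] := hd (affine_vec i0 z) _ Q Qs; first by rewrite norm1_affine_vec.
  by exists i; split; [exact: Qi | have := hrho (affine_coord (c i) Q - a i); rewrite subr0 => /(_ hi i)].
have nO := nbhdI n1 (nbhdI n2 n3).
set O := (fun z => (forall i, good i (phi i) (phir i).2 z) /\ _ /\ _) in nO.
have [|U [s [oU Uy0 oV hU hs]]] := inverse_function (O := O) dT uB.
  apply: nbhd_mono nO _ => z h; split; first exact: h.
  have {}h1 := h.1.
  have /choice [A hA] : forall j, exists A, sdiff1 (fun z => T z ord0 j) z A.
    move=> j; case Ej : (insub (val j) : option 'I_m) => [i|].
      have [_ [A hA] _ _] := h1 i; exists A; apply: sdiff1_ext hA => // z'.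
      by rewrite mxE Ej.
    by exists (col j B); apply: sdiff1_ext (dlin z j) => // z'; rewrite [RHS]mxE Ej.
  exists (\matrix_(k, j) A j k ord0); apply: sdiff_coords => j.
  by apply: sdiff1_ext (hA j) => //; apply/colP => k; rewrite !mxE.
exists U, T; split.
  split=> //.
  - apply/rowP => j; rewrite [LHS]mxE [RHS]mxE.
    case: insub => [i|]; last by rewrite subrr mul0mx mxE.
    have [_ pi _ _] := hphi i; have /(singular_chart _ _ (F4 y0)) [h _] := Ps i.
    by rewrite /tau /phi pi -Fp.
  - by move=> z /hU [].
  exists s; split=> // z Uz; last by have [] := hU z Uz.
  by have [_ _ [A hA]] := hU z Uz; exists (invmx A); have [] := hs z A Uz hA.
move=> z /hU [[{}h1 [h2 h3]] _ _].
(* The partials already vanish at the critical point, so it is singular exactly when the critical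
   value is zero. *)
have XS i : singular_locus (F z) (X i z) <-> tau i z = 0.
  have [_ _ crit _] := h1 i.
  by rewrite /X (singular_chart _ _ (F4 z)) Fp; split=> [[]|] //.
have near Q : singular_locus (F z) Q -> exists i, Q = X i z /\
    \det (hessian (family i0 (p i) z) (phi i z)) != 0.
  move=> Qs; have [i [Qi hi]] := h3 Q Qs; exists i.
  have [_ _ crit /(_ _ hi) [hx hd]] := h1 i.
  have QE := affine_chart_coord Qi.
  have /(singular_chart _ _ (F4 z)) [_ critQ] :
    singular_locus (F z) (affine_chart (c i) (affine_coord (c i) Q)) by rewrite -QE.
  have ex : affine_coord (c i) Q = phi i z by apply: hx => k; rewrite -Fp.
  by split; rewrite -?ex // /X -ex.
split.
  move=> Q Qs; have [i [QE hd]] := near Q Qs; rewrite QE in Qs *.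
  by apply/(node_chart (F4 z) Qs); rewrite Fp.
exists (fun i => X i z); split.
  move=> i j e; apply/eqP; apply: contraT => ij; exfalso.
  exact: (h2 (i, j) ij).
move=> Q; split=> [Qs|[i [-> ]]].
  have [i [QE _]] := near Q Qs; exists i; split=> //.
  by rewrite Ti; apply/XS; rewrite -QE.
by rewrite Ti => /XS.
Qed.

End Local.
End LocalStructure.

(** * Strata and dual variety in the local coordinates *)

Module NodalStrata.
Import mpoly NodalQuartics NodeIndependence ZariskiNodal KummerQuartic.
Import StrictDifferentiability LocalStructure.

(** The normal form of a crossing needs the vanishing coordinates in the first places; listing [Z]
    before its complement gives the permutation. *)
Lemma gather_perm n (Z : {set 'I_n}) :
  exists s : 'S_n, forall j, (s j \in Z) = (j < #|Z|)%N.
Proof.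
pose r := enum Z ++ enum (~: Z).
have sr : size r = n by rewrite size_cat -!cardE cardsC card_ord.
have ur : uniq r.
  rewrite cat_uniq !enum_uniq andbT /=; apply/hasPn => j.
  by rewrite !mem_enum inE.
pose f (j : 'I_n) := nth j r j.
have f_inj : injective f.
  move=> j k; rewrite /f (set_nth_default j) ?sr // => /eqP.
  by rewrite nth_uniq ?sr // => /eqP/val_inj.
exists (perm f_inj) => j; rewrite permE /f nth_cat -cardE.
case: ltnP => h; first by rewrite -mem_enum mem_nth -?cardE.
have : nth j (enum (~: Z)) (j - #|Z|) \in enum (~: Z).
  apply: mem_nth; rewrite -cardE ltn_subLR // cardsC card_ord.
  exact: ltn_ord.
by rewrite mem_enum inE => /negPf.
Qed.

Lemma injective_enum (T : Type) m k (X : 'I_m -> T) (Z : {set 'I_m}) (S : T -> Prop) :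
  injective X -> (forall Q, S Q <-> exists i, Q = X i /\ i \in Z) ->
  (exists P : 'I_k -> T, injective P /\ forall Q, S Q <-> exists i, Q = P i) <->
  #|Z| = k.
Proof.
move=> Xinj SX; split=> [[P [Pinj SP]]|zk].
  have /choice [s hs] : forall i, exists j, P i = X j /\ j \in Z.
    by move=> i; apply/SX/SP; exists i.
  have s_inj : injective s.
    by move=> i j e; apply: Pinj; rewrite (hs i).1 (hs j).1 e.
  rewrite -[RHS](card_ord k) -(card_imset predT s_inj); apply: eq_card => j.
  apply/idP/imsetP => [jZ|[i _ ->]]; last by have [] := hs i.
  have /SP [i e] : S (X j) by apply/SX; exists j.
  by exists i => //; apply: Xinj; rewrite e (hs i).1.
exists (fun i => X (enum_val (cast_ord (esym zk) i))); split.
  by move=> i j /Xinj/enum_val_inj/cast_ord_inj.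
move=> Q; rewrite SX; split=> [[i [-> iZ]]|[i ->]].
  by exists (cast_ord zk (enum_rank_in iZ i)); rewrite cast_ordK enum_rankK_in.
by eexists; split; [reflexivity | apply: enum_valP].
Qed.

Section Charts.
Variable K : numClosedFieldType.

Lemma quartic_of_chart i (y : 'rV[K]_34) : exists2 c : K, c != 0 &
  quartic_of (affine_chart i y) = c *: quartic_form (affine_vec i y).
Proof.
have [c c0 hc] := hcoord_line_of (affine_vec_neq0 i y); exists c => //.
rewrite /quartic_of /quartic_form /affine_chart hc scaler_sumr.
by apply: eq_bigr => j _; rewrite mxE scalerA.
Qed.

Lemma nodal_scale (c : K) (F : {mpoly K[4]}) : c != 0 -> nodal F -> nodal (c *: F).
Proof.
move=> c0 h Q /(singular_locus_scale c0) Qs; apply: is_node_scale => //; exact: h.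
Qed.

Lemma nodal_quartics_chart k i (y : 'rV[K]_34) (F := quartic_form (affine_vec i y)) :
  (0 < k)%N ->
  nodal_quartics K k (affine_chart i y) <-> nodal F /\
  exists P : 'I_k -> projspace K 3,
    injective P /\ forall Q, singular_locus F Q <-> exists i, Q = P i.
Proof.
move=> k0; have [c c0 E] := quartic_of_chart i y.
have SE Q := singular_locus_scale c0 F Q.
split=> [[_ /card_ordP [P Pinj hP] nod]|[nod [P [Pinj hP]]]].
  split.
    have := nodal_scale (c := c^-1) (F := quartic_of (affine_chart i y)) _ nod.
    by rewrite E scalerA mulVf // scale1r invr_eq0; apply.
  by exists P; split=> // Q; rewrite -hP E; split=> /SE.
split.
- by apply/dual_varietyP; exists (P (Ordinal k0)); rewrite E; apply/SE/hP; eexists.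
- by apply/card_ordP; exists P => // Q; rewrite E -hP; split=> /SE.
- by rewrite E; apply: nodal_scale.
Qed.

Lemma dual_variety_chart i (y : 'rV[K]_34) :
  dual_variety K (affine_chart i y) <->
  exists Q, singular_locus (quartic_form (affine_vec i y)) Q.
Proof.
rewrite dual_varietyP; have [c c0 ->] := quartic_of_chart i y.
by split=> -[Q /(singular_locus_scale c0)]; exists Q.
Qed.

End Charts.

Section Strata.
Variable R : realType.
Notation K := (R[i]).

(* The j-th node persists exactly over the hypersurface t_j = 0. *)
Lemma node_coordinates m i (y : 'rV[K]_34) : (0 < m)%N ->
  nodal_quartics K m (affine_chart i y) ->
  (m <= 34)%N /\ exists U t, coordinates y U t /\ forall z, U z ->
    (dual_variety K (affine_chart i z) <->
       exists j : 'I_34, (j < m)%N /\ t z ord0 j = 0) /\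
    forall k, (0 < k)%N -> (nodal_quartics K k (affine_chart i z) <->
       #|[set j : 'I_34 | (j < m)%N && (t z ord0 j == 0)]| = k).
Proof.
move=> m0 /(nodal_quartics_chart _ _ m0) [nod [P [Pinj hP]]].
have [m34 [U [t [ct ht]]]] := local_structure nod Pinj hP.
split; first exact: m34.
exists U, t; split; [exact: ct | move=> z /ht [nz [X [Xinj hX]]]].
pose Z := [set i : 'I_m | t z ord0 (widen_ord m34 i) == 0].
have wi : injective (widen_ord m34) by move=> a b /(congr1 val) /= /val_inj.
have cZ : #|[set j : 'I_34 | (j < m)%N && (t z ord0 j == 0)]| = #|Z|.
  rewrite -(card_imset _ wi); apply: eq_card => j; rewrite inE.
  apply/andP/imsetP => [[jm tj]|[a + ->]]; last first.
    by rewrite inE => h; split; [exact: (ltn_ord a) | exact: h].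
  exists (Ordinal jm); last exact: val_inj.
  by rewrite inE (_ : widen_ord _ _ = j) //; apply: val_inj.
have hZ Q : singular_locus (quartic_form (affine_vec i z)) Q <->
    exists a, Q = X a /\ a \in Z.
  by rewrite hX; split=> -[a [e h]]; exists a; split; rewrite ?inE //;
    move: h; rewrite ?inE => /eqP.
split.
  rewrite dual_variety_chart; split=> [[Q /hX [a [_ ta]]]|[j [jm tj]]].
    by exists (widen_ord m34 a); split; [exact: (ltn_ord a) | exact: ta].
  exists (X (Ordinal jm)); apply/hX; exists (Ordinal jm); split=> //.
  by rewrite -tj; congr (t z ord0 _); apply: val_inj.
move=> k k0; rewrite nodal_quartics_chart // cZ -(injective_enum k Xinj hZ).
by split=> [[]|].
Qed.

Lemma nodal_quartics_smooth m i (y : 'rV[K]_34) : (0 < m)%N ->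
  nodal_quartics K m (affine_chart i y) ->
  exists U t, coordinates y U t /\ forall z, U z ->
    (nodal_quartics K m (affine_chart i z) <->
     forall k : 'I_34, (34 - m <= k)%N -> t z ord0 k = 0).
Proof.
move=> m0 hy; have [m34 [U [t [ct ht]]]] := node_coordinates m0 hy.
(* The nodes occupy the first [m] coordinates, whereas [smooth_of_dim] asks for the vanishing of the
   last ones. *)
pose s : 'S_34 := perm (@rev_ord_inj 34).
have [oU Uy ty _ _] := ct.
exists U, (fun z => (t z - t y) *m perm_mx s^-1); split.
  by apply: coordinates_restrict ct oU _ Uy _ => //; apply: unitmx_perm.
move=> z Uz; have [_ /(_ m m0) ->] := ht z Uz.
have tE k : ((t z - t y) *m perm_mx s^-1) ord0 k = t z ord0 (rev_ord k).
  by rewrite -col_permE mxE ty subr0 permE.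
have cm : #|[set j : 'I_34 | (j < m)%N]| = m.
  have wi : injective (widen_ord m34) by move=> a b /(congr1 val) /= /val_inj.
  rewrite -[RHS](card_ord m) -(card_imset predT wi); apply: eq_card => j.
  rewrite inE; apply/idP/imsetP => [jm|[a _ ->]]; last exact: (ltn_ord a).
  by exists (Ordinal jm) => //; apply: val_inj.
have sub : [set j : 'I_34 | (j < m)%N && (t z ord0 j == 0)] \subset
    [set j : 'I_34 | (j < m)%N].
  by apply/fintype.subsetP => j; rewrite !inE => /andP[].
split=> [e k mk|h].
  have /eqP eqs : [set j : 'I_34 | (j < m)%N && (t z ord0 j == 0)] ==
      [set j : 'I_34 | (j < m)%N] by rewrite eqEcard sub e cm leqnn.
  have : rev_ord k \in [set j : 'I_34 | (j < m)%N].
    by rewrite inE /=; have := ltn_ord k; lia.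
  by rewrite -eqs inE => /andP[_ /eqP tk]; rewrite tE.
rewrite -[RHS]cm; apply: eq_card => j; rewrite !inE.
case jm: (j < m)%N => //=; apply/eqP.
rewrite -[j]rev_ordK -tE; apply: h => /=.
by have := ltn_ord j; lia.
Qed.

Lemma nodal_quartics_nonempty m : (0 < m <= 16)%N ->
  exists i (y : 'rV[K]_34), nodal_quartics K m (affine_chart i y).
Proof.
move=> /andP[m0 m16].
have [i [y [P [nod Pinj hP]]]] := sixteen_nodes (R[i] : numClosedFieldType).
have /(node_coordinates (isT : 0 < 16)%N) [_ [U [t [ct ht]]]] :
    nodal_quartics K 16 (affine_chart i y).
  by apply/nodal_quartics_chart => //; split=> //; exists P.
have [oU Uy ty _ [s [oV _ _]]] := ct.
have [d [d0 hd]] : nbhd 0 (fun w => exists z, U z /\ t z = w).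
  by apply: oV; exists y.
(* The first [m] nodes persist and the remaining ones are smoothed. With 34 entries of modulus at
   most d / 35, the sum of the moduli stays below d. *)
pose w : 'rV[K]_34 := \row_j if (m <= j < 16)%N then (d / 35)%:C%C else 0.
have w0 : d / 35 != 0 by rewrite mulf_neq0 ?invr_eq0 ?pnatr_eq0 // gt_eqF.
have [|z [Uz tz]] := hd w.
  rewrite subr0; apply: (@le_lt_trans _ _ (\sum_(j < 34) d / 35)).
    apply: ler_sum => j _; rewrite mxE; case: ifP => _.
      rewrite /modC normc_def /= expr0n addr0 sqrtr_sqr.
      by rewrite ger0_norm // divr_ge0 // ltW.
    by rewrite modC0 divr_ge0 // ltW.
  by rewrite sum_cst; lra.
exists i, z; have [_ /(_ m m0) ->] := ht z Uz.
have m34 : (m <= 34)%N by apply: leq_trans m16 _.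
have wi : injective (widen_ord m34) by move=> a b /(congr1 val) /= /val_inj.
rewrite -[RHS](card_ord m) -(card_imset predT wi); apply: eq_card => j.
rewrite inE tz mxE; apply/andP/imsetP => [[j16]|[a _ ->]]; last first.
  have am := ltn_ord a.
  by rewrite /= (leq_trans am m16) leqNgt am /= eqxx.
case: ifP => [_|].
  by rewrite eq_complex /= (negPf w0).
rewrite j16 andbT => /negbT; rewrite -ltnNge => jm _.
by exists (Ordinal jm) => //; apply: val_inj.
Qed.

Lemma dual_variety_normal_crossings m i (y : 'rV[K]_34) : (0 < m)%N ->
  nodal_quartics K m (affine_chart i y) ->
  exists d : R, 0 < d /\ forall B : 'rV[K]_34 -> Prop,
    open1 B -> (forall z, B z -> norm1 (z - y) < d) -> forall q, B q ->
    exists U t (k : nat), [/\ coordinates q U t, forall z, U z -> B z, (k <= 34)%N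
      & forall z, U z -> (dual_variety K (affine_chart i z) <->
          \prod_(j < 34 | (j < k)%N) t z ord0 j = 0)].
Proof.
move=> m0 hy; have [_ [U [t [ct ht]]]] := node_coordinates m0 hy.
have [oU Uy ty dt _] := ct.
have [d [d0 hd]] := oU y Uy; exists d; split=> // B oB Bd q Bq.
have BU z : B z -> U z by move=> /Bd /hd.
pose Z := [set j : 'I_34 | (j < m)%N && (t q ord0 j == 0)].
have [s hs] := gather_perm Z.
(* Near [q] only coordinates that vanish at [q] can vanish, so on [V] the other factors of the
   equation are units. The outer [nbhd] makes [V] open. *)
pose V z := nbhd z (fun z => B z /\ forall j, j \notin Z -> (j < m)%N -> t z ord0 j != 0).
have Vq : V q.
  apply: nbhdI; first exact: oB.
  apply: nbhd_forall => j; have [jZ|jZ] := boolP (j \in Z); first exact: nbhd_all.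
  have [jm|jm] := boolP (j < m)%N; last exact: nbhd_all.
  have [A hA] := dt q (BU q Bq).
  have tj : t q ord0 j != 0 by move: jZ; rewrite inE jm.
  by apply: nbhd_mono (sdiff1_neq0 (coord_sdiff j hA) tj) _.
have VB z : V z -> B z by move/nbhd_self => [].
exists V, (fun z => (t z - t q) *m perm_mx s^-1), #|Z|; split=> //.
- apply: coordinates_restrict ct _ _ Vq _; first exact: open1_nbhd.
    by move=> z /VB/BU.
  exact: unitmx_perm.
- by rewrite -[X in (_ <= X)%N](card_ord 34) max_card.
move=> z Vz; have [-> _] := ht z (BU z (VB z Vz)).
have tE k : ((t z - t q) *m perm_mx s^-1) ord0 k = t z ord0 (s k) - t q ord0 (s k).
  by rewrite -col_permE !mxE.
have [_ nz] := nbhd_self Vz.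
split=> [[j [jm tj]]|/eqP/prodf_eq0 [k kZ]].
  have jZ : j \in Z by apply: contraT => /nz/(_ jm); rewrite tj eqxx.
  have e : s (s^-1%g j) = j by rewrite permKV.
  have kZ : (s^-1%g j < #|Z|)%N by rewrite -hs e.
  apply/eqP/prodf_eq0; exists (s^-1%g j) => //; rewrite tE e tj sub0r oppr_eq0.
  by move: jZ; rewrite inE => /andP[].
rewrite -hs inE in kZ; case/andP: kZ => km /eqP tq.
by rewrite tE tq subr0 => /eqP tk; exists (s k).
Qed.

End Strata.
End NodalStrata.

From mathcomp Require Import all_classical all_reals all_analysis.
Import Order.TTheory GRing.Theory Num.Theory numFieldNormedType.Exports.
Local Open Scope classical_set_scope.
Local Open Scope ring_scope.

(** * Passage to the analytic topology, holomorphy and Euclidean balls *)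

Module ComplexAnalysis.
Import StrictDifferentiability ImplicitFunction LocalStructure.

(** Differentiability is a condition on the canonical differential; uniqueness of the linear part
    identifies it with [df]. *)
Lemma differentiable_linear_approx (K : numFieldType) (V W : normedModType K)
    (f : V -> W) (x : V) (df : {linear V -> W}) : continuous df ->
  (forall e : K, 0 < e ->
     \forall h \near (0 : V), `|f (h + x) - f x - df h| <= e * `|h|) ->
  differentiable f x.
Proof.
move=> dfc hf.
have E : f \o shift x = cst (f x) + df +o_ 0 id.
  apply/eqaddoP => e e0; move: (hf e e0); apply: filterS => h.
  by rewrite /= opprD addrA.
by have dE := diff_unique dfc E; apply/diff_locallyP; rewrite dE.
Qed.

Section Bridge.
Variable R : realType.
Local Notation K := (Cplx R).

Lemma mx_norm_le n (v : 'rV[K]_n) (c : K) : 0 <= c ->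
  (forall j, `|v ord0 j| <= c) -> `|v| <= c.
Proof.
move=> c0 h; rewrite /Num.norm /= mx_normE -[c]/((NngNum c0)%:num) num_le.
apply/bigmax_leP; split=> [|[i j] _]; first by rewrite -num_le.
by rewrite -num_le /= ord1 h.
Qed.

Lemma le_mx_norm n (v : 'rV[K]_n) j : `|v ord0 j| <= `|v|.
Proof.
rewrite [leRHS]/Num.norm /= mx_normE -[leLHS]nngE num_le.
exact: (le_bigmax _ _ (ord0, j)).
Qed.

Lemma mx_norm_le_norm1 n (v : 'rV[K]_n) : `|v| <= (norm1 v)%:C%C.
Proof.
apply: mx_norm_le => [|j]; first by rewrite lecR norm1_ge0.
by rewrite modCE lecR modC_le_norm1.
Qed.

Lemma norm1_le_mx_norm n (v : 'rV[K]_n) : (norm1 v)%:C%C <= n%:R * `|v|.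
Proof.
rewrite /norm1 rmorph_sum /= -[n in n%:R]card_ord -sum1_card natr_sum mulr_suml.
by apply: ler_sum => j _; rewrite mul1r -modCE le_mx_norm.
Qed.

Lemma nbhdP n (q : 'rV[K]_n) (P : set 'rV[K]_n) : nbhd q P <-> nbhs q P.
Proof.
split=> [[d [d0 hd]]|/nbhs_ballP [e /= e0 he]].
  (* The sum norm is at most n times the maximum norm; dividing by [n.+1] makes the inequality
     strict and includes n = 0. *)
  apply/nbhs_ballP; exists (d / n.+1%:R)%:C%C => /=; first by rewrite ltcR divr_gt0.
  rewrite mx_norm_ball => y /= qy; apply: hd; rewrite norm1_dist -ltcR.
  apply: le_lt_trans (norm1_le_mx_norm _) _.
  apply: (@le_lt_trans _ _ (n%:R * (d / n.+1%:R)%:C%C)).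
    by rewrite ler_wpM2l // ltW.
  rewrite -[n%:R](rmorph_nat (real_complex R)) -rmorphM ltcR.
  rewrite mulrA ltr_pdivrMr // mulrC ltr_pM2l // ltr_nat //.
exists (complex.Re e).
have eE : e = (complex.Re e)%:C%C by rewrite RRe_real // gtr0_real.
have Re0 : 0 < complex.Re e by rewrite -ltcR -eE.
split=> // y hy; apply: he; rewrite mx_norm_ball /= eE.
by apply: le_lt_trans (mx_norm_le_norm1 _) _; rewrite ltcR norm1_dist.
Qed.

Lemma open1P n (U : set 'rV[K]_n) : open1 U -> open U.
Proof. by move=> oU; rewrite openE => z /oU /nbhdP. Qed.

Lemma mulmxr_continuous n (A : 'M[K]_n) : continuous (mulmxr A : 'rV[K]_n -> 'rV[K]_n).
Proof.
move=> x P /nbhdP hP; apply/nbhdP.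
exact: (sdiff_continuous (sdiff_mulmx A x) hP).
Qed.

Lemma sdiff_differentiable n (f : 'rV[K]_n -> 'rV[K]_n) (x : 'rV[K]_n) (A : 'M[K]_n) :
  sdiff f x A -> differentiable f x.
Proof.
move=> hf.
apply: (@differentiable_linear_approx _ _ _ _ _ (mulmxr A)).
  exact: mulmxr_continuous.
move=> e e0; apply/nbhdP.
have eE : e = (complex.Re e)%:C%C by rewrite RRe_real // gtr0_real.
have Re0 : 0 < complex.Re e / n.+1%:R by rewrite divr_gt0 // -ltcR -eE.
have [d [d0 hd]] := hf _ Re0; exists d; split=> // h; rewrite subr0 => hh.
have := hd (h + x) x; rewrite addrK subrr norm1_0 => /(_ hh d0) le1.
apply: le_trans (mx_norm_le_norm1 _) _.
have : ((complex.Re e / n.+1%:R * norm1 h)%:C%C : K) <= e * `|h|.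
  rewrite rmorphM /= rmorphM /= -eE fmorphV rmorph_nat -mulrA.
  rewrite ler_wpM2l ?(ltW e0) // mulrC ler_pdivrMr ?ltr0n // mulrC.
  apply: le_trans (norm1_le_mx_norm _) _.
  by rewrite ler_wpM2r // ler_nat.
by apply: le_trans; rewrite lecR.
Qed.

Lemma coordinates_analytic n (q : 'rV[K]_n) U t :
  coordinates q U t -> analytic_coordinates q U t.
Proof.
move=> [oU Uq tq dt [s [oV ds sK]]].
have imE : [set w | exists z, U z /\ t z = w] = t @` U.
  by apply/seteqP; split=> w [z]; [case=> Uz <-; exists z | move=> Uz <-; exists z].
split=> //; first exact: open1P.
  by move=> z /dt [B /sdiff_differentiable].
exists s; split=> //; first by rewrite -imE; apply: open1P.
by move=> _ [z Uz <-]; have [B /sdiff_differentiable] := ds z Uz.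
Qed.

Lemma euclidean_ballE n (c : 'rV[K]_n) (r : R) z :
  euclidean_ball c r z <-> \sum_j modC (z ord0 j - c ord0 j) ^+ 2 < r ^+ 2.
Proof.
rewrite /euclidean_ball /= -ltcR rmorph_sum /=.
by under [X in _ <-> is_true (X < _)]eq_bigr => j _ do rewrite rmorphXn /= -modCE.
Qed.

Lemma euclidean_ball_coord n (c : 'rV[K]_n) (r : R) z j : 0 < r ->
  euclidean_ball c r z -> modC (z ord0 j - c ord0 j) < r.
Proof.
move=> r0 /euclidean_ballE h.
rewrite -(ltr_pXn2r (ltn0Sn 1)) ?nnegrE ?modC_ge0 ?(ltW r0) //.
apply: le_lt_trans h; rewrite (bigD1 j) //= lerDl.
by apply: sumr_ge0 => k _; rewrite exprn_ge0 // modC_ge0.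
Qed.

Lemma euclidean_ball_open n (c : 'rV[K]_n) (r : R) : 0 < r ->
  open1 (euclidean_ball c r).
Proof.
move=> r0 z hz; have hc j := euclidean_ball_coord j r0 hz.
move/euclidean_ballE: hz; set E := \sum_j _ => hE.
(* From (a + e)^2 <= a^2 + (2 r + 1) e for 0 <= a < r and 0 <= e <= 1, applied to each
   coordinate. *)
pose d := Order.min 1 ((r ^+ 2 - E) / (2 * r + 1)).
have d0 : 0 < d by rewrite lt_min ltr01 divr_gt0 ?subr_gt0 //; lra.
exists d; split=> // y; rewrite lt_min => /andP[y1].
rewrite ltr_pdivlMr; last by lra.
move=> y2; apply/euclidean_ballE.
have : \sum_j modC (y ord0 j - c ord0 j) ^+ 2 <=
    \sum_j (modC (z ord0 j - c ord0 j) ^+ 2 + (2 * r + 1) * modC ((y - z) ord0 j)).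
  apply: ler_sum => j _.
  have h1 : modC (y ord0 j - c ord0 j) <= modC (z ord0 j - c ord0 j) + modC ((y - z) ord0 j).
    apply: le_trans (modCD _ _); rewrite !mxE.
    by rewrite [X in _ <= modC X]addrC addrA subrK.
  have h2 : modC ((y - z) ord0 j) <= 1 by apply: le_trans (modC_le_norm1 _ j) (ltW y1).
  have := hc j; have := modC_ge0 (z ord0 j - c ord0 j).
  have := modC_ge0 ((y - z) ord0 j); have := modC_ge0 (y ord0 j - c ord0 j).
  move: h1 h2; move: (modC _) (modC _) (modC _) => a b e *; nra.
by rewrite big_split /= -mulr_sumr -/(norm1 _) -/E; move: (\sum_j _) => *; lra.
Qed.

Lemma euclidean_ball_small n (c y z : 'rV[K]_n) (r : R) : 0 < r ->
  euclidean_ball c r y -> euclidean_ball c r z -> norm1 (z - y) <= n%:R * (2 * r).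
Proof.
move=> r0 hy hz; rewrite -sum_cst; apply: ler_sum => j _; rewrite !mxE.
have := modCD (z ord0 j - c ord0 j) (c ord0 j - y ord0 j); rewrite addrA subrK.
rewrite [modC (c _ _ - _)]modCB.
have := euclidean_ball_coord j r0 hy; have := euclidean_ball_coord j r0 hz; lra.
Qed.

End Bridge.
End ComplexAnalysis.

Unset Implicit Arguments.

Theorem corollary2p3 (R : realType) (delta : nat)
    (hdelta : (1 <= delta <= 16)%N) :
  [/\ zariski_locally_closed (nodal_quartics (Cplx R) delta),
      smooth_of_dim (nodal_quartics (Cplx R) delta) (34 - delta)
    & forall (i : 'I_35) (y : 'rV[Cplx R]_34),
        nodal_quartics (Cplx R) delta (affine_chart i y) ->
        exists eps : R, 0 < eps /\
          forall (c : 'rV[Cplx R]_34) (r : R),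
            0 < r < eps -> euclidean_ball c r y ->
            normal_crossings (euclidean_ball c r)
              (euclidean_ball c r `&`
               [set z | dual_variety (Cplx R) (affine_chart i z)])].
Proof.
have /andP[delta0 _] := hdelta; split.
- exact: ZariskiNodal.nodal_quartics_locally_closed.
- split; first exact: leq_subr.
    have [i [y hy]] := NodalStrata.nodal_quartics_nonempty R hdelta.
    by exists (affine_chart i y).
  move=> i y hy.
  have [U [t [ct ht]]] := NodalStrata.nodal_quartics_smooth delta0 hy.
  by exists U, t; split=> //; apply: ComplexAnalysis.coordinates_analytic.
move=> i y hy.
have [d [d0 hd]] := NodalStrata.dual_variety_normal_crossings delta0 hy.
(* Two points of a ball of radius r in 34 coordinates are at [norm1]-distance at most 34 times 2 r,
   that is 68 r. *)
exists (d / 68); split; first by rewrite divr_gt0.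
move=> c r /andP[r0 rd] By; split; first by move=> z [].
move=> q Bq.
have [||U [t [k [ct UB k34 hU]]]] := hd (euclidean_ball c r) _ _ q Bq.
- exact: ComplexAnalysis.euclidean_ball_open.
- move=> z Bz; apply: le_lt_trans (ComplexAnalysis.euclidean_ball_small r0 By Bz) _.
  by lra.
exists U, t, k; split=> //; first exact: ComplexAnalysis.coordinates_analytic.
move=> z Uz; rewrite -hU //; split=> [[]//|h]; split=> //; exact: UB.
Qed.
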